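(* Let $X$ be a compact metric space with distance $d$, let $Y\subseteq\mathbb{R}$, and let $\rho$ be an unknown Borel probability measure on $X\times Y$ with marginal $\rho_X$ on $X$, such that the output $y$ is bounded by a positive constant $\rho$-almost surely. Assume: (i) (covering) there are constants $\eta,C_\eta>0$ with $\mathcal{N}(X,r)\le C_\eta r^{-\eta}$ for all $0<r\le 1$, where $\mathcal{N}(X,r)$ is the least number of open balls of radius $r$ covering $X$; (ii) $K:X\times X\to\mathbb{R}$ is a positive-definite reproducing kernel on $X$ such that the closed linear span of $\{K(\cdot,x):x\in X\}$ in $C(X)$ (sup norm) equals $C(X)$; (iii) for every $m\in\mathbb{N}$ and every pairwise distinct $x_1,\dots,x_m\in X$, writing ${\bf x}=(x_j)_{j=1}^m$, $K[{\bf x}]$ for the $m\times m$ matrix with $(K[{\bf x}])_{j,k}=K(x_k,x_j)$ and $K_{\bf x}(x)=(K(x,x_j):j=1,\dots,m)^T$, one has $\|K[{\bf x}]^{-1}K_{\bf x}(x)\|_1\le 1$ for all $x\in X$; (iv) (Lipschitz) there are constants $\alpha,C_\alpha>0$ with $|K(x,t)-K(x,t')|\le C_\alpha d(t,t')^\alpha$ for all $x,t,t'\in X$; (v) $f_\rho\in\mathrm{ran}(L_K^s)$ for some $s>0$. Given a sample ${\bf z}=\{(x_j,y_j)\}_{j=1}^m$ drawn i.i.d. from $\rho$ (with pairwise distinct $x_j$) and $\lambda>0$, let $\boldsymbol{c}_{{\bf z},\lambda}$ be a minimizer over $\boldsymbol{c}\in\mathbb{R}^m$ of $$\frac1m\sum_{j=1}^m|K^{\bf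 x}(x_j)\boldsymbol{c}-y_j|^2+\lambda\|\boldsymbol{c}\|_1,$$ where $K^{\bf x}(x)$ is the row vector $(K(x_j,x):j=1,\dots,m)$, and set $f_{{\bf z},\lambda}(x)=K^{\bf x}(x)\boldsymbol{c}_{{\bf z},\lambda}$. Then there exists a constant $C>0$ such that, with the choice $\lambda=m^{-\frac12\frac{1}{1+\eta/\alpha}\frac{1+s}{1+2s}}$, for all $0<\delta<1$, with confidence $1-\delta$ (over the draw of ${\bf z}$), $$\mathcal{E}(f_{{\bf z},\lambda})-\mathcal{E}(f_\rho)\le C m^{-\frac{s}{1+2s}\frac{1}{1+\eta/\alpha}}\log\frac{2+2m}{\delta}\quad\text{when }0<s<1,$$ and $$\mathcal{E}(f_{{\bf z},\lambda})-\mathcal{E}(f_\rho)\le C m^{-\frac{1}{3(1+\eta/\alpha)}}\log\frac{1+m}{\delta}\quad\text{when }s\ge 1.$$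
   Context: $\mathcal{E}(f):=\int_{X\times Y}|f(x)-y|^2\,d\rho$. The regression function is $f_\rho(x):=\int_Y y\,d\rho(y|x)$, with $\rho(y|x)$ the conditional distribution. $L^2_{\rho_X}$ is the space of square-integrable functions with respect to $\rho_X$. $L_K$ is the operator on $L^2_{\rho_X}$ given by $L_Kf:=\int_X K(t,\cdot)f(t)\,d\rho_X(t)$; with $\{\phi_j\}$ an orthonormal basis of $L^2_{\rho_X}$ of eigenfunctions of $L_K$ with eigenvalues $\lambda_1\ge\lambda_2\ge\cdots$, the condition $f_\rho\in\mathrm{ran}(L_K^s)$ means $f_\rho=\sum_j\lambda_j^s a_j\phi_j$ for some $h=\sum_j a_j\phi_j\in L^2_{\rho_X}$. $\|\cdot\|_1$ is the $\ell^1$ norm on $\mathbb{R}^m$. *)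

(* Defs.v *)
From HB Require Import structures.
From mathcomp Require Import all_boot all_order all_algebra.
From mathcomp Require Import all_classical all_reals all_analysis.
Set Implicit Arguments. Unset Strict Implicit. Unset Printing Implicit Defensive.
Import Order.TTheory GRing.Theory Num.Theory.
Local Open Scope classical_set_scope.
Local Open Scope ring_scope.

Section Defs.
Context {R : realType}.

Definition is_metric (X : Type) (d : X -> X -> R) : Prop :=
  [/\ (forall x y, 0 <= d x y), (forall x y, d x y = 0 <-> x = y),
      (forall x y, d x y = d y x) & (forall x y z, d x z <= d x y + d y z)].

Definition dball (X : Type) (d : X -> X -> R) (x : X) (r : R) : set X :=
  [set y | d x y < r].

Definition d_open (X : Type) (d : X -> X -> R) (A : set X) : Prop :=
  forall x, A x -> exists2 r : R, 0 < r & dball d x r `<=` A.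

Definition d_compact (X : Type) (d : X -> X -> R) : Prop :=
  forall (I : Type) (U : I -> set X), (forall i, d_open d (U i)) ->
    (forall x, exists i, U i x) ->
    exists (n : nat) (f : 'I_n -> I), forall x, exists k, U (f k) x.

Definition d_continuous (X : Type) (d : X -> X -> R) (f : X -> R) : Prop :=
  forall x (e : R), 0 < e -> exists2 del : R, 0 < del &
    forall y, d x y < del -> `|f x - f y| < e.

Definition covering_cond (X : Type) (d : X -> X -> R) (eta Ceta : R) : Prop :=
  forall r : R, 0 < r -> r <= 1 ->
    exists (n : nat) (c : 'I_n -> X),
      n%:R <= Ceta * r `^ (- eta) /\ forall x, exists i, dball d (c i) r x.

Definition pd_kernel (X : Type) (K : X -> X -> R) : Prop :=
  (forall x t, K x t = K t x) /\
  forall (m : nat) (x : 'I_m -> X), injective x ->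
    forall c : 'I_m -> R, (exists j, c j != 0) ->
      0 < \sum_(j < m) \sum_(k < m) c j * c k * K (x j) (x k).

Definition universal_kernel (X : Type) (d : X -> X -> R) (K : X -> X -> R) : Prop :=
  forall f : X -> R, d_continuous d f -> forall e : R, 0 < e ->
    exists (n : nat) (t : 'I_n -> X) (c : 'I_n -> R),
      forall x, `|f x - \sum_(i < n) c i * K x (t i)| <= e.

Definition Kmat (X : Type) (K : X -> X -> R) (m : nat) (x : 'I_m -> X) : 'M[R]_m :=
  \matrix_(j < m, k < m) K (x k) (x j).

Definition Kcol (X : Type) (K : X -> X -> R) (m : nat) (x : 'I_m -> X) (t : X) : 'cV[R]_m :=
  \col_(j < m) K t (x j).

Definition l1norm (m : nat) (v : 'cV[R]_m) : R := \sum_(j < m) `|v j ord0|.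

Definition l1_cond (X : Type) (K : X -> X -> R) : Prop :=
  forall (m : nat) (x : 'I_m -> X), injective x ->
    forall t, l1norm (invmx (Kmat K x) *m Kcol K x t) <= 1.

Definition holder_cond (X : Type) (d : X -> X -> R) (K : X -> X -> R) (alpha Calpha : R) : Prop :=
  forall x t t', `|K x t - K x t'| <= Calpha * d t t' `^ alpha.

End Defs.

Section Prob.
Context {R : realType} {dX : measure_display} {X : measurableType dX}.
Local Open Scope ereal_scope.

(** the sigma algebra of X is the Borel sigma algebra of d (generated by
    open balls; equal to the Borel sets for the separable metric space X) *)
Definition borel_for (d : X -> X -> R) : Prop :=
  @measurable _ X = <<s [set B | exists x r, B = dball d x r] >>.

(** ρ as measure on X × R; integrals against ρ_X are written as integrals
    against ρ of functions of the first coordinate *)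
Variable rho : probability (X * R)%type R.

Definition lsq_error (f : X -> R) : \bar R :=
  \int[rho]_z ((f z.1 - z.2) ^+ 2)%:E.

(** f is (a version of) the regression function f_ρ(x) = ∫ y dρ(y|x) *)
Definition is_regression (f : X -> R) : Prop :=
  measurable_fun setT f /\
  forall A : set X, measurable A ->
    \int[rho]_(z in A `*` setT) (z.2)%:E = \int[rho]_(z in A `*` setT) (f z.1)%:E.

Definition L2X (g : X -> R) : Prop :=
  measurable_fun setT g /\ rho.-integrable setT (fun z => ((g z.1) ^+ 2)%:E).

(** f_ρ ∈ ran(L_K^s): there is an orthonormal basis {φ_j}_{j ∈ J} (J ⊆ ℕ)
    of L^2_{ρ_X} made of eigenfunctions of L_K with eigenvalues lam_j, and
    h = Σ a_j φ_j ∈ L^2 with f_ρ = Σ lam_j^s a_j φ_j (convergence in L^2) *)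
Definition in_range_LKs (K : X -> X -> R) (s : R) (f : X -> R) : Prop :=
  exists (J : set nat) (phi : nat -> X -> R) (lam : nat -> R) (a : nat -> R),
  [/\ (forall j, J j -> L2X (phi j)),
      (forall i j, J i -> J j ->
         \int[rho]_z ((phi i z.1 * phi j z.1)%R)%:E = (if i == j then 1 else 0)),
      (forall g, L2X g -> (forall j, J j -> \int[rho]_z ((g z.1 * phi j z.1)%R)%:E = 0) ->
         {ae rho, forall z : X * R, g z.1 = 0%R}),
      (forall j, J j -> {ae rho, forall z : X * R,
         \int[rho]_w ((K w.1 z.1 * phi j w.1)%R)%:E = ((lam j * phi j z.1)%R)%:E}) &
      (exists M : R, forall n, (\sum_(0 <= j < n | j \in J) a j ^+ 2 <= M)%R) /\
      ((fun n => \int[rho]_z ((f z.1 - \sum_(0 <= j < n | j \in J) lam j `^ s * a j * phi j z.1) ^+ 2)%:E)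
        @ \oo --> 0) ].

End Prob.

Section Sample.
Context {R : realType} {dX : measure_display} {X : measurableType dX}.

Definition l1_objective (K : X -> X -> R) (m : nat) (x : 'I_m -> X) (y : 'I_m -> R)
    (lambda : R) (c : 'I_m -> R) : R :=
  m%:R^-1 * \sum_(j < m) (\sum_(k < m) K (x k) (x j) * c k - y j) ^+ 2
  + lambda * \sum_(k < m) `|c k|.

Definition is_l1_minimizer (K : X -> X -> R) (m : nat) (x : 'I_m -> X) (y : 'I_m -> R)
    (lambda : R) (c : 'I_m -> R) : Prop :=
  forall c' : 'I_m -> R, l1_objective K x y lambda c <= l1_objective K x y lambda c'.

Definition kernel_fun (K : X -> X -> R) (m : nat) (x : 'I_m -> X) (c : 'I_m -> R) (t : X) : R :=
  \sum_(j < m) K (x j) t * c j.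

Definition iid_sample {dO : measure_display} {O : measurableType dO}
    (P : probability O R) (rho : probability (X * R)%type R) (m : nat)
    (Z : 'I_m -> O -> (X * R)%type) : Prop :=
  [/\ (forall i, measurable_fun setT (Z i)),
      (forall i (A : set (X * R)), measurable A -> P (Z i @^-1` A) = rho A) &
      (forall A : 'I_m -> set (X * R), (forall i, measurable (A i)) ->
         P (\bigcap_(i in [set: 'I_m]) (Z i @^-1` A i)) =
         (\prod_(i < m) P (Z i @^-1` A i))%E)].

End Sample.

(* Main.v *)
Require Import Defs.
From HB Require Import structures.
From mathcomp Require Import all_boot all_order all_algebra.
From mathcomp Require Import all_classical all_reals all_analysis.
From mathcomp Require Import measurable_realfun ring lra.
Set Implicit Arguments. Unset Strict Implicit. Unset Printing Implicit Defensive.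
Import Order.TTheory GRing.Theory Num.Theory.
Import numFieldNormedType.Exports.
Local Open Scope classical_set_scope.
Local Open Scope ring_scope.

(** The l1 condition makes interpolation on the sample a contraction for the
    coefficient norm, so the minimizer f = K^x c competes with every kernel
    expansion g that does not depend on the sample.  Up to sampling errors,
      E(f) - E(frho) <= ||g - frho||^2 + lambda (|g|_1 - |c|_1).
    Sampling errors are controlled by a one-sided Bernstein inequality, with the
    variance absorbed in the excess risk, and a union bound over step functions
    on a net of X; this costs m^(-theta) / lambda^2 up to logarithms, where
    theta = 1 / (1 + eta/alpha).

    For s <= 1 the comparison function is g = L_K u with u = L_K^(-1) r(L_K) frho,
    r(l) = 1 - (k/(l+k))^2 and k^(1+s) = lambda, and the term -|c|_1 is dropped.
    For s > 1 this only gives a bias of order lambda, too large for the prescribed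
    lambda, and -|c|_1 has to be exploited: it is enough to exhibit a function P
    with |P| <= 1 that is close to the sign of u and of the form P = L_K q, since
    then |c|_1 >= sum_k c_k P(x_k) = <q, f>.  The l1 condition yields a maximum
    principle (inverse Gram matrices are diagonally dominant), whence odd normal
    contractions decrease the energy, and P = L_K (L_K + k)^(-1) clamp(u/tau)
    does the job.  The bias becomes lambda^(2 sigma/(1+sigma)), sigma = min(s, 2),
    which suffices for every s. *)

(** * Finite kernel expansions *)

(** The l1 hypothesis speaks of finitely many distinct points only. The maximum principle and the
    dual certificate are therefore proved for finite Gram matrices and carried over to [L_K] by a
    discretization of the measure whose error is uniform over Hoelder functions with a given
    constant; this is also why nodes must be kept pairwise distinct throughout. Nothing is known
    about the measurability of the minimizer in the sample. The good event is thus cut out by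
    finitely many deterministic functions, the step functions near which every possible minimizer
    lies, and the minimizer enters only afterwards, pointwise on that event. The relation
    [k^(1+s) = lambda] equates, for [s <= 1], the squared bias [k^(2s)] with the penalty
    [lambda |u|], which is of order [lambda k^(s-1)]. The factor [1 / lambda^2] arises because the
    coefficient norm of the minimizer is only known to be at most [M^2 / lambda], so that losses
    have the size of its square. *)

Section KernelAlgebra.
Context {R : realType} {dX : measure_display} {X : measurableType dX} (K : X -> X -> R).
Hypotheses (pdK : pd_kernel K) (l1K : l1_cond K).

Let symK x t : K x t = K t x. Proof. exact: pdK.1. Qed.

Lemma pd_ge0 n (t : 'I_n -> X) (c : 'I_n -> R) : injective t ->
  0 <= \sum_j c j * kernel_fun K t c (t j).
Proof.
move=> it; have -> : \sum_j c j * kernel_fun K t c (t j) =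
    \sum_(j < n) \sum_(k < n) c j * c k * K (t j) (t k).
  apply: eq_bigr => j _; rewrite /kernel_fun mulr_sumr.
  by apply: eq_bigr => k _; rewrite symK; ring.
have [[j cj]|/forallNP c0] := pselect (exists j, c j != 0).
  by apply/ltW/pdK.2 => //; exists j.
rewrite big1 // => j _; rewrite big1 // => k _.
by have /negP := c0 j; rewrite negbK => /eqP ->; rewrite !mul0r.
Qed.

Lemma pd_eq0 n (t : 'I_n -> X) (c : 'I_n -> R) : injective t ->
  \sum_j c j * kernel_fun K t c (t j) <= 0 -> forall j, c j = 0.
Proof.
move=> it; have -> : \sum_j c j * kernel_fun K t c (t j) =
    \sum_(j < n) \sum_(k < n) c j * c k * K (t j) (t k).
  apply: eq_bigr => j _; rewrite /kernel_fun mulr_sumr.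
  by apply: eq_bigr => k _; rewrite symK; ring.
move=> le0 j; apply/eqP/negPn/negP => cj; move: le0.
by rewrite leNgt pdK.2 //; exists j.
Qed.

Lemma Kmat_unit n (t : 'I_n -> X) : injective t -> Kmat K t \in unitmx.
Proof.
move=> it; rewrite -row_free_unit; apply/inj_row_free => v vG.
apply/rowP => j; rewrite mxE.
apply: (@pd_eq0 _ t (fun i => v ord0 i)) => //.
rewrite big1 // => i _; suff -> : kernel_fun K t (fun i => v ord0 i) (t i) = 0 by rewrite mulr0.
move/rowP/(_ i) : vG; rewrite !mxE => vG; rewrite -[RHS]vG /kernel_fun.
by apply: eq_bigr => k _; rewrite mxE mulrC symK.
Qed.

Lemma kernel_fun_Kmat n (t : 'I_n -> X) (c : 'I_n -> R) x :
  kernel_fun K t c x = ((\row_j c j) *m Kcol K t x) ord0 ord0.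
Proof. by rewrite !mxE; apply: eq_bigr => j _; rewrite !mxE mulrC symK. Qed.

Lemma kernel_fun_Kmat_row n (t : 'I_n -> X) (c : 'I_n -> R) i :
  kernel_fun K t c (t i) = ((\row_j c j) *m Kmat K t) ord0 i.
Proof. by rewrite !mxE; apply: eq_bigr => j _; rewrite !mxE mulrC symK. Qed.

(** The value at [x] is a combination of the values at the nodes, with weights
    [invmx (Kmat K t) *m Kcol K t x] of l1 norm at most 1. *)
Lemma kernel_fun_le_grid n (t : 'I_n -> X) (c : 'I_n -> R) B : injective t ->
  0 <= B -> (forall i, `|kernel_fun K t c (t i)| <= B) ->
  forall x, `|kernel_fun K t c x| <= B.
Proof.
move=> it B0 cB x; rewrite kernel_fun_Kmat.
set q := invmx (Kmat K t) *m Kcol K t x.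
have -> : (\row_j c j) *m Kcol K t x = ((\row_j c j) *m Kmat K t) *m q.
  by rewrite mulmxA mulmxK// Kmat_unit.
rewrite mxE; apply: le_trans (ler_norm_sum _ _ _) _.
apply: (@le_trans _ _ (\sum_i B * `|q i ord0|)).
  apply: ler_sum => i _; rewrite normrM -kernel_fun_Kmat_row.
  by apply: ler_wpM2r.
by rewrite -mulr_sumr -[leRHS]mulr1 ler_wpM2l//; apply: l1K.
Qed.

Lemma interpolation n (t : 'I_n -> X) (v : 'I_n -> R) : injective t ->
  exists c : 'I_n -> R, forall i, kernel_fun K t c (t i) = v i.
Proof.
move=> it; exists (fun i => ((\row_j v j) *m invmx (Kmat K t)) ord0 i) => i.
rewrite kernel_fun_Kmat_row.
set r := \row_j _; have -> : r = (\row_j v j) *m invmx (Kmat K t).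
  by apply/rowP => j; rewrite !mxE.
by rewrite mulmxKV ?mxE// Kmat_unit.
Qed.

(* Replaces an arbitrary kernel expansion by one carried by the sample. *)
Lemma representer n (x : 'I_n -> X) N (t : 'I_N -> X) (b : 'I_N -> R) :
  injective x ->
  exists2 c : 'I_n -> R, forall i, kernel_fun K x c (x i) = kernel_fun K t b (x i)
    & \sum_i `|c i| <= \sum_i `|b i|.
Proof.
(* Each section of [K] at [t k] is interpolated on the sample; its coefficients have l1 norm at most
   1, so the total norm cannot grow. *)
move=> ix; pose c i := \sum_k b k * (invmx (Kmat K x) *m Kcol K x (t k)) i ord0.
exists c.
  move=> i; rewrite /kernel_fun /c.
  under eq_bigr do rewrite mulr_sumr.
  rewrite exchange_big /=; apply: eq_bigr => k _.
  have /colP/(_ i) := mulKVmx (Kmat_unit ix) (Kcol K x (t k)).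
  rewrite !mxE => <-; rewrite mulr_suml; apply: eq_bigr => j _.
  by rewrite !mxE; ring.
rewrite /c; apply: (@le_trans _ _ (\sum_i \sum_k `|b k| *
    `|(invmx (Kmat K x) *m Kcol K x (t k)) i ord0|)).
  apply: ler_sum => i _; apply: le_trans (ler_norm_sum _ _ _) _.
  by apply: ler_sum => k _; rewrite normrM.
rewrite exchange_big /=; apply: ler_sum => k _; rewrite -mulr_sumr.
by rewrite -[leRHS]mulr1 ler_wpM2l//; apply: l1K.
Qed.

(** The discrete form of self-adjointness of the integral operator: it moves the pairing of
    coefficients with values from one set of nodes to the other. *)
Lemma kernel_fun_pair n (t : 'I_n -> X) (c : 'I_n -> R) N (x : 'I_N -> X) (b : 'I_N -> R) :
  \sum_i c i * kernel_fun K x b (t i) = \sum_j b j * kernel_fun K t c (x j).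
Proof.
rewrite /kernel_fun; under eq_bigr do rewrite mulr_sumr.
rewrite exchange_big /=; apply: eq_bigr => j _; rewrite mulr_sumr.
by apply: eq_bigr => i _; rewrite symK; ring.
Qed.

(* Interpolate c on the other nodes: the difference vanishes there, so its
   energy is the coefficient at i times the jump at i. *)
Lemma maximum_principle n (t : 'I_n -> X) (g : 'I_n -> R) i : injective t ->
  (forall j, `|kernel_fun K t g (t j)| <= 1) -> `|kernel_fun K t g (t i)| = 1 ->
  0 <= g i * kernel_fun K t g (t i).
Proof.
case: n t g i => [|n] t g i; first by case: i.
move=> it g1 gi1; set c := kernel_fun K t g.
have it' : injective (t \o lift i) by move=> a b /it /lift_inj.
have [h hE] := interpolation (fun j => c (t (lift i j))) it'.
set P := kernel_fun K (t \o lift i) h.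
have P1 : `|P (t i)| <= 1.
  by apply: kernel_fun_le_grid => // j; rewrite hE.
pose e j := if unlift i j is Some k then g j - h k else g j.
have eE x : kernel_fun K t e x = c x - P x.
  rewrite /c /P /kernel_fun (bigD1_ord i)//= [X in _ = X - _](bigD1_ord i)//=.
  rewrite -addrA -sumrB; congr (_ + _); first by rewrite /e unlift_none.
  by apply: eq_bigr => j _; rewrite /e liftK; ring.
have Ei : \sum_j e j * kernel_fun K t e (t j) = g i * (c (t i) - P (t i)).
  rewrite (bigD1_ord i)//= eE /e unlift_none big1 ?addr0// => j _.
  rewrite -/e eE; have := hE j; rewrite /= -/P => ->; by rewrite subrr mulr0.
have := pd_ge0 e it; rewrite Ei.
(* A zero jump means zero energy, hence [g i = 0]. Otherwise the jump has the sign of [c (t i)],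
   because [|P (t i)| <= 1 = |c (t i)|]. *)
have [eq0|neq0] := eqVneq (c (t i)) (P (t i)).
  have le0 : \sum_j e j * kernel_fun K t e (t j) <= 0.
    by rewrite Ei eq0 subrr mulr0.
  by have := pd_eq0 it le0 i; rewrite /e unlift_none => ->; rewrite !mul0r.
move: P1 neq0.
have : c (t i) = 1 \/ c (t i) = -1.
  by have := gi1; rewrite -/c; case: (ler0P (c (t i))) => _ h1; [right|left]; lra.
move=> -[->|->]; rewrite ler_norml => /andP[P1 P2] neq0 gP; nra.
Qed.

Definition clamp (a x : R) : R := Num.max (- a) (Num.min a x).

Lemma clampP a x : 0 <= a -> [\/ x < - a /\ clamp a x = - a, a < x /\ clamp a x = a |
  `|x| <= a /\ clamp a x = x].
Proof.
move=> a0; rewrite /clamp; case: (ltP x (- a)) => h1.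
  by apply: Or31; split => //; rewrite (min_r (_ : x <= a)) ?max_l//; lra.
case: (ltP a x) => h2; first by apply: Or32; split => //; rewrite ?max_r //; lra.
by apply: Or33; split; [rewrite ler_norml; apply/andP|rewrite max_r].
Qed.

Lemma clamp_norm a x : 0 <= a -> `|clamp a x| <= a.
Proof.
by move=> a0; have [[_ ->]|[_ ->]|[? ->]//] := clampP x a0; rewrite ?normrN ger0_norm.
Qed.

(** Where the clamp is active, [v i - clamp 1 (v i)] has the sign of [clamp 1 (v i)], and so has
    [g i] by the maximum principle; elsewhere the term is zero. This is the contraction property of
    the energy, written as a variational inequality. *)
Lemma clamp_pair n (t : 'I_n -> X) (v g : 'I_n -> R) : injective t ->
  (forall i, kernel_fun K t g (t i) = clamp 1 (v i)) ->
  0 <= \sum_i g i * (v i - clamp 1 (v i)).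
Proof.
move=> it gE; apply: sumr_ge0 => i _.
have mp : `|clamp 1 (v i)| = 1 -> 0 <= g i * clamp 1 (v i).
  move=> c1; rewrite -gE; apply: maximum_principle => //; last by rewrite gE.
  by move=> j; rewrite gE clamp_norm.
have [[h1 e]|[h1 e]|[_ ->]] := clampP (v i) (@ler01 R); last by rewrite subrr mulr0.
- have := mp; rewrite e normrN normr1 => /(_ erefl); nra.
- have := mp; rewrite e normr1 => /(_ erefl); nra.
Qed.

(** Solves [(mu + L_K) q = p] for the operator discretized with weights [w]. A homogeneous solution
    [v], paired with [w v], makes the energy of [w v] nonpositive, so [w v = 0]; then [mu v = 0],
    also at nodes of weight zero. *)
Lemma resolvent_exists n (t : 'I_n -> X) (w p : 'I_n -> R) mu : injective t ->
  0 < mu -> (forall i, 0 <= w i) ->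
  exists q : 'I_n -> R, forall i,
    mu * q i + kernel_fun K t (fun j => w j * q j) (t i) = p i.
Proof.
move=> it mu0 w0.
pose A : 'M[R]_n := \matrix_(i, j) (mu * (i == j)%:R + w i * K (t i) (t j)).
have AE (v : 'rV[R]_n) i : (v *m A) ord0 i =
    mu * v ord0 i + kernel_fun K t (fun j => w j * v ord0 j) (t i).
  rewrite mxE /kernel_fun; under eq_bigr do rewrite mxE mulrDr.
  rewrite big_split/=; congr (_ + _).
    rewrite (bigD1 i)//= eqxx big1 ?addr0; first by rewrite mulr1 mulrC.
    by move=> j /negbTE ->; rewrite mulr0 mulr0.
  by apply: eq_bigr => j _; ring.
have uA : A \in unitmx.
  rewrite -row_free_unit; apply/inj_row_free => v vA.
  have Ev i : mu * v ord0 i = - kernel_fun K t (fun j => w j * v ord0 j) (t i).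
    by apply/eqP; rewrite -subr_eq0 opprK -AE vA mxE.
  have wv0 : \sum_i (w i * v ord0 i) * kernel_fun K t (fun j => w j * v ord0 j) (t i) <= 0.
    rewrite -oppr_ge0 -sumrN; apply: sumr_ge0 => i _.
    rewrite -mulrN -Ev; have := sqr_ge0 (v ord0 i); have := w0 i.
    move=> wi; rewrite expr2 => v2.
    have -> : w i * v ord0 i * (mu * v ord0 i) = mu * (w i * (v ord0 i * v ord0 i)) by ring.
    by apply: mulr_ge0; [exact: ltW|exact: mulr_ge0].
  have wv := pd_eq0 it wv0.
  apply/rowP => i; rewrite mxE; have := Ev i.
  rewrite /kernel_fun big1; last by move=> j _; rewrite wv mulr0.
  by move/eqP; rewrite oppr0 mulf_eq0 gt_eqF//= => /eqP.
exists (fun i => ((\row_j p j) *m invmx A) ord0 i) => i.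
by rewrite -AE mulmxKV// mxE.
Qed.


(* The smoothed clamp v = p - mu q of u / tau stays in [-1, 1], hence so does
   the kernel expansion P with coefficients w q, which is therefore a dual
   certificate for the coefficient norm: sum |c| >= sum c_k P(x_k). *)
Lemma coefficient_norm_gap n (t : 'I_n -> X) (w b : 'I_n -> R)
    N (x : 'I_N -> X) (c : 'I_N -> R) (u : 'I_n -> R) tau mu th B :
  injective t -> (forall i, 0 <= w i) -> \sum_i w i = 1 ->
  \sum_i w i * `|b i| <= B -> 0 < tau -> 0 < mu -> 0 < th ->
  (forall i, u i = kernel_fun K t (fun j => w j * b j) (t i)) ->
  \sum_i w i * `|u i| - \sum_k `|c k| <= tau + mu * B + th * (B / (2 * tau * mu))
    + (4 * th)^-1 * \sum_i w i * (kernel_fun K x c (t i) - kernel_fun K t (fun j => w j * u j) (t i)) ^+ 2.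
Proof.
move=> it w0 w1 bB tau0 mu0 th0 uE.
set g := kernel_fun K t (fun j => w j * u j).
pose p i := clamp 1 (u i / tau).
have p1 i : `|p i| <= 1 by exact: clamp_norm.
have [q qE] := resolvent_exists p it mu0 w0.
pose al i := w i * q i.
pose v i := p i - mu * q i.
have alE i : kernel_fun K t al (t i) = v i by rewrite /v -(qE i) /al; ring.
have kfB (a1 a2 : 'I_n -> R) y : kernel_fun K t (fun j => a1 j - a2 j) y =
    kernel_fun K t a1 y - kernel_fun K t a2 y.
  by rewrite /kernel_fun -sumrB; apply: eq_bigr => j _; ring.
(* [v] is compared with its own clamp, interpolated by [ga]. Where [v] leaves [[-1, 1]],
   [al = w (p - v) / mu] points back inside since [|p| <= 1]; with [clamp_pair] this makes the
   energy of the difference nonpositive, so the two coincide. *)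
have v1 i : `|v i| <= 1.
  have [ga gaE] := interpolation (fun i => clamp 1 (v i)) it.
  have h1 := clamp_pair it gaE.
  have h2 : \sum_i al i * (v i - clamp 1 (v i)) <= 0.
    rewrite -oppr_ge0 -sumrN; apply: sumr_ge0 => j _.
    have qE' : q j = (p j - v j) / mu by rewrite /v; field; rewrite gt_eqF.
    have -> : - (al j * (v j - clamp 1 (v j))) =
      (w j / mu) * ((v j - p j) * (v j - clamp 1 (v j))).
      by rewrite /al qE'; ring.
    apply: mulr_ge0; first by rewrite divr_ge0// ltW.
    have := p1 j; rewrite ler_norml => /andP[pj1 pj2].
    have [[h ->]|[h ->]|[_ ->]] := clampP (v j) (@ler01 R); last by rewrite subrr mulr0.
    - by rewrite mulr_le0//; lra.
    - by rewrite mulr_ge0//; lra.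
  have h3 : \sum_j (al j - ga j) * kernel_fun K t (fun j => al j - ga j) (t j) <= 0.
    apply: (@le_trans _ _ (\sum_i al i * (v i - clamp 1 (v i)) -
                           \sum_i ga i * (v i - clamp 1 (v i)))); last by lra.
    rewrite -sumrB le_eqVlt; apply/orP; left; apply/eqP; apply: eq_bigr => j _.
    by rewrite kfB alE gaE; ring.
  have ag := pd_eq0 it h3.
  have -> : v i = clamp 1 (v i).
    rewrite -gaE -alE; apply: eq_bigr => j _; congr (_ * _).
    by apply/eqP; rewrite -subr_eq0 ag.
  exact: clamp_norm.
have P1 y : `|kernel_fun K t al y| <= 1.
  by apply: kernel_fun_le_grid => // i; rewrite alE.
have b0 : 0 <= B by apply: le_trans bB; apply: sumr_ge0 => i _; rewrite mulr_ge0.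
(* Where the clamp is active [p u = |u|], and elsewhere [|u| <= tau]: replacing [|u|] by [p u] costs
   at most [tau]. *)
have pu i : 0 <= w i * (tau - (`|u i| - p i * u i)).
  apply: mulr_ge0 => //; rewrite /p.
  set z := u i / tau; have ui : u i = z * tau by rewrite divfK// gt_eqF.
  rewrite ui normrM (gtr0_norm tau0).
  have [[h ->]|[h ->]|[h ->]] := clampP z (@ler01 R).
  - by rewrite ltr0_norm; [nra|lra].
  - by rewrite gtr0_norm; [nra|lra].
  - have -> : tau - (`|z| * tau - z * (z * tau)) = tau * (1 - `|z|) + tau * z ^+ 2 by ring.
    by rewrite addr_ge0// mulr_ge0 ?sqr_ge0 ?subr_ge0// ltW.
have S1 : \sum_i w i * `|u i| <= tau + \sum_i w i * (p i * u i).
  have -> : tau = \sum_i w i * tau by rewrite -mulr_suml w1 mul1r.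
  by rewrite -big_split/=; apply: ler_sum => i _; rewrite -subr_ge0; have := pu i; rewrite mulrBr mulrBr; lra.
have bnd (z : 'I_n -> R) : (forall i, `|z i| <= 1) -> \sum_i z i * (w i * b i) <= B.
  move=> z1; apply: le_trans bB; apply: ler_sum => i _.
  apply: le_trans (ler_norm _) _; rewrite !normrM (ger0_norm (w0 i)).
  by rewrite -[leRHS]mul1r ler_wpM2r// mulr_ge0.
(* Here [p = v + mu q], and symmetry turns the pairing of [w q] with [u] into that of [v] with
   [w b], which [bnd] bounds by [B]. *)
have S2 : \sum_i w i * (p i * u i) = \sum_i v i * (w i * u i) +
     mu * \sum_i v i * (w i * b i).
  have -> : \sum_i v i * (w i * b i) = \sum_i al i * u i.
    under [RHS]eq_bigr do rewrite uE.
    by rewrite kernel_fun_pair; apply: eq_bigr => i _; rewrite alE mulrC.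
  rewrite mulr_sumr -big_split/=; apply: eq_bigr => i _; rewrite /v /al; ring.
have S3 : \sum_i v i * (w i * u i) = \sum_i al i * g (t i).
  by rewrite /g kernel_fun_pair; apply: eq_bigr => i _; rewrite alE mulrC.
(* By [clamp_pair] the energy of [p] is at most its pairing with [u / tau]; as [u] is the image of
   [w b], that pairing is at most [B / tau]. *)
have [pi piE] := interpolation p it.
have E1 : \sum_i pi i * p i <= B / tau.
  apply: (@le_trans _ _ (\sum_i pi i * (u i / tau))).
    rewrite -subr_ge0 -sumrB.
    have := clamp_pair (v := fun i => u i / tau) it piE.
    by under eq_bigr do rewrite mulrBr.
  under eq_bigr do rewrite mulrA; rewrite -mulr_suml ler_pM2r ?invr_gt0//.
  under eq_bigr do rewrite uE.
  rewrite kernel_fun_pair; apply: le_trans (bnd p p1).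
  by rewrite le_eqVlt; apply/orP; left; apply/eqP; apply: eq_bigr => i _; rewrite piE mulrC.
(* The energies of [p - v] and of [v] are nonnegative, and their sum is the energy of [p] minus
   [2 mu] times the weighted square of [q]. *)
have Q1 : 2 * mu * \sum_i w i * q i ^+ 2 <= \sum_i pi i * p i.
  have h1 := pd_ge0 (fun j => pi j - al j) it.
  have h2 := pd_ge0 al it.
  have sw : \sum_i pi i * v i = \sum_i al i * p i.
    under eq_bigr do rewrite -alE; rewrite kernel_fun_pair.
    by apply: eq_bigr => i _; rewrite piE.
  have e1 : \sum_j (pi j - al j) * kernel_fun K t (fun j => pi j - al j) (t j) =
    \sum_i pi i * p i - \sum_i pi i * v i - \sum_i al i * p i + \sum_i al i * v i.
    rewrite -!sumrB -big_split/=; apply: eq_bigr => i _; rewrite kfB alE piE; ring.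
  have e2 : \sum_j al j * kernel_fun K t al (t j) = \sum_i al i * v i.
    by apply: eq_bigr => i _; rewrite alE.
  have e3 : \sum_i al i * p i = \sum_i al i * v i + mu * \sum_i w i * q i ^+ 2.
    by rewrite mulr_sumr -big_split/=; apply: eq_bigr => i _; rewrite /v /al; ring.
  rewrite e1 sw e3 in h1; rewrite e2 in h2.
  rewrite -subr_ge0; apply: le_trans (_ : 0 <= _ + _) _; first exact: (addr_ge0 h1 h2).
  by rewrite le_eqVlt; apply/orP; left; apply/eqP; ring.
have Q2 : \sum_i w i * q i ^+ 2 <= B / (2 * tau * mu).
  have := le_trans Q1 E1; rewrite !ler_pdivlMr ?mulr_gt0//; lra.
have C1 : \sum_i al i * kernel_fun K x c (t i) <= \sum_k `|c k|.
  rewrite kernel_fun_pair; apply: ler_sum => k _.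
  apply: le_trans (ler_norm _) _; rewrite normrM.
  by rewrite -[leRHS]mulr1 ler_wpM2l.
(* Young's inequality with weight [th]: the distance between the two expansions is paid partly by
   [q], partly by its square. *)
have C2 : \sum_i al i * g (t i) - \sum_i al i * kernel_fun K x c (t i) <=
    th * \sum_i w i * q i ^+ 2
    + (4 * th)^-1 * \sum_i w i * (kernel_fun K x c (t i) - g (t i)) ^+ 2.
  rewrite -sumrB !mulr_sumr -big_split/=; apply: ler_sum => i _.
  set y1 := g (t i); set y2 := kernel_fun K x c (t i).
  rewrite -subr_ge0.
  have -> : th * (w i * q i ^+ 2) + (4 * th)^-1 * (w i * (y2 - y1) ^+ 2) -
      (al i * y1 - al i * y2) = w i * th * (q i + (2 * th)^-1 * (y2 - y1)) ^+ 2.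
    by rewrite /al; field; rewrite gt_eqF.
  by rewrite mulr_ge0 ?sqr_ge0 ?mulr_ge0// ltW.
have B1 := bnd v v1.
have B2 : mu * \sum_i v i * (w i * b i) <= mu * B by rewrite ler_pM2l.
have B3 : th * \sum_i w i * q i ^+ 2 <= th * (B / (2 * tau * mu)) by rewrite ler_pM2l.
rewrite S2 S3 in S1; lra.
Qed.

End KernelAlgebra.

(** * Expectations of bounded measurable functions *)

Section BoundedMeasurable.
Context {R : realType} {dT : measure_display} {T : measurableType dT}.

(** A class stable under the operations below and integrable for every probability, so that real
    expectations can be handled without integrability conditions. *)
Definition bmeas (f : T -> R) :=
  measurable_fun setT f /\ exists B, forall x, `|f x| <= B.

Lemma bmeas_cst (r : R) : bmeas (fun=> r).
Proof. by split; [exact: measurable_cst|exists `|r|]. Qed.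

Lemma bmeasD f g : bmeas f -> bmeas g -> bmeas (fun x => f x + g x).
Proof.
move=> [mf [B fB]] [mg [C gC]]; split; first exact: measurable_funD.
by exists (B + C) => x; apply: le_trans (ler_normD _ _) _; rewrite lerD.
Qed.

Lemma bmeasM f g : bmeas f -> bmeas g -> bmeas (fun x => f x * g x).
Proof.
move=> [mf [B fB]] [mg [C gC]]; split; first exact: measurable_funM.
by exists (B * C) => x; rewrite normrM ler_pM.
Qed.

Lemma bmeasZ r f : bmeas f -> bmeas (fun x => r * f x).
Proof. by move=> bf; apply: bmeasM => //; exact: bmeas_cst. Qed.

Lemma bmeasN f : bmeas f -> bmeas (fun x => - f x).
Proof. by move=> [mf [B fB]]; split; [exact: measurableT_comp|exists B => x; rewrite normrN]. Qed.

Lemma bmeasB f g : bmeas f -> bmeas g -> bmeas (fun x => f x - g x).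
Proof. by move=> bf bg; apply: bmeasD => //; exact: bmeasN. Qed.

Lemma bmeasX f n : bmeas f -> bmeas (fun x => f x ^+ n).
Proof.
move=> [mf [B fB]]; split; first exact: measurable_funX.
by exists (B ^+ n) => x; rewrite normrX lerXn2r// ?nnegrE//; apply: le_trans (fB x).
Qed.

Lemma bmeas_norm f : bmeas f -> bmeas (fun x => `|f x|).
Proof. by move=> [mf [B fB]]; split; [exact: measurableT_comp|exists B => x; rewrite normr_id]. Qed.

Lemma bmeas_expR f : bmeas f -> bmeas (fun x => expR (f x)).
Proof.
move=> [mf [B fB]]; split; first by apply: measurableT_comp => //; exact: measurable_expR.
by exists (expR B) => x; rewrite ger0_norm ?expR_ge0// ler_expR (le_trans (ler_norm _)).
Qed.

Lemma bmeas_indic A : measurable A -> bmeas (\1_A).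
Proof.
move=> mA; split; first exact: measurable_indic.
by exists 1 => x; rewrite indicE; case: (x \in A); rewrite ?normr0 ?normr1.
Qed.

Lemma bmeas_sum I (r : seq I) (Q : pred I) (f : I -> T -> R) :
  (forall i, Q i -> bmeas (f i)) -> bmeas (fun x => \sum_(i <- r | Q i) f i x).
Proof.
move=> bf; elim: r => [|i r IH].
  by have := bmeas_cst 0; congr bmeas; apply/funext => x; rewrite big_nil.
have [Qi|Qi] := boolP (Q i).
  have := bmeasD (bf _ Qi) IH; congr bmeas; apply/funext => x.
  by rewrite big_cons Qi.
by move: IH; congr bmeas; apply/funext => x; rewrite big_cons (negbTE Qi).
Qed.

Lemma bmeas_prod I (r : seq I) (Q : pred I) (f : I -> T -> R) :
  (forall i, Q i -> bmeas (f i)) -> bmeas (fun x => \prod_(i <- r | Q i) f i x).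
Proof.
move=> bf; elim: r => [|i r IH].
  by have := bmeas_cst 1; congr bmeas; apply/funext => x; rewrite big_nil.
have [Qi|Qi] := boolP (Q i).
  have := bmeasM (bf _ Qi) IH; congr bmeas; apply/funext => x.
  by rewrite big_cons Qi.
by move: IH; congr bmeas; apply/funext => x; rewrite big_cons (negbTE Qi).
Qed.

Lemma measurable_clamp a : measurable_fun setT (@clamp R a).
Proof.
apply: measurable_maxr; first exact: measurable_cst.
by apply: measurable_minr; [exact: measurable_cst|exact: measurable_id].
Qed.

Lemma bmeas_clamp a f : 0 <= a -> measurable_fun setT f -> bmeas (fun x => clamp a (f x)).
Proof.
move=> a0 mf; split; first by apply: measurableT_comp => //; exact: measurable_clamp.
by exists a => x; exact: clamp_norm.
Qed.

End BoundedMeasurable.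

Lemma bmeas_comp {R : realType} {d1 d2 : measure_display} {T1 : measurableType d1}
  {T2 : measurableType d2} (f : T2 -> R) (g : T1 -> T2) :
  measurable_fun setT g -> bmeas f -> bmeas (fun x => f (g x)).
Proof. by move=> mg [mf [B fB]]; split; [exact: measurableT_comp|exists B]. Qed.

Ltac solve_bmeas := repeat first [assumption | apply: bmeas_cst | apply: bmeasX
  | apply: bmeasZ | apply: bmeasN | apply: bmeasM | apply: bmeasD | apply: bmeas_norm].

Section Expectation.
Context {R : realType} {dT : measure_display} {T : measurableType dT}.
Variable P : probability T R.

Lemma bmeas_integrable f : bmeas f -> P.-integrable setT (EFin \o f).
Proof.
move=> [mf [B fB]]; apply: measurable_bounded_integrable => //.
  by rewrite (_ : _ setT = 1%E) ?ltry//; exact: (probability_setT P).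
by exists B; split; [exact: num_real|move=> M BM x _; exact: le_trans (fB x) (ltW BM)].
Qed.

Lemma ExE f : bmeas f -> (\int[P]_x f x)%:E = (\int[P]_x (f x)%:E)%E.
Proof.
by move=> bf; rewrite fineK//; apply: integrable_fin_num => //; exact: bmeas_integrable.
Qed.

Lemma ExD f g : bmeas f -> bmeas g ->
  \int[P]_x (f x + g x) = \int[P]_x f x + \int[P]_x g x.
Proof. by move=> bf bg; rewrite RintegralD//; exact: bmeas_integrable. Qed.

Lemma ExB f g : bmeas f -> bmeas g ->
  \int[P]_x (f x - g x) = \int[P]_x f x - \int[P]_x g x.
Proof. by move=> bf bg; rewrite RintegralB//; exact: bmeas_integrable. Qed.

Lemma ExZ r f : bmeas f -> \int[P]_x (r * f x) = r * \int[P]_x f x.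
Proof. by move=> bf; rewrite RintegralZl//; exact: bmeas_integrable. Qed.

Lemma Ex_cst r : \int[P]_x r = r.
Proof.
rewrite Rintegral_cst// -[RHS]mulr1; congr (_ * _).
exact: (congr1 fine (probability_setT P)).
Qed.

Lemma Ex_le f g : bmeas f -> bmeas g -> (forall x, f x <= g x) ->
  \int[P]_x f x <= \int[P]_x g x.
Proof. by move=> bf bg fg; apply: le_Rintegral => //; exact: bmeas_integrable. Qed.

Lemma Ex_ge0 f : (forall x, 0 <= f x) -> 0 <= \int[P]_x f x.
Proof. by move=> f0; apply: Rintegral_ge0. Qed.

Lemma Ex_sum I (r : seq I) (Q : pred I) (f : I -> T -> R) :
  (forall i, Q i -> bmeas (f i)) ->
  \int[P]_x (\sum_(i <- r | Q i) f i x) = \sum_(i <- r | Q i) \int[P]_x f i x.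
Proof.
move=> bf; elim: r => [|i r IH].
  by rewrite big_nil -[RHS]Ex_cst; apply: eq_Rintegral => x _; rewrite big_nil.
rewrite big_cons; case: ifPn => Qi.
  rewrite -IH -ExD//; last exact: bmeas_sum.
    by apply: eq_Rintegral => x _; rewrite big_cons Qi.
  exact: bf.
by rewrite -IH; apply: eq_Rintegral => x _; rewrite big_cons (negbTE Qi).
Qed.

Lemma Ex_norm f : bmeas f -> `|\int[P]_x f x| <= \int[P]_x `|f x|.
Proof. by move=> bf; apply: le_normr_Rintegral => //; exact: bmeas_integrable. Qed.

Lemma Ex_norm_le f B : bmeas f -> (forall x, `|f x| <= B) -> `|\int[P]_x f x| <= B.
Proof.
move=> bf fB; apply: le_trans (Ex_norm bf) _; rewrite -[leRHS]Ex_cst.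
by apply: Ex_le => //; [exact: bmeas_norm|exact: bmeas_cst].
Qed.

Lemma Ex_indic A : measurable A -> (\int[P]_x \1_A x)%:E = P A.
Proof. by move=> mA; rewrite ExE ?integral_indic ?setIT//; exact: bmeas_indic. Qed.

Lemma Ex_CS f g : bmeas f -> bmeas g ->
  (\int[P]_x (f x * g x)) ^+ 2 <= (\int[P]_x f x ^+ 2) * (\int[P]_x g x ^+ 2).
Proof.
move=> bf bg; set a := \int[P]_x (f x ^+ 2); set b := \int[P]_x _; set c := \int[P]_x (g x ^+ 2).
have a0 : 0 <= a by apply: Ex_ge0 => x; exact: sqr_ge0.
have c0 : 0 <= c by apply: Ex_ge0 => x; exact: sqr_ge0.
have q s t : 0 <= s ^+ 2 * a + 2 * s * t * b + t ^+ 2 * c.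
  have <- : \int[P]_x ((s * f x + t * g x) ^+ 2) = s ^+ 2 * a + 2 * s * t * b + t ^+ 2 * c.
    by rewrite /a /b /c -!ExZ -?ExD; solve_bmeas; apply: eq_Rintegral => x _; ring.
  by apply: Ex_ge0 => x; exact: sqr_ge0.
have [c00|cn0] := eqVneq c 0.
  (* With [c = 0] the form at [(b, -(a+1))] equals [- b^2 (a+2)], which forces [b = 0]. *)
  have := q b (- (a + 1)) ; rewrite c00 !mulr0 addr0 => h.
  have : 0 <= b ^+ 2 * (- (a + 2)) by nra.
  have := sqr_ge0 b; nra.
have cp : 0 < c by rewrite lt_neqAle eq_sym cn0.
have := q c (- b); have -> : c ^+ 2 * a + 2 * c * - b * b + (- b) ^+ 2 * c = c * (a * c - b ^+ 2) by ring.
by rewrite pmulr_rge0// subr_ge0.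
Qed.

End Expectation.

(** * Exponential inequalities for i.i.d. samples *)

Section Step.
Context {R : realType} {dT : measure_display} {T : measurableType dT}.

(** The range of [h] is sliced into intervals of length [e], and each slice gets its right endpoint.
    The step function lies above [h], the side on which [Ex_prod_le] needs it. *)
Lemma step_approx (h : T -> R) (e : R) : 0 < e -> bmeas h ->
  exists (N : nat) (a : 'I_N -> R) (A : 'I_N -> set T),
    (forall k, measurable (A k)) /\
    forall x, h x <= \sum_k a k * \1_(A k) x <= h x + e.
Proof.
move=> e0 [mh [B hB]].
pose g x := (h x + B) / e.
have g0 x : 0 <= g x.
  by rewrite divr_ge0 ?(ltW e0)//; have := hB x; rewrite ler_norml => /andP[]; lra.
have gB x : g x <= 2 * B / e.
  by rewrite ler_pM2r ?invr_gt0//; have := hB x; rewrite ler_norml => /andP[]; lra.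
pose N := (Num.truncn (2 * B / e)).+1.
pose A (k : 'I_N) := h @^-1` `[k%:R * e - B, k.+1%:R * e - B[.
exists N, (fun k : 'I_N => k.+1%:R * e - B), A; split.
  move=> k; rewrite -[A k]setTI; apply: mh => //; exact: measurable_itv.
move=> x; have gx := truncn_itv (g0 x).
have kN : (Num.truncn (g x) < N)%N by rewrite ltnS; apply: le_truncn.
have AE k : A k x = (k%:R <= g x < k.+1%:R) :> Prop.
  rewrite /A /= in_itv/= /g ler_pdivlMr// ltr_pdivrMr//.
  by congr (is_true (_ && _)); [rewrite lerBlDr|rewrite ltrBrDr].
rewrite (bigD1 (Ordinal kN))//= big1 ?addr0; last first.
  move=> k /eqP nk; rewrite indicE memNset ?mulr0// AE => /truncn_def E.
  by apply: nk; apply: val_inj; rewrite /= -E.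
rewrite indicE mem_set ?AE//= mulr1.
move: gx; rewrite /g ler_pdivlMr// ltr_pdivrMr// => /andP[]; set n := Num.truncn _.
rewrite -(natr1 n) => g1 g2; apply/andP; split; lra.
Qed.

End Step.

Section Independence.
Context {R : realType} {dX : measure_display} {X : measurableType dX}.
Context {dO : measure_display} {O : measurableType dO}.
Variables (P : probability O R) (rho : probability (X * R)%type R) (m : nat).
Variables (Z : 'I_m -> O -> (X * R)%type).
Hypothesis iid : iid_sample P rho Z.

Let mZ i : measurable_fun setT (Z i). Proof. by case: iid. Qed.

Lemma bmeas_sample (f : X * R -> R) i : bmeas f -> bmeas (fun w => f (Z i w)).
Proof. exact: bmeas_comp. Qed.

Lemma Ex_prod_indic (A : 'I_m -> set (X * R)) : (forall i, measurable (A i)) ->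
  \int[P]_w (\prod_i \1_(A i) (Z i w)) = \prod_i \int[rho]_z \1_(A i) z.
Proof.
move=> mA; case: iid => _ id ind.
pose S := \bigcap_(i in [set: 'I_m]) (Z i @^-1` A i).
have mP i : measurable (Z i @^-1` A i).
  by rewrite -[_ @^-1` _]setTI; apply: mZ.
have mS : measurable S by apply: fin_bigcap_measurable => //; exact: finite_setT.
have -> : \int[P]_w (\prod_i \1_(A i) (Z i w)) = \int[P]_w \1_S w.
  apply: eq_Rintegral => w _; rewrite [RHS]indicE.
  have [|wS] := boolP (w \in S).
    rewrite inE => wS; rewrite big1// => i _.
    by rewrite indicE mem_set//; exact: wS.
  have [i Ai] : exists i, ~ A i (Z i w).
    by apply/existsNP => wA; move: wS; rewrite notin_setE; apply => i _; exact: wA.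
  by rewrite (bigD1 i)//= indicE memNset// mul0r.
apply: EFin_inj; rewrite Ex_indic// ind// -prodEFin.
by apply: eq_bigr => i _; rewrite id// Ex_indic.
Qed.

(** Distributing the product over the sums gives one product of indicators for each map from sample
    positions to pieces; independence applies to each of them. *)
Lemma Ex_prod_step N (a : 'I_N -> R) (A : 'I_N -> set (X * R)) :
  (forall k, measurable (A k)) ->
  \int[P]_w (\prod_(i < m) \sum_k a k * \1_(A k) (Z i w)) =
    (\int[rho]_z \sum_k a k * \1_(A k) z) ^+ m.
Proof.
move=> mA; under eq_Rintegral do rewrite bigA_distr_bigA.
have bA k : bmeas (\1_(A k) : _ -> R) by exact: bmeas_indic.
rewrite Ex_sum; last first.
  by move=> f _; apply: bmeas_prod => i _; apply: bmeasZ; exact: bmeas_sample.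
rewrite -[m in RHS]card_ord -prodr_const Ex_sum; last by move=> k _; exact: bmeasZ.
rewrite (bigA_distr_bigA (fun (i : 'I_m) k => \int[rho]_z (a k * \1_(A k) z))).
apply: eq_bigr => f _.
under eq_Rintegral do rewrite big_split/=.
rewrite ExZ; last by apply: bmeas_prod => i _; exact: bmeas_sample.
rewrite (Ex_prod_indic (A := fun i => A (f i)))// -big_split/=.
by apply: eq_bigr => i _; rewrite ExZ.
Qed.

(** Independence is only given for events. So [h] is dominated by a step function within [e], and
    [e] tends to 0; an inequality is all that the Chernoff bound requires. *)
Lemma Ex_prod_le (h : X * R -> R) : bmeas h -> (forall z, 0 <= h z) ->
  \int[P]_w (\prod_(i < m) h (Z i w)) <= (\int[rho]_z h z) ^+ m.
Proof.
move=> bh h0; set I := \int[rho]_z h z.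
have le e : 0 < e -> \int[P]_w (\prod_(i < m) h (Z i w)) <= (I + e) ^+ m.
  move=> e0; have [N [a [A [mA hA]]]] := step_approx e0 bh.
  have bs : bmeas (fun z => \sum_k a k * \1_(A k) z).
    by apply: bmeas_sum => k _; apply: bmeasZ; exact: bmeas_indic.
  apply: (@le_trans _ _ ((\int[rho]_z \sum_k a k * \1_(A k) z) ^+ m)).
    rewrite -Ex_prod_step//; apply: Ex_le.
    - by apply: bmeas_prod => i _; exact: bmeas_sample.
    - by apply: bmeas_prod => i _; apply: (bmeas_sample i bs).
    - by move=> w; apply: ler_prod => i _; rewrite h0; case/andP: (hA (Z i w)).
  have s0 : 0 <= \int[rho]_z \sum_k a k * \1_(A k) z.
    by apply: Ex_ge0 => z; apply: le_trans (h0 z) _; case/andP: (hA z).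
  rewrite lerXn2r ?nnegrE//; first by rewrite addr_ge0 ?(ltW e0)//; exact: Ex_ge0.
  have -> : I + e = \int[rho]_z (h z + e).
    by rewrite ExD ?Ex_cst//; exact: bmeas_cst.
  apply: Ex_le => //; first by apply: bmeasD => //; exact: bmeas_cst.
  by move=> z; case/andP: (hA z).
have cv : (I + e) ^+ m @[e --> 0^'+] --> I ^+ m.
  rewrite -[in X in _ --> X](addr0 I).
  apply: (@cvg_comp _ _ _ (fun e => I + e) (fun x => x ^+ m) _ (nbhs (I + 0))); last exact: exprn_continuous.
  by apply: cvgD; [exact: cvg_cst|exact: cvg_at_right_filter].
rewrite -(cvg_lim (@Rhausdorff R) cv); apply: limr_ge; first exact: cvgP cv.
by near=> e; apply: le; near: e; exact: nbhs_right_gt.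
Unshelve. all: by end_near. Qed.

Lemma chernoff (z : X * R -> R) (a : R) : bmeas z ->
  measurable [set w | a <= \sum_i z (Z i w)] /\
  (P [set w | (a <= \sum_i z (Z i w))%R] <=
    ((\int[rho]_x expR (z x)) ^+ m * expR (- a))%:E)%E.
Proof.
move=> bz; have bS : bmeas (fun w => \sum_i z (Z i w)).
  by apply: bmeas_sum => i _; exact: bmeas_sample.
set S := [set w | _].
have mS : measurable S.
  rewrite -[S]setTI (_ : S = (fun w => \sum_i z (Z i w)) @^-1` `[a, +oo[).
    by apply: bS.1 => //; exact: measurable_itv.
  by apply/seteqP; split => w; rewrite /S /= in_itv/= andbT.
split => //; rewrite -Ex_indic// lee_fin.
have be : bmeas (fun x => expR (z x)) by exact: bmeas_expR.
apply: (@le_trans _ _ (expR (- a) * \int[P]_w (\prod_i expR (z (Z i w))))).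
  have bp : bmeas (fun w => \prod_i expR (z (Z i w))).
    by apply: bmeas_prod => i _; apply: (bmeas_sample i be).
  rewrite -ExZ//; apply: Ex_le; [exact: bmeas_indic|exact: bmeasZ|move=> w].
  rewrite -expR_sum -expRD indicE; have [|_] := boolP (w \in S); last exact: expR_ge0.
  by rewrite inE /S /= => aS; rewrite -[1]expR0 ler_expR addrC subr_ge0.
rewrite mulrC ler_wpM2r ?expR_ge0//; apply: Ex_prod_le => // x; exact: expR_ge0.
Qed.

End Independence.

(** Through [expR x <= 1 / (1 - x)]; clearing the denominator leaves [x^2 (1 - 2x) >= 0]. *)
Lemma expR_le_quadratic (R : realType) (x : R) : x <= 2^-1 -> expR x <= 1 + x + 2 * x ^+ 2.
Proof.
move=> x2; have h : 1 - x <= expR (- x) by exact: expR_ge1Dx.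
have x1 : 0 < 1 - x by lra.
have : expR x <= (1 - x)^-1.
  by rewrite -[x in expR x]opprK expRN lef_pV2 ?posrE ?expR_gt0.
move=> le; apply: le_trans le _; rewrite -div1r ler_pdivrMr// -subr_ge0.
have -> : (1 + x + 2 * x ^+ 2) * (1 - x) - 1 = x ^+ 2 * (1 - 2 * x) by ring.
by rewrite mulr_ge0 ?sqr_ge0//; lra.
Qed.

(* The variance condition makes the fluctuation absorbable in half of the mean. *)
Lemma relative_chernoff (R : realType) (dX : measure_display) (X : measurableType dX)
    (dO : measure_display) (O : measurableType dO) (P : probability O R)
    (rho : probability (X * R)%type R) m (Z : 'I_m -> O -> (X * R)%type)
    (xi : X * R -> R) (D I eps : R) :
  iid_sample P rho Z -> bmeas xi -> 0 < D -> (forall z, `|xi z| <= D) ->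
  `|\int[rho]_z xi z| = I -> \int[rho]_z (xi z ^+ 2) <= D * I ->
  let S := [set w | m%:R * (\int[rho]_z xi z + I / 2 + eps) <= \sum_i xi (Z i w)] in
  measurable S /\ (P S <= (expR (- (m%:R * eps / (4 * D))))%:E)%E.
Proof.
move=> iid bxi D0 xiD IE xi2 S; set J := \int[rho]_z xi z.
(* With this [t], [t xi <= 1/4] stays in the range of [expR_le_quadratic], and the variance term
   [2 t^2 (D I)] is exactly [t I / 2]. *)
pose t := (4 * D)^-1; have t0 : 0 < t by rewrite invr_gt0 mulr_gt0.
have -> : S = [set w | t * (m%:R * (J + I / 2 + eps)) <= \sum_i t * xi (Z i w)].
  by apply/seteqP; split => w; rewrite /S /= -mulr_sumr ler_pM2l.
have bt : bmeas (fun z => t * xi z) by exact: bmeasZ.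
have [mS PS] := chernoff iid (t * (m%:R * (J + I / 2 + eps))) bt.
split => //; apply: le_trans PS _; rewrite lee_fin.
have E : \int[rho]_z expR (t * xi z) <= expR (t * (J + I / 2)).
  apply: (@le_trans _ _ (1 + t * J + 2 * t ^+ 2 * (D * I))); last first.
    apply: le_trans (expR_ge1Dx _); rewrite -addrA lerD2l.
    rewrite le_eqVlt; apply/orP; left; apply/eqP; rewrite /t; field.
    by rewrite gt_eqF.
  apply: (@le_trans _ _ (\int[rho]_z (1 + t * xi z + 2 * t ^+ 2 * xi z ^+ 2))).
    apply: Ex_le; [exact: bmeas_expR|by solve_bmeas|move=> z].
    apply: le_trans (expR_le_quadratic _) _.
      have := xiD z; rewrite ler_norml => /andP[_ xz].
      apply: (@le_trans _ _ (t * D)); first by rewrite ler_pM2l.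
      by rewrite /t invfM -mulrA mulVf ?gt_eqF//; lra.
    by rewrite exprMn mulrA.
  rewrite ExD; [|by solve_bmeas..].
  rewrite ExD; [|by solve_bmeas..].
  rewrite ExZ // ExZ; last by solve_bmeas.
  by rewrite Ex_cst lerD2l ler_wpM2l// mulr_ge0 ?sqr_ge0.
apply: (@le_trans _ _ (expR (t * (J + I / 2)) ^+ m * expR (- (t * (m%:R * (J + I / 2 + eps)))))).
  by rewrite ler_wpM2r ?expR_ge0// lerXn2r ?nnegrE ?expR_ge0//; apply: Ex_ge0 => z; exact: expR_ge0.
rewrite -expRM_natl -expRD ler_expR -subr_ge0 le_eqVlt; apply/orP; left; apply/eqP.
by rewrite /t; ring.
Qed.

(** * Nets and Hoelder functions *)

Lemma powR_root (R : realType) (e a : R) : 0 <= e -> 0 < a -> (e `^ a^-1) `^ a = e.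
Proof. by move=> e0 a0; rewrite -powRrM mulVf ?gt_eqF// powRr1. Qed.

Section Metric.
Context {R : realType} {dX : measure_display} {X : measurableType dX}.
Variables (d : X -> X -> R) (eta Ceta alpha : R).
Hypotheses (md : is_metric d) (bX : borel_for d) (cov : covering_cond d eta Ceta).
Hypothesis (alpha0 : 0 < alpha).

Let d0 x y : 0 <= d x y. Proof. by case: md. Qed.
Let dC x y : d x y = d y x. Proof. by case: md. Qed.
Let dT x y z : d x z <= d x y + d y z. Proof. by case: md. Qed.

Lemma measurable_dball x r : measurable (dball d x r).
Proof. by rewrite bX; apply: sub_gen_smallest; exists x, r. Qed.

(** The sigma-algebra is generated by balls only. The finite covers of radius [1 / (n+1)] supply
    countably many balls, and an open set is the union of those that it contains. *)
Lemma d_open_measurable A : d_open d A -> measurable A.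
Proof.
move=> oA.
have /choice[c cP] n : exists c : {N & 'I_N -> X},
    forall x, exists i, dball d (projT2 c i) n.+1%:R^-1 x.
  have [||N [c [_ cN]]] := cov (_ : 0 < n.+1%:R^-1) _.
  - by rewrite invr_gt0.
  - by rewrite invf_le1// ler1n.
  - by exists (existT _ N c).
pose U n := \bigcup_(i in [set i | dball d (projT2 (c n) i) n.+1%:R^-1 `<=` A])
  dball d (projT2 (c n) i) n.+1%:R^-1.
have -> : A = \bigcup_n U n.
  apply/seteqP; split=> [x Ax|x [n _ [i iA]]]; last exact: iA.
  have [r r0 rA] := oA _ Ax.
  have [n nr] : exists n, n.+1%:R^-1 < r / 2.
    have [n] := near_infty_natSinv_lt (PosNum (divr_gt0 r0 (ltr0n _ 2))).
    by move=> _ /(_ n (leqnn n)) nr; exists n.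
  have [i ix] := cP n x.
  exists n => //; exists i => // y iy; apply: rA; rewrite /dball /= in ix iy *.
  by have := dT x (projT2 (c n) i) y; rewrite (dC x (projT2 (c n) i)) => /le_lt_trans; apply; rewrite (splitr r) ltrD// (lt_trans _ nr).
apply: bigcup_measurable => n _; apply: fin_bigcup_measurable => //.
by move=> i _; exact: measurable_dball.
Qed.

Definition hol (f : X -> R) :=
  exists2 L, 0 <= L & forall x y, `|f x - f y| <= L * d x y `^ alpha.

Lemma hol_cst r : hol (fun=> r).
Proof. by exists 0 => // x y; rewrite subrr normr0 mul0r. Qed.

Lemma holD f g : hol f -> hol g -> hol (fun x => f x + g x).
Proof.
move=> [L L0 fL] [M M0 gM]; exists (L + M); first exact: addr_ge0.
move=> x y; rewrite opprD addrACA mulrDl.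
by apply: le_trans (ler_normD _ _) _; rewrite lerD.
Qed.

Lemma holZ r f : hol f -> hol (fun x => r * f x).
Proof.
move=> [L L0 fL]; exists (`|r| * L); first exact: mulr_ge0.
by move=> x y; rewrite -mulrBr normrM -mulrA ler_wpM2l.
Qed.

Lemma hol_sum I (s : seq I) (Q : pred I) (f : I -> X -> R) :
  (forall i, Q i -> hol (f i)) -> hol (fun x => \sum_(i <- s | Q i) f i x).
Proof.
move=> hf; elim: s => [|i s IH].
  by have := hol_cst 0; congr hol; apply/funext => x; rewrite big_nil.
have [Qi|Qi] := boolP (Q i).
  by have := holD (hf _ Qi) IH; congr hol; apply/funext => x; rewrite big_cons Qi.
by move: IH; congr hol; apply/funext => x; rewrite big_cons (negbTE Qi).
Qed.

Lemma hol_measurable f : hol f -> measurable_fun setT f.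
Proof.
move=> [L L0 fL] _; apply: (measurability _ (RGenOInfty.measurableE R)) => //.
move=> /= _ [_ [a ->] <-]; rewrite setTI; apply: d_open_measurable => x.
rewrite /= in_itv/= andbT => ax.
have q0 : 0 < (f x - a) / (L + 1) by rewrite divr_gt0 ?subr_gt0// ltr_wpDl.
exists (((f x - a) / (L + 1)) `^ alpha^-1); first exact: powR_gt0.
move=> y; rewrite /dball /= in_itv/= andbT => xy.
have : d x y `^ alpha <= (f x - a) / (L + 1).
  rewrite -[leRHS](powR_root (ltW q0) alpha0); apply: ge0_ler_powR; rewrite ?nnegrE ?(ltW alpha0)//.
    exact: powR_ge0.
  exact: ltW.
move=> /(ler_wpM2l L0) le.
have := le_trans (fL x y) le.
have : L * ((f x - a) / (L + 1)) < f x - a.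
  by rewrite mulrA ltr_pdivrMr ?ltr_wpDl// mulrDr; nra.
by move=> h1 h2; have := ler_norm (f x - f y); lra.
Qed.

(** Each point goes to the first center within [r], which yields disjoint measurable cells. [undup]
    makes the centers distinct, as positive definiteness and the l1 condition require. *)
Lemma net_partition r : 0 < r -> r <= 1 ->
  exists (N : nat) (t : 'I_N -> X) (idx : X -> 'I_N),
    [/\ N%:R <= Ceta * r `^ (- eta), injective t,
      (forall k, measurable (idx @^-1` [set k])) & forall x, d (t (idx x)) x < r].
Proof.
move=> r0 r1; have [n [c [nC cx]]] := cov r0 r1.
pose s := undup (codom c).
pose p x := (fun y => d y x < r) : pred X.
have hs x : has (p x) s.
  have [i ix] := cx x; apply/hasP; exists (c i) => //.
  by rewrite mem_undup; exact: codom_f.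
have fs x : (find (p x) s < size s)%N by rewrite -has_find.
exists (size s), (tnth (in_tuple s)), (fun x => Ordinal (fs x)); split.
- apply: le_trans nC; rewrite ler_nat.
  by apply: leq_trans (size_undup _) _; rewrite size_codom card_ord.
- by apply/tuple_uniqP; exact: undup_uniq.
- move=> k.
  have -> : (fun x => Ordinal (fs x)) @^-1` [set k] =
     dball d (tnth (in_tuple s) k) r `&`
     \bigcap_(j in [set j : 'I_(size s) | (j < k)%N]) ~` dball d (tnth (in_tuple s) j) r.
    apply/seteqP; split=> [x /= kx|x [/= kx jx]].
      have kx' : find (p x) s = k by rewrite -kx.
      split; first by rewrite /dball /= (tnth_nth x)/= -kx'; exact: (nth_find x (hs x)).
      move=> j /= jk; rewrite /dball /= (tnth_nth x)/=.
      by have := @before_find _ x (p x) s j; rewrite kx' jk => /(_ erefl) /negbT/negP.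
    apply: val_inj => /=; apply/eqP; rewrite eqn_leq; apply/andP; split.
      rewrite leqNgt; apply/negP => lt; have := before_find x lt.
      by move: kx; rewrite /p /dball /= (tnth_nth x)/= => ->.
    rewrite leqNgt; apply/negP => lt.
    apply: (jx (Ordinal (fs x)) lt); rewrite /dball /= (tnth_nth x)/=.
    exact: (nth_find x (hs x)).
  apply: measurableI; first exact: measurable_dball.
  apply: fin_bigcap_measurable => // j _; apply: measurableC; exact: measurable_dball.
- by move=> x; rewrite (tnth_nth x)/=; exact: (nth_find x (hs x)).
Qed.

Lemma hol_close (f : X -> R) L r x y : 0 <= L -> (forall x y, `|f x - f y| <= L * d x y `^ alpha) ->
  0 < r -> d x y < r -> `|f x - f y| <= L * r `^ alpha.
Proof.
move=> L0 fL r0 xy; apply: le_trans (fL x y) _; rewrite ler_wpM2l//.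
by apply: ge0_ler_powR; rewrite ?nnegrE ?(ltW alpha0) ?(ltW r0)// ltW.
Qed.

Lemma hol_bounded f : hol f -> exists B, forall x, `|f x| <= B.
Proof.
move=> [L L0 fL]; have [N [t [idx [_ _ _ tx]]]] := net_partition ltr01 (lexx 1).
exists (\sum_k `|f (t k)| + L) => x.
have := hol_close L0 fL ltr01 (tx x); rewrite powR1 mulr1 => h.
have : `|f (t (idx x))| <= \sum_k `|f (t k)|.
  by rewrite (bigD1 (idx x))//= lerDl sumr_ge0.
have := ler_distD (f (t (idx x))) (f x) 0; rewrite !subr0 distrC.
lra.
Qed.

Lemma hol_bmeas f : hol f -> bmeas f.
Proof. by move=> hf; split; [exact: hol_measurable|exact: hol_bounded]. Qed.

Lemma holM f g : hol f -> hol g -> hol (fun x => f x * g x).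
Proof.
move=> hf hg; have [B fB] := hol_bounded hf; have [C gC] := hol_bounded hg.
case: hf hg => L L0 fL [M M0 gM].
exists (L * `|C| + `|B| * M); first by rewrite addr_ge0// mulr_ge0.
move=> x y; have -> : f x * g x - f y * g y = (f x - f y) * g x + f y * (g x - g y) by ring.
apply: le_trans (ler_normD _ _) _; rewrite !normrM mulrDl; apply: lerD.
  rewrite mulrAC; apply: ler_pM => //; exact: le_trans (gC x) (ler_norm _).
by rewrite -mulrA; apply: ler_pM => //; exact: le_trans (fB y) (ler_norm _).
Qed.

End Metric.

(** * The integral operator *)

Section StepFunctions.
Context {R : realType} {dX : measure_display} {X : measurableType dX}.
Variable rho : probability (X * R)%type R.

Lemma bmeas_fst (f : X -> R) : bmeas f -> bmeas (fun z : X * R => f z.1).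
Proof. exact: bmeas_comp. Qed.

Variables (N : nat) (idx : X -> 'I_N).
Hypothesis midx : forall k, measurable (idx @^-1` [set k]).

Let stepE (v : 'I_N -> R) x : v (idx x) = \sum_k v k * \1_(idx @^-1` [set k]) x.
Proof.
rewrite (bigD1 (idx x))//= indicE mem_set// mulr1 big1 ?addr0// => k /eqP nk.
by rewrite indicE memNset ?mulr0// => /= e; apply: nk.
Qed.

Lemma bmeas_step (v : 'I_N -> R) : bmeas (fun x => v (idx x)).
Proof.
have -> : (fun x => v (idx x)) = fun x => \sum_k v k * \1_(idx @^-1` [set k]) x.
  by apply/funext => x; exact: stepE.
by apply: bmeas_sum => k _; apply: bmeasZ; exact: bmeas_indic.
Qed.

Definition cell_mass k := \int[rho]_z \1_(idx @^-1` [set k]) z.1.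

Lemma Ex_step (v : 'I_N -> R) : \int[rho]_z v (idx z.1) = \sum_k cell_mass k * v k.
Proof.
under eq_Rintegral do rewrite stepE.
rewrite Ex_sum; last first.
  by move=> k _; apply: bmeasZ; apply: bmeas_fst; exact: bmeas_indic.
apply: eq_bigr => k _; rewrite ExZ 1?mulrC//.
by apply: bmeas_fst; exact: bmeas_indic.
Qed.

Lemma cell_mass_ge0 k : 0 <= cell_mass k.
Proof. by apply: Ex_ge0 => z; rewrite indicE. Qed.

Lemma sum_cell_mass : \sum_k cell_mass k = 1.
Proof.
by rewrite -[RHS](Ex_cst rho) (Ex_step (fun=> 1)); apply: eq_bigr => k _; rewrite mulr1.
Qed.

End StepFunctions.

Section KernelOperator.
Context {R : realType} {dX : measure_display} {X : measurableType dX}.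
Variables (d : X -> X -> R) (rho : probability (X * R)%type R) (K : X -> X -> R).
Variables (eta Ceta alpha Calpha : R).
Hypotheses (md : is_metric d) (bX : borel_for d) (cov : covering_cond d eta Ceta).
Hypotheses (alpha0 : 0 < alpha) (Calpha0 : 0 < Calpha).
Hypotheses (pdK : pd_kernel K) (holK : holder_cond d K alpha Calpha).

Let symK x t : K x t = K t x. Proof. exact: pdK.1. Qed.
Let bh f : hol d alpha f -> bmeas f. Proof. exact: (hol_bmeas md bX cov alpha0). Qed.

(** The arguments are moved one at a time to a net of radius 1; the Hoelder condition handles the
    second argument, symmetry the first. *)
Lemma kernel_bounded : exists2 kappa, 0 < kappa & forall x t, `|K x t| <= kappa.
Proof.
have [N [t [idx [_ _ _ tx]]]] := net_partition bX cov ltr01 (lexx 1).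
have close x y z : d y z < 1 -> `|K x y - K x z| <= Calpha.
  move=> yz; have := hol_close md alpha0 (ltW Calpha0) (@holK x) ltr01 yz.
  by rewrite powR1 mulr1.
exists (\sum_i \sum_j `|K (t i) (t j)| + 2 * Calpha).
  by rewrite ltr_wpDl ?mulr_gt0// sumr_ge0// => i _; apply: sumr_ge0.
move=> x y; have h1 := close x _ _ (tx y).
have h2 := close (t (idx y)) _ _ (tx x).
have h3 : `|K (t (idx x)) (t (idx y))| <= \sum_i \sum_j `|K (t i) (t j)|.
  rewrite (bigD1 (idx x))//= (bigD1 (idx y))//= -addrA lerDl addr_ge0 ?sumr_ge0//.
  by move=> i _; apply: sumr_ge0.
have e : K x y = K (t (idx x)) (t (idx y)) - (K (t (idx y)) (t (idx x)) - K (t (idx y)) x)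
   - (K x (t (idx y)) - K x y).
  by rewrite (symK (t (idx y)) (t (idx x))) (symK (t (idx y)) x); ring.
rewrite e; apply: le_trans (ler_normB _ _) _.
have := ler_normB (K (t (idx x)) (t (idx y))) (K (t (idx y)) (t (idx x)) - K (t (idx y)) x).
lra.
Qed.

Lemma hol_kernel x : hol d alpha (K x).
Proof. by exists Calpha; [exact: ltW|exact: holK]. Qed.

Lemma hol_kernel_fun N (t : 'I_N -> X) c : hol d alpha (kernel_fun K t c).
Proof.
apply: hol_sum => j _; have := holZ (c j) (hol_kernel (t j)).
by congr hol; apply/funext => x; rewrite mulrC.
Qed.

Lemma kernel_fun_holder N (t : 'I_N -> X) c x y :
  `|kernel_fun K t c x - kernel_fun K t c y| <= (\sum_j `|c j|) * Calpha * d x y `^ alpha.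
Proof.
rewrite /kernel_fun -sumrB; apply: le_trans (ler_norm_sum _ _ _) _.
rewrite -mulrA mulr_suml; apply: ler_sum => j _.
by rewrite -mulrBl normrM mulrC ler_wpM2l.
Qed.

Lemma kernel_fun_bound kappa N (t : 'I_N -> X) c x : (forall x t, `|K x t| <= kappa) ->
  `|kernel_fun K t c x| <= kappa * \sum_j `|c j|.
Proof.
move=> Kk; apply: le_trans (ler_norm_sum _ _ _) _; rewrite mulr_sumr.
by apply: ler_sum => j _; rewrite normrM ler_wpM2r.
Qed.

Definition LK (f : X -> R) (x : X) := \int[rho]_z (K x z.1 * f z.1).

Lemma bmeas_LK_integrand f x : bmeas f -> bmeas (fun z : X * R => K x z.1 * f z.1).
Proof.
move=> bf; apply: bmeasM; first by apply: bmeas_fst; apply: bh; exact: hol_kernel.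
exact: bmeas_fst.
Qed.

Lemma hol_LK f : bmeas f -> hol d alpha (LK f).
Proof.
move=> bf; have [B fB] := bf.2.
exists (Calpha * `|B|); first by rewrite mulr_ge0// ltW.
move=> x y; rewrite /LK -ExB; [|exact: bmeas_LK_integrand..].
apply: Ex_norm_le; first by apply: bmeasB; exact: bmeas_LK_integrand.
move=> z; rewrite -mulrBl normrM (symK x) (symK y) mulrAC.
by apply: ler_pM => //; exact: le_trans (fB _) (ler_norm _).
Qed.

Lemma LK_sum I (s : seq I) (c : I -> R) (f : I -> X -> R) x : (forall i, bmeas (f i)) ->
  LK (fun x => \sum_(i <- s) c i * f i x) x = \sum_(i <- s) c i * LK (f i) x.
Proof.
move=> bf; rewrite /LK; under eq_Rintegral do rewrite mulr_sumr.
rewrite Ex_sum; last first.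
  by move=> i _; apply: (bmeas_LK_integrand (f := fun y => c i * f i y)); exact: bmeasZ.
apply: eq_bigr => i _; rewrite -ExZ; last exact: bmeas_LK_integrand.
by apply: eq_Rintegral => z _; ring.
Qed.

(** The net has radius [e^(1/alpha)], so the error is linear in [e]. Nodes and weights do not depend
    on [f]: one discretization serves all functions at once. *)
Lemma discretization e : 0 < e -> e <= 1 -> exists (N : nat) (t : 'I_N -> X) (w : 'I_N -> R),
  [/\ injective t, forall k, 0 <= w k, \sum_k w k = 1 &
    forall f L, 0 <= L -> (forall x y, `|f x - f y| <= L * d x y `^ alpha) ->
      `|\int[rho]_z f z.1 - \sum_k w k * f (t k)| <= L * e].
Proof.
move=> e0 e1; have r0 : 0 < e `^ alpha^-1 by exact: powR_gt0.
have r1 : e `^ alpha^-1 <= 1.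
  have a1 : 0 <= alpha^-1 by rewrite invr_ge0 ltW.
  by have := ge0_ler_powR a1 (ltW e0 : e \in Num.nneg) (ler01 : 1 \in Num.nneg) e1; rewrite powR1.
have [N [t [idx [_ it mi tx]]]] := net_partition bX cov r0 r1.
exists N, t, (cell_mass rho idx); split => //.
- exact: cell_mass_ge0.
- exact: sum_cell_mass.
- move=> f L L0 fL; have hf : hol d alpha f by exists L.
  have b1 := bmeas_fst (bh hf).
  have b2 := bmeas_fst (bmeas_step mi (fun k => f (t k))).
  rewrite -(Ex_step rho mi (fun k => f (t k))) -ExB//.
  apply: Ex_norm_le; first exact: bmeasB.
  move=> z; rewrite distrC; have := hol_close md alpha0 L0 fL r0 (tx z.1).
  by rewrite powR_root// ltW.
Qed.

Lemma LK_discretized e N (t : 'I_N -> X) (w : 'I_N -> R) f kappa B L x :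
  (forall x t, `|K x t| <= kappa) -> (forall x, `|f x| <= B) -> 0 <= L ->
  (forall x y, `|f x - f y| <= L * d x y `^ alpha) ->
  (forall f L, 0 <= L -> (forall x y, `|f x - f y| <= L * d x y `^ alpha) ->
      `|\int[rho]_z f z.1 - \sum_k w k * f (t k)| <= L * e) ->
  `|LK f x - kernel_fun K t (fun k => w k * f (t k)) x| <= (kappa * L + B * Calpha) * e.
Proof.
move=> Kk fB L0 fL disc.
have k0 : 0 <= kappa by exact: le_trans (Kk x x).
have B0 : 0 <= B by exact: le_trans (fB x).
have -> : kernel_fun K t (fun k => w k * f (t k)) x = \sum_k w k * (K x (t k) * f (t k)).
  by apply: eq_bigr => k _; rewrite symK; ring.
apply: (disc (fun y => K x y * f y)); first by rewrite addr_ge0 ?mulr_ge0// ltW.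
move=> y y'; have -> : K x y * f y - K x y' * f y' = K x y * (f y - f y') + f y' * (K x y - K x y') by ring.
apply: le_trans (ler_normD _ _) _; rewrite mulrDl !normrM -!mulrA; apply: lerD.
  by apply: ler_pM.
by apply: ler_pM.
Qed.

(** Positivity passes from finite sums to the integral: the discretization error is at most [C * e]
    with [C] independent of [e]. *)
Lemma LK_ge0 f : hol d alpha f -> 0 <= \int[rho]_z (f z.1 * LK f z.1).
Proof.
move=> hf; have [kappa k0 Kk] := kernel_bounded.
have [B fB] := (bh hf).2.
have hL := hol_LK (bh hf).
have [L' L'0 fL'] := holM md bX cov alpha0 hf hL.
have [L L0 fL] := hf.
set I := \int[rho]_z _; pose C := L' + B * (kappa * L + B * Calpha).
have B0 : 0 <= B.
  exact: le_trans (normr_ge0 _) (Ex_norm_le rho (bmeas_fst (bh hf)) (fun z => fB z.1)).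
have C0 : 0 <= C by rewrite addr_ge0 ?mulr_ge0// addr_ge0 ?mulr_ge0// ltW.
have le e : 0 < e -> e <= 1 -> - (C * e) <= I.
  move=> e0 e1; have [N [t [w [it w0 w1 disc]]]] := discretization e0 e1.
  have h1 := disc _ _ L'0 fL'.
  have h2 := pd_ge0 pdK (fun k => w k * f (t k)) it.
  have h3 : \sum_k w k * (f (t k) * LK f (t k)) >=
     \sum_k w k * f (t k) * kernel_fun K t (fun k => w k * f (t k)) (t k)
      - B * (kappa * L + B * Calpha) * e.
    rewrite -[X in _ - X]mul1r -w1 mulr_suml -sumrB; apply: ler_sum => k _.
    have h4 := LK_discretized (t k) Kk fB L0 fL disc.
    rewrite -mulrA -mulrBr ler_wpM2l// lerBlDr -lerBlDl -mulrBr.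
    apply: le_trans (ler_norm _) _; rewrite normrM distrC -mulrA.
    by apply: ler_pM.
  move: h1; rewrite ler_norml => /andP[h1 _]; rewrite /C mulrDl /I; lra.
rewrite leNgt; apply/negP => I0.
pose e := Num.min 1 (- I / (2 * (C + 1))).
have C1 : 0 < 2 * (C + 1) by rewrite mulr_gt0// ltr_wpDl.
have e0 : 0 < e by rewrite lt_min ltr01/= divr_gt0// oppr_gt0.
have := le e e0; rewrite ge_min lexx => /(_ erefl).
have : e * (2 * (C + 1)) <= - I by rewrite -ler_pdivlMr// ge_min lexx orbT.
nra.
Qed.

End KernelOperator.

(** * Spectral expansion of the regression function *)

Lemma Ex_ae_bmeas (R : realType) dT (T : measurableType dT) (P : probability T R) (f g : T -> R) :
  measurable_fun setT f -> bmeas g -> {ae P, forall x, f x = g x} ->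
  (\int[P]_x (f x)%:E = (\int[P]_x g x)%R%:E)%E.
Proof.
move=> mf bg fg; rewrite ExE//; apply: ae_eq_integral => //.
- exact/measurable_EFinP.
- by apply/measurable_EFinP; exact: bg.1.
- by apply: filterS fg => x /= -> _.
Qed.

Section Spectral.
Context {R : realType} {dX : measure_display} {X : measurableType dX}.
Variables (d : X -> X -> R) (rho : probability (X * R)%type R) (K : X -> X -> R).
Variables (eta Ceta alpha Calpha : R).
Hypotheses (md : is_metric d) (bX : borel_for d) (cov : covering_cond d eta Ceta).
Hypotheses (alpha0 : 0 < alpha) (Calpha0 : 0 < Calpha).
Hypotheses (pdK : pd_kernel K) (holK : holder_cond d K alpha Calpha).

Let symK x t : K x t = K t x. Proof. exact: pdK.1. Qed.
Let bh f : hol d alpha f -> bmeas f. Proof. exact: (hol_bmeas md bX cov alpha0). Qed.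
Let bKx x : bmeas (fun z : X * R => K x z.1).
Proof. by apply: bmeas_fst; apply: bh; exact: (hol_kernel Calpha0 holK). Qed.
Let L_K := LK rho K.

(* An eigenfunction for a nonzero eigenvalue agrees almost everywhere with its
   own image under the integral operator, which is Hoelder continuous. *)
Lemma eigenfunction_version (phi : X -> R) lam : lam != 0 -> L2X rho phi ->
  {ae rho, forall z : X * R,
    \int[rho]_w ((K w.1 z.1 * phi w.1)%R)%:E = ((lam * phi z.1)%R)%:E}%E ->
  exists psi, [/\ hol d alpha psi, {ae rho, forall z, phi z.1 = psi z.1} &
    forall x, L_K psi x = lam * psi x].
Proof.
move=> lam0 [mphi iphi2] eig.
have mp : measurable_fun setT (fun z : X * R => phi z.1).
  by apply: measurableT_comp => //; exact: measurable_fst.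
(* [phi] is only square integrable; [|phi| <= 1 + phi^2] suffices under a probability measure. *)
have iphi : rho.-integrable setT (EFin \o (fun z : X * R => phi z.1)).
  apply: (le_integrable _ _ _ (g := fun z => (1 + phi z.1 ^+ 2)%:E)) => //.
  - exact/measurable_EFinP.
  - move=> z _; rewrite !abse_EFin lee_fin [leRHS]ger0_norm ?addr_ge0 ?sqr_ge0//.
    rewrite ler_norml; have := sqr_ge0 (phi z.1 - 1); have := sqr_ge0 (phi z.1 + 1).
    by rewrite !expr2 => h1 h2; apply/andP; split; nra.
  - have := integrableD measurableT (bmeas_integrable rho (bmeas_cst 1)) iphi2.
    by apply: eq_integrable => // z _; rewrite /= EFinD.
have iM g : bmeas g -> rho.-integrable setT (EFin \o (fun z => g z * phi z.1)).
  move=> [mg [B gB]].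
  apply: (le_integrable _ _ _ (g := fun z => (`|B| * phi z.1)%:E)) => //.
  - by apply/measurable_EFinP; exact: measurable_funM.
  - move=> z _; rewrite !abse_EFin lee_fin !normrM normr_id ler_wpM2r//.
    exact: le_trans (gB z) (ler_norm _).
  - have := integrableZl measurableT `|B| iphi.
    by apply: eq_integrable => // z _; rewrite /= EFinM.
pose J x := \int[rho]_w (K x w.1 * phi w.1).
pose psi x := lam^-1 * J x.
have hpsi : hol d alpha psi.
  apply: holZ; exists (Calpha * \int[rho]_w `|phi w.1|).
    by apply: mulr_ge0; [exact: ltW|apply: Rintegral_ge0].
  move=> x y; rewrite /J -RintegralB//; [|exact: iM..].
  have inorm : rho.-integrable setT (EFin \o (fun z : X * R => `|phi z.1|)).
    exact: integrable_norm.
  apply: (@le_trans _ _ (\int[rho]_w (Calpha * d x y `^ alpha * `|phi w.1|))).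
    have bxy : bmeas (fun w : X * R => K x w.1 - K y w.1) by exact: bmeasB.
    have i1 := iM _ bxy.
    have e1 : (fun w : X * R => K x w.1 * phi w.1 - K y w.1 * phi w.1) =
      (fun w => (K x w.1 - K y w.1) * phi w.1) by apply/funext => w; rewrite mulrBl.
    rewrite e1; apply: le_trans (le_normr_Rintegral _ i1) _ => //.
    apply: le_Rintegral => //.
    - exact: integrable_norm i1.
    - have := integrableZl measurableT (Calpha * d x y `^ alpha) inorm.
      by apply: eq_integrable => // z _; rewrite /= EFinM.
    - by move=> w _; rewrite normrM ler_wpM2r// (symK x) (symK y).
  by rewrite RintegralZl// mulrAC.
have phipsi : {ae rho, forall z, phi z.1 = psi z.1}.
  apply: filterS eig => z; have fJ : (\int[rho]_w ((K w.1 z.1 * phi w.1)%R)%:E = (J z.1)%:E)%E.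
    rewrite /J fineK; last by apply: integrable_fin_num => //; exact: iM.
    by apply: eq_integral => w _; rewrite symK.
  by rewrite fJ => -[h]; rewrite /psi h mulKf.
exists psi; split => // x; rewrite /psi mulrA divff// mul1r /J /L_K /LK.
have e := Ex_ae_bmeas (measurable_funM (bKx x).1 mp) (bmeasM (bKx x) (bmeas_fst (bh hpsi))).
apply/esym; rewrite /Rintegral e//.
by apply: filterS phipsi => z /= ->.
Qed.

(* Positivity matters in [l `^ s], whose value is [1] for [l < 0]. *)
Lemma eigenvalue_bounds (psi : X -> R) lam kappa : (forall x t, `|K x t| <= kappa) ->
  hol d alpha psi -> \int[rho]_z (psi z.1 * psi z.1) = 1 -> lam != 0 ->
  (forall x, L_K psi x = lam * psi x) -> 0 < lam <= kappa.
Proof.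
move=> Kk hpsi p1 lam0 eig.
have bpsi := bmeas_fst (bh hpsi).
have k0 : 0 <= kappa by exact: le_trans (Kk point point).
have E2 : \int[rho]_z (psi z.1 ^+ 2) = 1 by rewrite -p1; apply: eq_Rintegral => z _.
apply/andP; split.
  rewrite lt_neqAle eq_sym lam0/=.
  have := LK_ge0 rho md bX cov alpha0 Calpha0 pdK holK hpsi.
  rewrite -[X in _ -> 0 <= X]mulr1 -p1 -ExZ; last exact: bmeasM.
  by congr (0 <= _); apply: eq_Rintegral => z _; rewrite -/L_K eig mulrCA.
have [lam_lt0|lam_ge0] := ltP lam 0; first exact: le_trans (ltW lam_lt0) _.
rewrite -(@ler_pXn2r _ 2)// ?nnegrE//.
(* Cauchy-Schwarz gives [|lam psi| <= kappa] pointwise; integrating the square against the unit norm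
   of [psi] gives [lam^2 <= kappa^2]. *)
have bnd x : (lam * psi x) ^+ 2 <= kappa ^+ 2.
  rewrite -eig; apply: le_trans (Ex_CS rho (bKx x) bpsi) _.
  rewrite E2 mulr1 -[leRHS](Ex_cst rho); apply: Ex_le; [exact: bmeasX|exact: bmeas_cst|].
  by move=> z; rewrite -real_normK ?num_real// lerXn2r ?nnegrE.
have -> : lam ^+ 2 = \int[rho]_z ((lam * psi z.1) ^+ 2).
  under eq_Rintegral do rewrite exprMn.
  by rewrite ExZ ?E2 ?mulr1//; exact: bmeasX.
rewrite -[leRHS](Ex_cst rho); apply: Ex_le; [|exact: bmeas_cst|by move=> z].
by apply: bmeasX; exact: bmeasZ.
Qed.

(** Reduces the spectral hypothesis to finite sums of Hoelder eigenfunctions. Terms with eigenvalue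
    zero drop out since [0^s = 0] for [s > 0]. The bound [A] does not depend on the truncation error
    [e], so later constants do not either. *)
Lemma spectral_data s frho f0 kappa : 0 < s -> in_range_LKs rho K s frho ->
  measurable_fun setT frho -> bmeas f0 -> {ae rho, forall z, frho z.1 = f0 z.1} ->
  (forall x t, `|K x t| <= kappa) ->
  exists A, forall e, 0 < e ->
  exists n (psi : 'I_n -> X -> R) (l a : 'I_n -> R),
  [/\ forall i, hol d alpha (psi i), forall i, 0 < l i <= kappa,
      forall i x, L_K (psi i) x = l i * psi i x,
      forall i j, \int[rho]_z (psi i z.1 * psi j z.1) = (i == j)%:R &
      \sum_i a i ^+ 2 <= A /\
      \int[rho]_z ((f0 z.1 - \sum_i l i `^ s * a i * psi i z.1) ^+ 2) <= e].
Proof.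
move=> s0 [J [phi [lam [a [L2 orth _ eig [[A aA] cv]]]]]] mf bf0 ff0 Kk.
pose Q j := (j \in J) && (lam j != 0).
have /choice[psi psiP] j : exists p, Q j -> [/\ hol d alpha p,
    {ae rho, forall z, phi j z.1 = p z.1} & forall x, L_K p x = lam j * p x].
  have [Qj|Qj] := boolP (Q j); last by exists (fun=> 0).
  move: (Qj); rewrite /Q => /andP[/set_mem Jj lj].
  by have [p pP] := eigenfunction_version lj (L2 _ Jj) (eig _ Jj); exists p.
have mphi j : Q j -> measurable_fun setT (fun z : X * R => phi j z.1).
  case/andP => /set_mem /L2 [mp _] _.
  by apply: measurableT_comp => //; exact: measurable_fst.
have bpsi j : Q j -> bmeas (fun z : X * R => psi j z.1).
  by move=> /psiP[hp _ _]; apply: bmeas_fst; exact: bh.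
have orth' i j : Q i -> Q j -> \int[rho]_z (psi i z.1 * psi j z.1) = (i == j)%:R.
  move=> Qi Qj; apply: EFin_inj; rewrite -(Ex_ae_bmeas (measurable_funM (mphi _ Qi) (mphi _ Qj))).
  - case/andP: (Qi) => /set_mem Ji _; case/andP: (Qj) => /set_mem Jj _.
    by rewrite orth//; case: eqP.
  - by apply: bmeasM; exact: bpsi.
  - have [_ ei _] := psiP _ Qi; have [_ ej _] := psiP _ Qj.
    by apply: filterS2 ei ej => z /= -> ->.
have lamP j : Q j -> 0 < lam j <= kappa.
  move=> Qj; have [hp _ ep] := psiP _ Qj.
  apply: (eigenvalue_bounds Kk hp) => //; first by rewrite orth'// eqxx.
  by case/andP: Qj.
exists A => e e0.
have cvn : nbhs (0 : \bar R)%E [set u : \bar R | (u < e%:E)%E].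
  by apply: open_ereal_lt'; rewrite lte_fin.
have [n _ /(_ n (leqnn n))] := cv _ cvn.
move=> /= lte.
pose r := [seq j <- index_iota 0 n | Q j].
pose x (i : 'I_(size r)) := tnth (in_tuple r) i.
have Qx i : Q (x i).
  by have := mem_tnth i (in_tuple r); rewrite mem_filter => /andP[].
have ix : injective x.
  by apply/tuple_uniqP; rewrite /= /r filter_uniq// iota_uniq.
have sumr (F : nat -> R) : \sum_(0 <= j < n | Q j) F j = \sum_i F (x i).
  by rewrite -big_filter -/r big_tnth.
exists (size r), (psi \o x), (lam \o x), (a \o x); split => /=.
- by move=> i; have [] := psiP _ (Qx i).
- by move=> i; exact: lamP.
- by move=> i; have [] := psiP _ (Qx i).
- by move=> i j; rewrite orth'// (inj_eq ix).
split.
  apply: le_trans (aA n); rewrite -(sumr (fun j => a j ^+ 2)) /Q.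
  rewrite big_mkcondr/=; apply: ler_sum => j _; case: ifP => // _; exact: sqr_ge0.
rewrite -lee_fin; apply: le_trans (ltW lte).
have mS : measurable_fun setT (fun z : X * R =>
    (frho z.1 - \sum_(0 <= j < n | j \in J) lam j `^ s * a j * phi j z.1) ^+ 2).
  apply: measurable_funX; apply: measurable_funB.
    by apply: measurableT_comp => //; exact: measurable_fst.
  have -> : (fun z : X * R => \sum_(0 <= j < n | j \in J) lam j `^ s * a j * phi j z.1) =
      fun z => \sum_(0 <= j < n) if j \in J then lam j `^ s * a j * phi j z.1 else 0.
    by apply/funext => z; rewrite big_mkcond.
  apply: measurable_sum => j; have [jJ|_] := boolP (j \in J); last exact: measurable_cst.
  apply: measurable_funM; first exact: measurable_cst.
  have [mp _] := L2 _ (set_mem jJ).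
  by apply: measurableT_comp => //; exact: measurable_fst.
rewrite (Ex_ae_bmeas mS (g := fun z => (f0 z.1 - \sum_i lam (x i) `^ s * a (x i) * psi (x i) z.1) ^+ 2)) //.
  apply: bmeasX; apply: bmeasB; first exact: bmeas_fst.
  by apply: bmeas_sum => i _; apply: bmeasZ; exact: bpsi.
have aeQ : {ae rho, forall z : X * R, forall j, Q j -> phi j z.1 = psi j z.1}.
  apply: ae_foralln => j; have [Qj|nQ] := pselect (Q j); last exact: aeW.
  by have [_ ep _] := psiP _ Qj; apply: filterS ep => z ->.
apply: filterS2 ff0 aeQ => z -> E; congr (_ ^+ 2); congr (_ - _).
rewrite -(sumr (fun j => lam j `^ s * a j * psi j z.1)) [RHS]big_mkcond [LHS]big_mkcond/=.
apply: eq_bigr => j _; have [Qj|] := boolP (Q j).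
  by case/andP: (Qj) => -> _; rewrite E.
rewrite /Q negb_and negbK => /orP[/negbTE -> //|/eqP ->].
by case: ifP => // _; rewrite powR0 ?gt_eqF// !mul0r.
Qed.

End Spectral.

(** * Comparison functions *)

Section Filters.
Context {R : realType}.
Implicit Types x k p s : R.

Lemma ler_powRl p x y : 0 <= p -> 0 <= x -> x <= y -> x `^ p <= y `^ p.
Proof.
by move=> p0 x0 xy; apply: ge0_ler_powR; rewrite ?nnegrE//; exact: le_trans xy.
Qed.

Lemma powR_split p x : 0 < x -> x `^ p * x `^ (1 - p) = x.
Proof.
move=> x0; rewrite -powRD; last by rewrite (gt_eqF x0) implybT.
by rewrite addrC subrK powRr1// ltW.
Qed.

Lemma powR_young p x k : 0 <= p <= 1 -> 0 < x -> 0 < k -> x `^ p * k `^ (1 - p) <= x + k.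
Proof.
move=> /andP[p0 p1] x0 k0; have xk : 0 < x + k by exact: addr_gt0.
have <- : (x + k) `^ p * (x + k) `^ (1 - p) = x + k by exact: powR_split.
by apply: ler_pM; rewrite ?powR_ge0//; apply: ler_powRl; rewrite ?subr_ge0 ?lerDl ?lerDr// ltW.
Qed.

(** The saturation [s <= 2] of the filter enters here: [y = k / (x + k)] is at most 1, so
    [y^2 <= y^s], while [y x <= k]. *)
Lemma filter_residual s x k : 0 < s <= 2 -> 0 < x -> 0 < k ->
  (k / (x + k)) ^+ 2 * x `^ s <= k `^ s.
Proof.
move=> /andP[s0 s2] x0 k0; have xk : 0 < x + k by exact: addr_gt0.
have y0 : 0 < k / (x + k) by rewrite divr_gt0.
have y1 : k / (x + k) <= 1 by rewrite ler_pdivrMr// mul1r lerDr ltW.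
apply: (@le_trans _ _ ((k / (x + k)) `^ s * x `^ s)).
  rewrite ler_wpM2r ?powR_ge0// -powR_mulrn ?(ltW y0)//.
  by apply: ger_powR => //; rewrite y0.
rewrite -powRM ?(ltW y0) ?(ltW x0)//; apply: ler_powRl; first exact: ltW.
  by rewrite mulr_ge0 ?(ltW y0) ?(ltW x0).
by rewrite mulrAC ler_pdivrMr// ler_pM2l// lerDl ltW.
Qed.

(** The factor [(x + 2k) / (x + k)^2] is [(1 - (k / (x + k))^2) / x], what remains of the filter
    after one division by the eigenvalue. *)
Lemma filter_size p x k : 0 <= p <= 1 -> 0 < x -> 0 < k ->
  (x + 2 * k) / (x + k) ^+ 2 * x `^ p <= 2 * (k `^ p / k).
Proof.
move=> p01 x0 k0; have xk : 0 < x + k by exact: addr_gt0.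
have h := powR_young p01 x0 k0.
have kp := powR_split p k0.
apply: (@le_trans _ _ (2 / (x + k) * x `^ p)).
  rewrite ler_wpM2r ?powR_ge0// expr2 invfM mulrA ler_wpM2r ?invr_ge0 ?(ltW xk)//.
  by rewrite ler_pdivrMr//; lra.
rewrite -mulrA ler_pM2l// mulrC ler_pdivrMr// mulrAC ler_pdivlMr//.
rewrite -[X in _ * X <= _]kp mulrCA ler_wpM2l ?powR_ge0//.
Qed.

End Filters.

Section Arithmetic.
Context {R : realType}.
Implicit Types A q k e eps : R.

Lemma parts_le (a b c f g e eps : R) :
  0 <= a -> 0 <= b -> 0 <= c -> 0 <= f -> 0 <= g -> 0 < e ->
  (a + b + c + f + g) * e <= eps ->
  [/\ a * e <= eps, b * e + c * e <= eps, f * e <= eps & g * e <= eps].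
Proof.
move=> a0 b0 c0 f0 g0 e0; rewrite !mulrDl => h.
have ae := mulr_ge0 a0 (ltW e0); have be := mulr_ge0 b0 (ltW e0).
have ce := mulr_ge0 c0 (ltW e0); have fe := mulr_ge0 f0 (ltW e0).
by have ge := mulr_ge0 g0 (ltW e0); split; lra.
Qed.

(** Case [s <= 1], with [q = k^s] and [k q = lambda]. The norm [sc] of the other expansion is
    dropped, and the penalty has order [k q (q / k) = q^2]. *)
Lemma small_gap A q k sg sc : 1 <= A -> 0 < q -> q <= 1 -> 0 < k -> k <= 1 ->
  0 <= sc -> sg <= 2 * A * (q / k) + q ^+ 2 -> k * q * (sg - sc) <= (10 * A + 10) * q ^+ 2.
Proof.
move=> A1 q0 q1 k0 k1 c0 h.
have kn : k != 0 by rewrite gt_eqF.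
have h2 : k * q * (sg - sc) <= k * q * (2 * A * (q / k) + q ^+ 2).
  by rewrite ler_pM2l ?mulr_gt0//; lra.
have h3 : k * q * (2 * A * (q / k) + q ^+ 2) = 2 * A * q ^+ 2 + (k * q) * q ^+ 2 by field.
have q20 : 0 < q ^+ 2 by exact: exprn_gt0.
have h4 : k * q * q ^+ 2 <= 1 * q ^+ 2.
  by rewrite ler_pM2r// -[leRHS]mul1r ler_pM// ltW.
have h5 : 0 <= A * q ^+ 2 by rewrite mulr_ge0 ?(ltW q20)//; lra.
rewrite h3 in h2; apply: le_trans h2 _; rewrite mulrDl; lra.
Qed.

(** Case [s > 1], with [tau = q / k], [mu = k] and [th = 2 k q] in [coefficient_norm_gap]. Since
    [k^2 B <= (2A+1) q], the first three terms become of order [q^2] once multiplied by [k q]. The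
    last becomes [I / 8] up to that order, and [I <= 2 E + ...] leaves the share [E / 4] of the
    excess risk, small enough to be absorbed in [risk_arith]. *)
Lemma large_gap A q k D I E : 1 <= A -> 0 < q -> q <= 1 -> 0 < k -> k <= 1 ->
  0 <= E -> I <= 2 * E + 2 * ((4 * A + 5) * q ^+ 2) ->
  let B := 2 * A * (q / k ^+ 2) + q ^+ 2 in
  D <= q / k + k * B + 2 * (k * q) * (B / (2 * (q / k) * k)) + (4 * (2 * (k * q)))^-1 * (I + q ^+ 2) ->
  k * q * D <= (10 * A + 10) * q ^+ 2 + 4^-1 * E.
Proof.
move=> A1 q0 q1 k0 k1 E0 IE B DB.
have kn : k != 0 by rewrite gt_eqF.
have qn : q != 0 by rewrite gt_eqF.
have kq0 : 0 < k * q by exact: mulr_gt0.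
have := ler_wpM2l (ltW kq0) DB.
have Bk : k ^+ 2 * B <= (2 * A + 1) * q.
  have -> : k ^+ 2 * B = 2 * A * q + (k * q) ^+ 2 by rewrite /B; field.
  have : (k * q) ^+ 2 <= q.
    rewrite exprMn -[leRHS]mul1r; apply: ler_pM; rewrite ?sqr_ge0//.
      by rewrite expr_le1// ltW.
    by rewrite expr2 ler_piMl// ltW.
  lra.
have -> : k * q * (q / k + k * B + 2 * (k * q) * (B / (2 * (q / k) * k)) +
   (4 * (2 * (k * q)))^-1 * (I + q ^+ 2)) =
   q ^+ 2 + 2 * (q * (k ^+ 2 * B)) + 8^-1 * (I + q ^+ 2).
  by field; rewrite kn qn.
have qB : q * (k ^+ 2 * B) <= (2 * A + 1) * q ^+ 2.
  have -> : (2 * A + 1) * q ^+ 2 = q * ((2 * A + 1) * q) by ring.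
  exact: (ler_wpM2l (ltW q0) Bk).
have Aq : 0 <= A * q ^+ 2 by rewrite mulr_ge0 ?sqr_ge0//; lra.
have q20 := sqr_ge0 q; move: IE qB Aq q20; clear; rewrite !mulrDl; lra.
Qed.

End Arithmetic.

Section Approximation.
Context {R : realType} {dX : measure_display} {X : measurableType dX}.
Variables (d : X -> X -> R) (rho : probability (X * R)%type R) (K : X -> X -> R).
Variables (eta Ceta alpha Calpha kappa : R).
Hypotheses (md : is_metric d) (bX : borel_for d) (cov : covering_cond d eta Ceta).
Hypotheses (alpha0 : 0 < alpha) (Calpha0 : 0 < Calpha).
Hypotheses (pdK : pd_kernel K) (l1K : l1_cond K) (holK : holder_cond d K alpha Calpha).
Hypothesis (Kk : forall x t, `|K x t| <= kappa).

Let bh f : hol d alpha f -> bmeas f. Proof. exact: (hol_bmeas md bX cov alpha0). Qed.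
Let L_K := LK rho K.
Let hLK f : bmeas f -> hol d alpha (L_K f).
Proof. exact: (hol_LK rho md bX cov alpha0 Calpha0 pdK holK). Qed.
Let hkf N (t : 'I_N -> X) c : hol d alpha (kernel_fun K t c).
Proof. exact: (hol_kernel_fun Calpha0 holK). Qed.

Lemma Ex_sqr_split (f g h : X -> R) : bmeas f -> bmeas g -> bmeas h ->
  \int[rho]_z ((f z.1 - h z.1) ^+ 2) <=
    2 * \int[rho]_z ((f z.1 - g z.1) ^+ 2) + 2 * \int[rho]_z ((g z.1 - h z.1) ^+ 2).
Proof.
move=> /(bmeas_fst (R:=R)) bf /(bmeas_fst (R:=R)) bg /(bmeas_fst (R:=R)) bbh.
rewrite -!ExZ -?ExD; solve_bmeas; apply: Ex_le; solve_bmeas.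
move=> z; have := sqr_ge0 (f z.1 - 2 * g z.1 + h z.1); nra.
Qed.

(** Transfers [coefficient_norm_gap] from finite sums to the integral operator. The nodes must be
    fine enough for all expansions of coefficient norm at most [Rz] simultaneously, so [Rz] is fixed
    before them. *)
Lemma discretized_comparison (b f0 : X -> R) (Rz eps : R) : hol d alpha b -> bmeas f0 ->
  0 <= Rz -> 0 < eps -> exists N (t : 'I_N -> X) (cg : 'I_N -> R),
  [/\ \int[rho]_z ((kernel_fun K t cg z.1 - f0 z.1) ^+ 2) <=
        2 * \int[rho]_z ((L_K (L_K b) z.1 - f0 z.1) ^+ 2) + eps,
      \sum_i `|cg i| <= \int[rho]_z `|L_K b z.1| + eps &
      forall (B tau mu th : R) N' (x : 'I_N' -> X) (c : 'I_N' -> R),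
        \int[rho]_z `|b z.1| <= B -> 0 < tau -> 0 < mu -> 0 < th ->
        \sum_i `|c i| <= Rz ->
        \sum_i `|cg i| - \sum_i `|c i| <= tau + mu * (B + eps)
          + th * ((B + eps) / (2 * tau * mu)) + (4 * th)^-1 *
            (\int[rho]_z ((kernel_fun K x c z.1 - kernel_fun K t cg z.1) ^+ 2) + eps)].
Proof.
move=> hb bf0 Rz0 eps0.
have k0 : 0 <= kappa by exact: le_trans (Kk point point).
have [B bB] := (bh hb).2.
have B0 : 0 <= B by exact: le_trans (bB point).
have hu := hLK (bh hb).
have [Lb Lb0 bL] := hb; have [Lu Lu0 uL] := hu.
pose u := L_K b; pose g := L_K u.
have uB x : `|u x| <= kappa * B.
  apply: Ex_norm_le; first exact: (bmeas_LK_integrand md bX cov alpha0 Calpha0 holK x (bh hb)).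
  by move=> z; rewrite normrM ler_pM.
(* Times [e], [H1] bounds the error of [ud] against [u], and [H3] that of the expansion with
   coefficients [cg] against [g]. [G] bounds two coefficient norms together, and [H4] is the Hoelder
   constant of the squared difference of two expansions. All errors must fall below [eps], which
   fixes [e]. *)
pose H1 := kappa * Lb + B * Calpha.
pose H3 := kappa * Lu + kappa * B * Calpha + kappa * H1.
pose G := Rz + kappa * B; pose H4 := 2 * kappa * Calpha * G ^+ 2.
have G0 : 0 <= G by rewrite addr_ge0// mulr_ge0.
have H10 : 0 <= H1 by rewrite addr_ge0// mulr_ge0// ltW.
have H30 : 0 <= H3.
  by rewrite addr_ge0 ?(mulr_ge0 k0)// addr_ge0 ?(mulr_ge0 k0)// mulr_ge0 ?(ltW Calpha0)// mulr_ge0.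
have H40 : 0 <= H4 by rewrite mulr_ge0 ?sqr_ge0// mulr_ge0 ?(ltW Calpha0)// mulr_ge0.
have H320 : 0 <= 2 * H3 ^+ 2 by rewrite mulr_ge0 ?sqr_ge0.
pose H := 2 * H3 ^+ 2 + Lu + H1 + Lb + H4.
have H0 : 0 <= H := addr_ge0 (addr_ge0 (addr_ge0 (addr_ge0 H320 Lu0) H10) Lb0) H40.
pose e := Num.min 1 (eps / (H + 1)).
have e0 : 0 < e by rewrite lt_min ltr01 divr_gt0// ltr_wpDl.
have e1 : e <= 1 by rewrite ge_min lexx.
have He : H * e <= eps.
  have : e * (H + 1) <= eps by rewrite -ler_pdivlMr ?ltr_wpDl// ge_min lexx orbT.
  by apply: le_trans; rewrite mulrC ler_wpM2l ?(ltW e0)// lerDl.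
have [H3e LuHe Lbe H4e] := parts_le H320 Lu0 H10 Lb0 H40 e0 He.
have [N [t [w [it w0 w1 disc]]]] := discretization rho md bX cov alpha0 e0 e1.
(* Not the values of [L_K b] themselves: [coefficient_norm_gap] needs an exact kernel expansion at
   the nodes. *)
pose ud i := kernel_fun K t (fun j => w j * b (t j)) (t i).
pose cg i := w i * ud i.
have normw (v : 'I_N -> R) : \sum_i `|w i * v i| = \sum_i w i * `|v i|.
  by apply: eq_bigr => i _; rewrite normrM ger0_norm.
have avg (v : 'I_N -> R) V : (forall i, `|v i| <= V) -> \sum_i w i * `|v i| <= V.
  move=> vV; rewrite -[leRHS]mul1r -w1 mulr_suml; apply: ler_sum => i _.
  by rewrite ler_wpM2l.
have uud i : `|u (t i) - ud i| <= H1 * e.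
  exact: (LK_discretized Calpha0 pdK holK (t i) Kk bB Lb0 bL disc).
have gcg x : `|g x - kernel_fun K t cg x| <= H3 * e.
  have h1 := LK_discretized Calpha0 pdK holK x Kk uB Lu0 uL disc.
  have h2 : `|kernel_fun K t (fun i => w i * u (t i)) x - kernel_fun K t cg x| <= kappa * H1 * e.
    have -> : kernel_fun K t (fun i => w i * u (t i)) x - kernel_fun K t cg x =
      kernel_fun K t (fun i => w i * (u (t i) - ud i)) x.
      by rewrite /kernel_fun -sumrB; apply: eq_bigr => i _; rewrite /cg; ring.
    apply: le_trans (kernel_fun_bound _ _ _ Kk) _; rewrite -mulrA ler_wpM2l// normw.
    exact: avg.
  apply: le_trans (ler_distD (kernel_fun K t (fun i => w i * u (t i)) x) _ _) _.
  by rewrite /H3 mulrDl lerD.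
have udB i : `|ud i| <= kappa * B.
  apply: le_trans (kernel_fun_bound _ _ _ Kk) _; rewrite ler_wpM2l// normw.
  exact: avg.
have cgB : \sum_i `|cg i| <= kappa * B by rewrite normw; exact: avg.
have bg : bmeas g by apply: bh; apply: hLK; exact: bh.
have absL (f : X -> R) L : 0 <= L -> (forall x y, `|f x - f y| <= L * d x y `^ alpha) ->
    \sum_i w i * `|f (t i)| <= \int[rho]_z `|f z.1| + L * e.
  move=> L0 fL; have := disc (fun x => `|f x|) L L0.
  have nL x y : `| `|f x| - `|f y| | <= L * d x y `^ alpha.
    by apply: le_trans (fL x y); exact: ler_dist_dist.
  by move=> /(_ nL); rewrite ler_norml => /andP[]; lra.
exists N, t, cg; split.
- apply: le_trans (Ex_sqr_split (g := g) (bh (hkf _ _)) bg bf0) _.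
  rewrite addrC lerD2l.
  have : \int[rho]_z ((kernel_fun K t cg z.1 - g z.1) ^+ 2) <= H3 ^+ 2 * e.
    rewrite -[leRHS](Ex_cst rho); apply: Ex_le.
    + by apply: bmeasX; apply: bmeasB; apply: bmeas_fst => //; exact: bh.
    + exact: bmeas_cst.
    + move=> z; rewrite -real_normK ?num_real// distrC.
      apply: (@le_trans _ _ ((H3 * e) ^+ 2)).
        by rewrite lerXn2r ?nnegrE// mulr_ge0// ltW.
      by rewrite exprMn ler_wpM2l ?sqr_ge0// expr2 ler_piMl// ltW.
  by move: H3e; clear; rewrite -mulrA; lra.
- rewrite normw.
  have h1 := absL _ _ Lu0 uL.
  have h2 : \sum_i w i * `|ud i| <= \sum_i w i * `|u (t i)| + H1 * e.
    rewrite -[X in _ <= _ + X]mul1r -w1 mulr_suml -big_split/=; apply: ler_sum => i _.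
    rewrite -mulrDr ler_wpM2l//; have h2 := uud i; rewrite distrC in h2.
    have h3 := ler_dist_dist (ud i) (u (t i)).
    by rewrite -lerBlDl; exact: le_trans (le_trans (ler_norm _) h3) h2.
  apply: le_trans h2 _; apply: le_trans (lerD h1 (lexx _)) _.
  by rewrite -addrA lerD2l.
- move=> B' tau mu th N' x c bB' tau0 mu0 th0 cR.
  have wb : \sum_i w i * `|b (t i)| <= B' + eps.
    exact: le_trans (absL _ _ Lb0 bL) (lerD bB' Lbe).
  have := coefficient_norm_gap (u := ud) pdK l1K x c it w0 w1 wb tau0 mu0 th0 (fun=> erefl).
  rewrite -(normw ud) => h; apply: le_trans h _; rewrite lerD2l ler_wpM2l ?invr_ge0 ?mulr_ge0 ?(ltW th0)//.
  pose h y := kernel_fun K x c y - kernel_fun K t cg y.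
  have sG : (\sum_i `|c i| + \sum_i `|cg i|) <= G by exact: lerD.
  have hB y : `|h y| <= kappa * G.
    apply: le_trans (ler_normB _ _) _.
    apply: (@le_trans _ _ (kappa * \sum_i `|c i| + kappa * \sum_i `|cg i|)).
      by apply: lerD; exact: kernel_fun_bound.
    by rewrite -mulrDr ler_wpM2l.
  have hL y y' : `|h y - h y'| <= G * Calpha * d y y' `^ alpha.
    have -> : h y - h y' = (kernel_fun K x c y - kernel_fun K x c y')
      - (kernel_fun K t cg y - kernel_fun K t cg y') by rewrite /h; ring.
    apply: le_trans (ler_normB _ _) _.
    apply: le_trans (lerD (kernel_fun_holder holK _ _ _ _) (kernel_fun_holder holK _ _ _ _)) _.
    by rewrite -!mulrDl !ler_wpM2r ?powR_ge0 ?(ltW Calpha0).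
  have h2L y y' : `|h y ^+ 2 - h y' ^+ 2| <= H4 * d y y' `^ alpha.
    rewrite subr_sqr normrM.
    have -> : H4 * d y y' `^ alpha = (G * Calpha * d y y' `^ alpha) * (kappa * G + kappa * G).
      by rewrite /H4; ring.
    by apply: ler_pM => //; apply: le_trans (ler_normD _ _) _; exact: lerD.
  have h3 := disc (fun y => h y ^+ 2) H4 H40 h2L; rewrite distrC in h3.
  by rewrite -lerBlDl; exact: le_trans (le_trans (ler_norm _) h3) H4e.
Qed.

Lemma Ex_sqr_orthonormal n (psi : 'I_n -> X -> R) (c : 'I_n -> R) :
  (forall i, bmeas (psi i)) ->
  (forall i j, \int[rho]_z (psi i z.1 * psi j z.1) = (i == j)%:R) ->
  \int[rho]_z ((\sum_i c i * psi i z.1) ^+ 2) = \sum_i c i ^+ 2.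
Proof.
move=> bpsi orth; have bp i := bmeas_fst (bpsi i).
transitivity (\int[rho]_z (\sum_i \sum_j c i * c j * (psi i z.1 * psi j z.1))).
  apply: eq_Rintegral => z _; rewrite expr2 mulr_suml; apply: eq_bigr => i _.
  by rewrite mulr_sumr; apply: eq_bigr => j _; ring.
have bij i j : bmeas (fun z : X * R => c i * c j * (psi i z.1 * psi j z.1)).
  by apply: bmeasZ; exact: bmeasM.
rewrite Ex_sum; last by move=> i _; apply: bmeas_sum => j _.
apply: eq_bigr => i _; rewrite Ex_sum// (bigD1 i)//= big1 ?addr0.
  by rewrite ExZ ?orth ?eqxx ?mulr1//; exact: bmeasM.
move=> j ji; rewrite ExZ ?orth; last exact: bmeasM.
by rewrite eq_sym (negbTE ji) mulr0.
Qed.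

Lemma Ex_norm_sqrt (f : X -> R) S : bmeas f -> 0 <= S ->
  \int[rho]_z (f z.1 ^+ 2) <= S ^+ 2 -> \int[rho]_z `|f z.1| <= S.
Proof.
move=> /(bmeas_fst (R:=R)) bf S0 fS.
rewrite -(@ler_pXn2r _ 2)// ?nnegrE//; last exact: Ex_ge0.
apply: le_trans fS; have h := Ex_CS rho (bmeas_norm bf) (bmeas_cst 1).
have e1 : \int[rho]_z (`|f z.1| * 1) = \int[rho]_z `|f z.1|.
  by apply: eq_Rintegral => z _; rewrite mulr1.
have e2 : \int[rho]_z (`|f z.1| ^+ 2) = \int[rho]_z (f z.1 ^+ 2).
  by apply: eq_Rintegral => z _; rewrite real_normK ?num_real.
by rewrite e1 e2 Ex_cst expr1n mulr1 in h.
Qed.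

(* Replacing l^s by l^s (1 - (k/(l+k))^2), which is divisible by l^2, turns
   f0 = L_K^s h into L_K (L_K b). *)
Lemma continuous_comparison s (f0 : X -> R) A k : 0 < s <= 2 -> 1 <= A -> bmeas f0 ->
  (forall e, 0 < e ->
  exists n (psi : 'I_n -> X -> R) (l a : 'I_n -> R),
  [/\ forall i, hol d alpha (psi i), forall i, 0 < l i <= kappa,
      forall i x, L_K (psi i) x = l i * psi i x,
      forall i j, \int[rho]_z (psi i z.1 * psi j z.1) = (i == j)%:R &
      \sum_i a i ^+ 2 <= A /\
      \int[rho]_z ((f0 z.1 - \sum_i l i `^ s * a i * psi i z.1) ^+ 2) <= e]) ->
  0 < k -> exists2 b, hol d alpha b &
  [/\ \int[rho]_z ((L_K (L_K b) z.1 - f0 z.1) ^+ 2) <= 2 * (A + 1) * (k `^ s) ^+ 2,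
      s <= 1 -> \int[rho]_z `|L_K b z.1| <= 2 * A * (k `^ s / k) &
      1 <= s -> \int[rho]_z `|b z.1| <= 2 * A * (k `^ s / k ^+ 2)].
Proof.
move=> s02 A1 bf0 spec k0; set q := k `^ s.
have q0 : 0 < q by exact: powR_gt0.
have [n [psi [l [a [hpsi l0k eig orth [aA fe]]]]]] := spec (q ^+ 2) (exprn_gt0 _ q0).
have l0 i : 0 < l i by case/andP: (l0k i).
have lk0 i : 0 < l i + k by exact: addr_gt0.
have ll i : l i != 0 by rewrite gt_eqF.
have lk i : l i + k != 0 by rewrite gt_eqF.
(* The filter divided by [l i ^ 2], that is [(1 - (k / (l i + k))^2) / l i ^ 2], times the
   coefficient [l i ^ s * a i]. The division is harmless because only finitely many, positive
   eigenvalues occur. *)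
pose be i := (l i + 2 * k) / ((l i + k) ^+ 2 * l i) * l i `^ s * a i.
pose S (c : 'I_n -> R) (x : X) := \sum_i c i * psi i x.
have bpsi i := bh (hpsi i).
have hS c : hol d alpha (S c) by apply: hol_sum => i _; exact: holZ.
have LS c : L_K (S c) = S (fun i => c i * l i).
  apply/funext => x; rewrite /L_K /S (LK_sum rho md bX cov alpha0 Calpha0 holK)//; apply: eq_bigr => i _.
  by rewrite -/(L_K (psi i)) eig mulrA.
have bnd (c m : 'I_n -> R) T : 0 <= T -> (forall i, c i = m i * a i) ->
    (forall i, 0 <= m i <= T) -> \int[rho]_z (S c z.1 ^+ 2) <= (T ^+ 2) * A.
  move=> T0 cE mT; rewrite /S Ex_sqr_orthonormal//.
  apply: (@le_trans _ _ (T ^+ 2 * \sum_i a i ^+ 2)); last by rewrite ler_wpM2l ?sqr_ge0.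
  rewrite mulr_sumr; apply: ler_sum => i _; rewrite cE exprMn ler_wpM2r ?sqr_ge0//.
  by have /andP[m0 mle] := mT i; rewrite lerXn2r ?nnegrE.
have bnd1 (c m : 'I_n -> R) T : 0 <= T -> (forall i, c i = m i * a i) ->
    (forall i, 0 <= m i <= 2 * T) -> \int[rho]_z `|S c z.1| <= 2 * A * T.
  move=> T0 cE mT; apply: Ex_norm_sqrt; first exact: bh.
    by rewrite mulr_ge0// mulr_ge0//; lra.
  apply: le_trans (bnd c m (2 * T) _ cE mT) _; first by rewrite mulr_ge0.
  have -> : (2 * A * T) ^+ 2 = (2 * T) ^+ 2 * A ^+ 2 by ring.
  by rewrite ler_wpM2l ?sqr_ge0// expr2 ler_peMl//; lra.
exists (S be) => //; split.
- rewrite !LS.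
  pose fn := S (fun i => l i `^ s * a i).
  apply: le_trans (Ex_sqr_split (g := fn) (bh (hS _)) (bh (hS _)) bf0) _.
  have e1 : \int[rho]_z ((fn z.1 - f0 z.1) ^+ 2) <= q ^+ 2.
    by apply: le_trans fe; under eq_Rintegral do rewrite -sqrrN opprB.
  have e2 : \int[rho]_z ((S (fun i => be i * l i * l i) z.1 - fn z.1) ^+ 2) <= q ^+ 2 * A.
    apply: (@le_trans _ _ (\int[rho]_z (S (fun i => (k / (l i + k)) ^+ 2 * l i `^ s * a i) z.1 ^+ 2))).
      apply: Ex_le.
      + by apply: bmeasX; apply: bmeasB; apply: bmeas_fst; exact: (bh (hS _)).
      + by apply: bmeasX; apply: bmeas_fst; exact: (bh (hS _)).
      + move=> z; rewrite -sqrrN opprB /fn /S -sumrB le_eqVlt; apply/orP; left; apply/eqP.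
        congr (_ ^+ 2); apply: eq_bigr => i _; rewrite /be; field.
        by rewrite ll lk.
    apply: (bnd _ (fun i => (k / (l i + k)) ^+ 2 * l i `^ s)); rewrite ?(ltW q0)// => i.
    by rewrite mulr_ge0 ?sqr_ge0 ?powR_ge0//= filter_residual.
  lra.
- move=> s1; rewrite LS.
  apply: (bnd1 _ (fun i => (l i + 2 * k) / (l i + k) ^+ 2 * l i `^ s)).
  + by rewrite divr_ge0// ltW.
  + by move=> i; rewrite /be; field; rewrite ll lk.
  + move=> i; rewrite filter_size ?andbT//; last by case/andP: s02 => s0 _; rewrite s1 ltW.
    by rewrite mulr_ge0 ?powR_ge0// divr_ge0 ?sqr_ge0// addr_ge0 ?mulr_ge0// ltW.
- move=> s1.
  (* One factor [l] of [l^s] pays for the second division, so [filter_size] applies with the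
     exponent [s - 1]. *)
  have lE x : 0 < x -> x `^ s = x * x `^ (s - 1).
    by move=> x0; rewrite mulr_powRB1 ?(ltW x0)//; case/andP: s02.
  apply: (bnd1 _ (fun i => (l i + 2 * k) / (l i + k) ^+ 2 * l i `^ (s - 1))).
  + by rewrite divr_ge0// ?sqr_ge0// ltW.
  + by move=> i; rewrite /be lE//; field; rewrite ll lk.
  + move=> i; have -> : q / k ^+ 2 = k `^ (s - 1) / k.
      by rewrite /q lE//; field; rewrite gt_eqF.
    rewrite filter_size ?andbT//; last by case/andP: s02 => _ s2; apply/andP; split; lra.
    by rewrite mulr_ge0 ?powR_ge0// divr_ge0 ?sqr_ge0// addr_ge0 ?mulr_ge0// ltW.
Qed.

(** Discretization is allowed an error [q^2], with [q = k^s]: this is the order of the squared bias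
    itself, so it disappears in a constant that depends neither on [k] nor on [Rz]. *)
Lemma span_approximation s (f0 : X -> R) A : 0 < s <= 2 -> 1 <= A -> bmeas f0 ->
  (forall e, 0 < e ->
  exists n (psi : 'I_n -> X -> R) (l a : 'I_n -> R),
  [/\ forall i, hol d alpha (psi i), forall i, 0 < l i <= kappa,
      forall i x, L_K (psi i) x = l i * psi i x,
      forall i j, \int[rho]_z (psi i z.1 * psi j z.1) = (i == j)%:R &
      \sum_i a i ^+ 2 <= A /\
      \int[rho]_z ((f0 z.1 - \sum_i l i `^ s * a i * psi i z.1) ^+ 2) <= e]) ->
  exists2 C, 0 < C & forall k Rz, 0 < k <= 1 -> 0 <= Rz ->
  exists N (t : 'I_N -> X) (cg : 'I_N -> R),
    \int[rho]_z ((kernel_fun K t cg z.1 - f0 z.1) ^+ 2) <= C * (k `^ s) ^+ 2 /\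
    forall N' (x : 'I_N' -> X) (c : 'I_N' -> R), \sum_i `|c i| <= Rz ->
      k * k `^ s * (\sum_i `|cg i| - \sum_i `|c i|) <=
        C * (k `^ s) ^+ 2 + 4^-1 * \int[rho]_z ((kernel_fun K x c z.1 - f0 z.1) ^+ 2).
Proof.
move=> s02 A1 bf0 spec; have A45 : 4 * A + 5 <= 10 * A + 10 by lra.
exists (10 * A + 10); first by lra.
move=> k Rz /andP[k0 k1] Rz0.
have [b hb] := continuous_comparison s02 A1 bf0 spec k0.
set q := k `^ s => -[e1 e2 e3].
have q0 : 0 < q by exact: powR_gt0.
have q1 : q <= 1 by have := @ler_powRl _ s k 1 ltac:(lra) (ltW k0) k1; rewrite powR1.
have qq0 : 0 < q ^+ 2 by exact: exprn_gt0.
have [N [t [cg [E1 E2 E3]]]] := discretized_comparison hb bf0 Rz0 qq0.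
have E1' : \int[rho]_z ((kernel_fun K t cg z.1 - f0 z.1) ^+ 2) <= (4 * A + 5) * q ^+ 2.
  have -> : (4 * A + 5) * q ^+ 2 = 2 * (2 * (A + 1) * q ^+ 2) + q ^+ 2 by ring.
  by apply: le_trans E1 _; rewrite lerD2r ler_wpM2l.
exists N, t, cg; split.
  by apply: le_trans E1' _; rewrite ler_wpM2r ?(ltW qq0).
move=> N' x c cR; set Ef := \int[rho]_z _.
have Ef0 : 0 <= Ef by apply: Ex_ge0 => z; exact: sqr_ge0.
have c0 : 0 <= \sum_i `|c i| by apply: sumr_ge0.
have [s1|s1] := leP s 1.
  rewrite -[leLHS]addr0; apply: lerD; last by rewrite mulr_ge0.
  by apply: small_gap => //; apply: le_trans E2 _; rewrite lerD2r e2.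
have kq0 : 0 < 2 * (k * q) by rewrite !mulr_gt0.
have := E3 _ (q / k) k (2 * (k * q)) _ x c (e3 (ltW s1)) (divr_gt0 q0 k0) k0 kq0 cR.
apply: large_gap => //.
apply: le_trans (Ex_sqr_split (bh (hkf x c)) bf0 (bh (hkf t cg))) _.
have -> : \int[rho]_z ((f0 z.1 - kernel_fun K t cg z.1) ^+ 2) =
    \int[rho]_z ((kernel_fun K t cg z.1 - f0 z.1) ^+ 2).
  by apply: eq_Rintegral => z _; rewrite -sqrrN opprB.
by rewrite lerD2l ler_wpM2l.
Qed.

End Approximation.

(** * Excess risk *)

Section Regression.
Context {R : realType} {dX : measure_display} {X : measurableType dX}.
Variables (rho : probability (X * R)%type R) (M : R).
Hypotheses (M0 : 0 < M) (yM : {ae rho, forall z : X * R, `|z.2| <= M}).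

(** Labels are bounded only almost surely; clamping makes the losses of bounded functions bounded
    everywhere, at the price of a null set. *)
Definition trunc_label (z : X * R) : R := clamp M z.2.

Lemma bmeas_trunc_label : bmeas trunc_label.
Proof. by apply: bmeas_clamp; [exact: ltW|exact: measurable_snd]. Qed.

Lemma trunc_label_bound z : `|trunc_label z| <= M.
Proof. by apply: clamp_norm; exact: ltW. Qed.

Lemma clamp_id (a x : R) : `|x| <= a -> clamp a x = x.
Proof.
move=> xa; have a0 : 0 <= a by exact: le_trans xa.
by case: (clampP x a0) => [[h]|[h]|[]//]; move: xa; rewrite ler_norml => /andP[]; lra.
Qed.

Lemma trunc_labelE : {ae rho, forall z : X * R, z.2 = trunc_label z}.
Proof. by apply: filterS yM => z h; rewrite /trunc_label clamp_id. Qed.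

Let mcyl A : measurable A -> measurable (A `*` [set: R] : set (X * R)).
Proof. by move=> mA; exact: measurableX. Qed.

Lemma integral_label A (y : X * R -> R) : measurable A -> measurable_fun setT y ->
  {ae rho, forall z, y z = trunc_label z} ->
  (\int[rho]_(z in A `*` setT) (y z)%:E = \int[rho]_(z in A `*` setT) (trunc_label z)%:E)%E.
Proof.
move=> mA my yt; apply: ae_eq_integral; first exact: mcyl.
- by apply/measurable_EFinP; exact: measurable_funTS.
- by apply/measurable_EFinP; apply: measurable_funTS; exact: bmeas_trunc_label.1.
- by apply: filterS yt => z /= ->.
Qed.

(** The common integral is squeezed between [M + e] and [M] times the mass of the cell.
    Integrability of [g] is not known, but [g] is positive on the cell, so its extended integral can
    be bounded below. *)
Lemma large_cell_null (g : X -> R) (y : X * R -> R) A e : measurable_fun setT g ->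
  measurable A -> 0 < e -> bmeas y -> (forall z, `|y z| <= M) ->
  (forall x, A x -> M + e <= g x) ->
  (\int[rho]_(z in A `*` setT) (g z.1)%:E = \int[rho]_(z in A `*` setT) (y z)%:E)%E ->
  rho (A `*` setT) = 0.
Proof.
move=> mg mA e0 by_ yB gA E; set B := A `*` setT.
have mB : measurable B by exact: mcyl.
have rB : rho B \is a fin_num by exact: fin_num_measure.
have up : (\int[rho]_(z in B) (y z)%:E <= M%:E * rho B)%E.
  rewrite -integral_cst//; apply: le_integral => //.
  - by apply: integrableS (bmeas_integrable rho by_).
  - by apply: integrableS (bmeas_integrable rho (bmeas_cst M)).
  - by move=> z _; rewrite lee_fin; exact: le_trans (ler_norm _) (yB z).
have lo : ((M + e)%:E * rho B <= \int[rho]_(z in B) (g z.1)%:E)%E.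
  rewrite -integral_cst//; apply: ge0_le_integral => //.
  - by move=> z _; rewrite lee_fin addr_ge0// ltW.
  - apply/measurable_EFinP; apply: measurable_funTS.
    by apply: measurableT_comp => //; exact: measurable_fst.
  - by move=> z [Az _]; rewrite lee_fin gA.
rewrite -E in up; have := le_trans lo up.
have [b bE] : exists b, rho B = b%:E by exists (fine (rho B)); rewrite fineK.
have b0 : 0 <= b by rewrite -lee_fin -bE; exact: measure_ge0.
rewrite bE -!EFinM lee_fin => le; congr EFin; apply/eqP; rewrite eq_le b0 andbT.
by rewrite -(pmulr_lle0 _ e0); move: le; rewrite mulrDl; lra.
Qed.

Variable frho : X -> R.
Hypothesis reg : is_regression rho frho.

Definition trunc_reg (x : X) : R := clamp M (frho x).

Let mf : measurable_fun setT frho. Proof. exact: reg.1. Qed.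

Lemma bmeas_trunc_reg : bmeas trunc_reg.
Proof. by apply: bmeas_clamp => //; exact: ltW. Qed.

Lemma trunc_reg_bound x : `|trunc_reg x| <= M.
Proof. by apply: clamp_norm; exact: ltW. Qed.

(** Boundedness has to be extracted from integrals over cylinders: the sets where [frho] or [- frho]
    reaches [M + 1/(n+1)] are null by [large_cell_null], the two signs being treated together
    through [sg]. *)
Lemma regression_bounded : {ae rho, forall z : X * R, frho z.1 = trunc_reg z.1}.
Proof.
have msf (sg : R) : measurable_fun setT (fun x => sg * frho x).
  by apply: measurable_funM mf; exact: measurable_cst.
have msup (sg a : R) : measurable [set x | a <= sg * frho x].
  rewrite -[X in measurable X]setTI.
  have -> : [set x | a <= sg * frho x] = (fun x => sg * frho x) @^-1` `[a, +oo[.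
    by apply/seteqP; split => x; rewrite /= in_itv/= andbT.
  by apply: msf => //; exact: measurable_itv.
have null (sg : R) (n : nat) : sg = 1 \/ sg = -1 ->
  rho ([set x | M + n.+1%:R^-1 <= sg * frho x] `*` setT) = 0.
  move=> sgE; have mA := msup sg (M + n.+1%:R^-1).
  apply: (@large_cell_null (fun x => sg * frho x) (fun z => sg * trunc_label z) _ n.+1%:R^-1).
  - exact: msf.
  - exact: mA.
  - by rewrite invr_gt0.
  - by apply: bmeasZ; exact: bmeas_trunc_label.
  - by move=> z; case: sgE => ->; rewrite ?mul1r ?mulN1r ?normrN; exact: trunc_label_bound.
  - by [].
  set A := [set x | _] in mA *; have E := reg.2 A mA.
  rewrite (integral_label mA measurable_snd trunc_labelE) in E.
  have mB := mcyl mA.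
  have B1 : (\int[rho]_(z in A `*` setT) (trunc_label z)%:E =
    \int[rho]_(z in A `*` setT) (frho z.1)%:E)%E by exact: E.
  case: sgE => sgE.
    transitivity (\int[rho]_(z in A `*` setT) (frho z.1)%:E)%E.
      by apply: eq_integral => z _; rewrite sgE mul1r.
    by rewrite -B1; apply: eq_integral => z _; rewrite sgE mul1r.
  (* An extended integral can be negated here because [sg * frho] is nonnegative on [A]. *)
  have i1 : (\int[rho]_(z in A `*` setT) (frho z.1)%:E =
      - \int[rho]_(z in A `*` setT) (sg * frho z.1)%:E)%E.
    rewrite -integral_ge0N; first by apply: eq_integral => z _; rewrite sgE mulN1r EFinN oppeK.
    move=> z [Az _]; rewrite lee_fin; apply: le_trans Az.
    by rewrite addr_ge0 ?invr_ge0// ltW.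
  have i2 : (\int[rho]_(z in A `*` setT) (sg * trunc_label z)%:E =
      - \int[rho]_(z in A `*` setT) (trunc_label z)%:E)%E.
    rewrite -[RHS]mulN1e -integralZl//; first by apply: eq_integral => z _; rewrite sgE EFinM.
    apply: integrableS (bmeas_integrable rho bmeas_trunc_label) => //.
  by rewrite i2 B1 i1 oppeK.
have aebound (sg : R) : sg = 1 \/ sg = -1 -> {ae rho, forall z : X * R, sg * frho z.1 <= M}.
  move=> sgE; have : {ae rho, forall z : X * R, forall n : nat,
      ~ (M + n.+1%:R^-1 <= sg * frho z.1)}.
    apply: ae_foralln => n.
    exists ([set x | M + n.+1%:R^-1 <= sg * frho x] `*` setT); split.
    - by apply: mcyl; exact: msup.
    - exact: null.
    - by move=> z /= /contrapT.
  apply: filterS => z h; rewrite leNgt; apply/negP => lt.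
  have e0 : 0 < sg * frho z.1 - M by rewrite subr_gt0.
  have [n _ /(_ n (leqnn n))] := near_infty_natSinv_lt (PosNum e0).
  rewrite /= => /ltW nM; apply: (h n).
  by rewrite -lerBrDl.
have p1 := aebound 1 (or_introl erefl).
have p2 := aebound (-1) (or_intror erefl).
apply: filterS2 p1 p2 => z; rewrite mul1r mulN1r /trunc_reg => h1 h2.
by rewrite clamp_id// ler_norml h1 andbT lerNl.
Qed.

(** The defining property of the regression function gives indicators, linearity gives step
    functions, and uniform approximation gives [psi], since the residual is bounded by [2 * M]. *)
Lemma label_residual_orthogonal (psi : X -> R) : bmeas psi ->
  \int[rho]_z (psi z.1 * (trunc_reg z.1 - trunc_label z)) = 0.
Proof.
move=> bpsi.
have br : bmeas (fun z : X * R => trunc_reg z.1) by apply: bmeas_fst; exact: bmeas_trunc_reg.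
have bl := bmeas_trunc_label.
have bd : bmeas (fun z => trunc_reg z.1 - trunc_label z) by exact: bmeasB.
have bi A : measurable A -> bmeas (fun z : X * R => (\1_A z.1 : R)).
  by move=> mA; apply: bmeas_fst; exact: bmeas_indic.
have ind A : measurable A -> \int[rho]_z (\1_A z.1 * (trunc_reg z.1 - trunc_label z)) = 0.
  move=> mA.
  have restr (y : X * R -> R) : (\int[rho]_(z in A `*` setT) (y z)%:E =
      \int[rho]_z (\1_A z.1 * y z)%:E)%E.
    rewrite integral_mkcond; apply: eq_integral => z _; rewrite patchE indicE.
    have -> : (z \in A `*` setT) = (z.1 \in A).
      by apply/idP/idP; rewrite !inE => //= -[].
    by case: (z.1 \in A); rewrite ?mul1r ?mul0r.
  under eq_Rintegral do rewrite mulrBr.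
  rewrite ExB; [|by apply: bmeasM => //; exact: bi..].
  apply/eqP; rewrite subr_eq0; apply/eqP; apply: EFin_inj.
  rewrite !ExE; [|by apply: bmeasM => //; exact: bi..].
  rewrite -(restr trunc_label) -(integral_label mA measurable_snd trunc_labelE) (reg.2 A mA).
  rewrite restr; apply: ae_eq_integral => //.
  - by apply/measurable_EFinP; exact: (bmeasM (bi _ mA) br).1.
  - apply/measurable_EFinP; apply: measurable_funM; first exact: (bi _ mA).1.
    by apply: measurableT_comp => //; exact: measurable_fst.
  - by apply: filterS regression_bounded => z -> .
apply/eqP; rewrite -normr_le0; apply/ler_addgt0Pr => e e0; rewrite add0r.
pose e' := e / (2 * M); have e'0 : 0 < e' by rewrite divr_gt0 ?mulr_gt0.
have [N [a [A [mA sA]]]] := step_approx e'0 bpsi.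
pose S x := \sum_k a k * \1_(A k) x.
have bS : bmeas (fun z : X * R => S z.1).
  by apply: bmeas_sum => k _; apply: bmeasZ; exact: bi.
have bp := bmeas_fst bpsi.
have S0 : \int[rho]_z (S z.1 * (trunc_reg z.1 - trunc_label z)) = 0.
  under eq_Rintegral do rewrite mulr_suml.
  rewrite Ex_sum; last first.
    by move=> k _; apply: bmeasM => //; apply: bmeasZ; exact: bi.
  rewrite big1// => k _; under eq_Rintegral do rewrite -mulrA.
  by rewrite ExZ ?ind ?mulr0//; apply: bmeasM => //; exact: bi.
rewrite -[X in `|X|]subr0 -S0 -ExB; [|exact: bmeasM..].
apply: Ex_norm_le; first by apply: bmeasB; exact: bmeasM.
move=> z; rewrite -mulrBl normrM.
have -> : e = e' * (2 * M) by rewrite /e' divfK// gt_eqF ?mulr_gt0.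
apply: ler_pM => //.
  by have /andP[h1 h2] := sA z.1; rewrite distrC ger0_norm ?subr_ge0// lerBlDl.
apply: le_trans (ler_normB _ _) _; rewrite mulr2n mulrDl mul1r.
by rewrite lerD// ?trunc_reg_bound ?trunc_label_bound.
Qed.

Definition excess_loss (f : X -> R) (z : X * R) : R :=
  (f z.1 - trunc_label z) ^+ 2 - (trunc_reg z.1 - trunc_label z) ^+ 2.

Definition excess_risk (f : X -> R) : R := \int[rho]_z ((f z.1 - trunc_reg z.1) ^+ 2).

Lemma excess_risk_ge0 f : 0 <= excess_risk f.
Proof. by apply: Ex_ge0 => z; exact: sqr_ge0. Qed.

Lemma bmeas_excess_loss f : bmeas f -> bmeas (excess_loss f).
Proof.
move=> /bmeas_fst bf; have /bmeas_fst br := bmeas_trunc_reg; have bl := bmeas_trunc_label.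
by apply: bmeasB; apply: bmeasX; exact: bmeasB.
Qed.

(** Expanding around [trunc_reg] leaves a cross term with the label residual, which is orthogonal to
    bounded functions of the input. *)
Lemma Ex_excess_loss f : bmeas f -> \int[rho]_z excess_loss f z = excess_risk f.
Proof.
move=> bf; have b1 := bmeas_fst bf; have /bmeas_fst br := bmeas_trunc_reg.
have bl := bmeas_trunc_label.
have b2 : bmeas (fun z : X * R => f z.1 - trunc_reg z.1) by exact: bmeasB.
transitivity (\int[rho]_z ((f z.1 - trunc_reg z.1) ^+ 2 +
    2 * ((f z.1 - trunc_reg z.1) * (trunc_reg z.1 - trunc_label z)))).
  by apply: eq_Rintegral => z _; rewrite /excess_loss; ring.
have b3 : bmeas (fun z => (f z.1 - trunc_reg z.1) * (trunc_reg z.1 - trunc_label z)).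
  by apply: bmeasM => //; exact: bmeasB.
rewrite ExD ?ExZ//; [|exact: bmeasX|exact: bmeasZ].
rewrite (label_residual_orthogonal (psi := fun x => f x - trunc_reg x)) ?mulr0 ?addr0//.
by apply: bmeasB => //; exact: bmeas_trunc_reg.
Qed.

Lemma excess_lossE f z : excess_loss f z =
  (f z.1 - trunc_reg z.1) * (f z.1 + trunc_reg z.1 - 2 * trunc_label z).
Proof. by rewrite /excess_loss; ring. Qed.

Lemma excess_loss_factor f b z : (forall x, `|f x| <= b) ->
  `|f z.1 + trunc_reg z.1 - 2 * trunc_label z| <= b + 3 * M.
Proof.
move=> fb; apply: le_trans (ler_normB _ _) _; rewrite normrM (ger0_norm (ler0n _ 2)).
have := ler_normD (f z.1) (trunc_reg z.1); have := fb z.1.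
have := trunc_reg_bound z.1; have := trunc_label_bound z; lra.
Qed.

Lemma excess_loss_bound f b z : (forall x, `|f x| <= b) ->
  `|excess_loss f z| <= (b + 3 * M) ^+ 2.
Proof.
move=> fb; rewrite excess_lossE normrM expr2.
apply: ler_pM => //; last exact: excess_loss_factor.
apply: le_trans (ler_normB _ _) _.
have := fb z.1; have := trunc_reg_bound z.1; move: M0; lra.
Qed.

(** The factor [f - trunc_reg] of the loss bounds its second moment by the risk itself: the variance
    condition of [relative_chernoff]. *)
Lemma excess_loss_variance f b : bmeas f -> (forall x, `|f x| <= b) ->
  \int[rho]_z (excess_loss f z ^+ 2) <= (b + 3 * M) ^+ 2 * excess_risk f.
Proof.
move=> bf fb; have b1 := bmeas_fst bf; have /bmeas_fst br := bmeas_trunc_reg.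
have b2 : bmeas (fun z : X * R => (f z.1 - trunc_reg z.1) ^+ 2).
  by apply: bmeasX; exact: bmeasB.
rewrite -ExZ//; apply: Ex_le; [by apply: bmeasX; exact: bmeas_excess_loss|exact: bmeasZ|].
move=> z; rewrite excess_lossE exprMn mulrC ler_wpM2r ?sqr_ge0//.
have h := excess_loss_factor z fb.
by rewrite -real_normK ?num_real// lerXn2r ?nnegrE//; exact: le_trans h.
Qed.

Lemma excess_loss_lipschitz f g b e z : (forall x, `|f x| <= b) -> (forall x, `|g x| <= b) ->
  (forall x, `|f x - g x| <= e) -> `|excess_loss f z - excess_loss g z| <= e * (2 * (b + M)).
Proof.
move=> fb gb fg.
have -> : excess_loss f z - excess_loss g z =
  (f z.1 - g z.1) * (f z.1 + g z.1 - 2 * trunc_label z) by rewrite /excess_loss; ring.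
rewrite normrM; apply: ler_pM => //.
apply: le_trans (ler_normB _ _) _; rewrite normrM (ger0_norm (ler0n _ 2)).
have := ler_normD (f z.1) (g z.1); have := fb z.1; have := gb z.1.
have := trunc_label_bound z; lra.
Qed.

Lemma lsq_error_excess f : bmeas f ->
  (lsq_error rho f - lsq_error rho frho = (excess_risk f)%:E)%E.
Proof.
move=> bf; have b1 := bmeas_fst bf; have /bmeas_fst br := bmeas_trunc_reg.
have bl := bmeas_trunc_label.
have mf1 : measurable_fun setT (fun z : X * R => frho z.1).
  by apply: measurableT_comp => //; exact: measurable_fst.
rewrite /lsq_error (Ex_ae_bmeas (g := fun z => (f z.1 - trunc_label z) ^+ 2)); last 3 first.
- by apply: measurable_funX; apply: measurable_funB; [exact: b1.1|exact: measurable_snd].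
- by apply: bmeasX; exact: bmeasB.
- by apply: filterS trunc_labelE => z <-.
rewrite (Ex_ae_bmeas (g := fun z => (trunc_reg z.1 - trunc_label z) ^+ 2)); last 3 first.
- by apply: measurable_funX; apply: measurable_funB => //; exact: measurable_snd.
- by apply: bmeasX; exact: bmeasB.
- by apply: filterS2 trunc_labelE regression_bounded => z <- ->.
rewrite -EFinB -ExB; [|by apply: bmeasX; exact: bmeasB..].
by rewrite -Ex_excess_loss.
Qed.

End Regression.

(** * Sampling errors *)

Lemma probability_bigU_le (R : realType) dT (T : measurableType dT) (P : probability T R)
    (I : Type) (r : seq I) (S : I -> set T) (p : R) :
  (forall i, measurable (S i)) -> (forall i, P (S i) <= p%:E)%E ->
  measurable (\big[setU/set0]_(i <- r) S i) /\
  (P (\big[setU/set0]_(i <- r) S i) <= ((size r)%:R * p)%:E)%E.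
Proof.
move=> mS PS; elim: r => [|i r [mU PU]].
  by rewrite big_nil mul0r measure0; split.
rewrite big_cons; split; first exact: measurableU.
apply: le_trans (measureU2 P (mS i) mU) _.
by rewrite /= -natr1 mulrDl mul1r addrC EFinD leeD.
Qed.

Section Sampling.
Context {R : realType} {dX : measure_display} {X : measurableType dX}.
Variables (rho : probability (X * R)%type R) (M : R).
Hypotheses (M0 : 0 < M) (yM : {ae rho, forall z : X * R, `|z.2| <= M}).
Variable frho : X -> R.
Hypothesis reg : is_regression rho frho.
Context {dO : measure_display} {O : measurableType dO}.
Variables (P : probability O R) (m : nat) (Z : 'I_m -> O -> (X * R)%type).
Hypothesis iid : iid_sample P rho Z.

Let loss := excess_loss M frho.
Let risk := excess_risk rho M frho.

Lemma labels_bounded : exists B : set O, [/\ measurable B, P B = 0 &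
  forall w, ~ B w -> forall j, `|(Z j w).2| <= M].
Proof.
case: iid => mZ idZ _; pose A := [set z : X * R | M < `|z.2|].
have mA : measurable A.
  rewrite -[X in measurable X]setTI.
  have -> : A = (fun z : X * R => `|z.2|) @^-1` `]M, +oo[.
    by apply/seteqP; split => z; rewrite /= in_itv/= andbT.
  suff mn : measurable_fun setT (fun z : X * R => `|z.2|).
    by apply: mn => //; exact: measurable_itv.
  by apply: measurableT_comp => //; exact: measurable_snd.
have A0 : rho A = 0.
  apply: measure_negligible => //.
  by move: yM; congr negligible; apply/seteqP; split => z; rewrite /A /= ltNge => /negP.
have mZA j : measurable (Z j @^-1` A).
  by rewrite -[X in measurable X]setTI; apply: mZ.
have PZA j : (P (Z j @^-1` A) <= (0 : R)%:E)%E.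
  by rewrite idZ// A0.
have [mB PB] := probability_bigU_le (index_enum 'I_m) mZA PZA.
exists (\big[setU/set0]_j (Z j @^-1` A)); split => //.
  by apply/eqP; rewrite eq_le measure_ge0 andbT; move: PB; rewrite mulr0.
move=> w nB j; rewrite leNgt; apply/negP => lt; apply: nB.
by rewrite (bigD1 j)//=; left.
Qed.

Lemma lower_deviation f b D eps : bmeas f -> (forall x, `|f x| <= b) -> 0 < D ->
  (b + 3 * M) ^+ 2 <= D ->
  let S := [set w | m%:R * (risk f / 2 - eps) >= \sum_j loss f (Z j w)] in
  measurable S /\ (P S <= (expR (- (m%:R * eps / (4 * D))))%:E)%E.
Proof.
move=> bf fb D0 bD S.
have bl : bmeas (loss f) by exact: (bmeas_excess_loss M0 reg).
have J : \int[rho]_z (- loss f z) = - risk f.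
  under eq_Rintegral do rewrite -mulN1r.
  by rewrite ExZ// mulN1r /loss (Ex_excess_loss M0 yM reg).
have [|||||mS PS] := relative_chernoff (xi := fun z => - loss f z) (D := D) (I := risk f) eps iid.
- exact: bmeasN.
- exact: D0.
- by move=> z; rewrite normrN; apply: le_trans bD; exact: excess_loss_bound.
- by rewrite J normrN ger0_norm//; exact: excess_risk_ge0.
- under eq_Rintegral do rewrite sqrrN.
  apply: le_trans (excess_loss_variance M0 reg bf fb) _.
  by rewrite ler_wpM2r//; exact: excess_risk_ge0.
suff -> : S = [set w | m%:R * (\int[rho]_z (- loss f z) + risk f / 2 + eps) <=
    \sum_i - loss f (Z i w)] by [].
apply/seteqP; split => w; rewrite /S /= J sumrN.
  by rewrite lerNr -mulrN; congr (_ <= _ * _); field.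
by rewrite lerNr -mulrN; congr (_ <= _ * _); field.
Qed.

Lemma upper_deviation f b D eps : bmeas f -> (forall x, `|f x| <= b) -> 0 < D ->
  (b + 3 * M) ^+ 2 <= D ->
  let S := [set w | m%:R * (3 / 2 * risk f + eps) <= \sum_j loss f (Z j w)] in
  measurable S /\ (P S <= (expR (- (m%:R * eps / (4 * D))))%:E)%E.
Proof.
move=> bf fb D0 bD S.
have bl : bmeas (loss f) by exact: (bmeas_excess_loss M0 reg).
have J : \int[rho]_z (loss f z) = risk f by rewrite /loss (Ex_excess_loss M0 yM reg).
have [|||||mS PS] := relative_chernoff (xi := loss f) (D := D) (I := risk f) eps iid.
- exact: bl.
- exact: D0.
- by move=> z; apply: le_trans bD; exact: excess_loss_bound.
- by rewrite J ger0_norm//; exact: excess_risk_ge0.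
- apply: le_trans (excess_loss_variance M0 reg bf fb) _.
  by rewrite ler_wpM2r//; exact: excess_risk_ge0.
suff -> : S = [set w | m%:R * (\int[rho]_z (loss f z) + risk f / 2 + eps) <=
    \sum_i loss f (Z i w)] by [].
have e : risk f + risk f / 2 + eps = 3 / 2 * risk f + eps by field.
by apply/seteqP; split => w; rewrite /S /= J e.
Qed.

(** A lower deviation is excluded for each candidate [F i], and an upper one for the comparison
    function alone, hence [#|I|.+1] events; the null set of large labels is free. *)
Lemma sampling_event (I : finType) (F : I -> X -> R) (g : X -> R) b D eps :
  (forall i, bmeas (F i)) -> (forall i x, `|F i x| <= b) -> bmeas g ->
  (forall x, `|g x| <= b) -> 0 < D -> (b + 3 * M) ^+ 2 <= D ->
  exists E : set O, [/\ measurable E,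
    (P E >= (1 - (#|I|.+1)%:R * expR (- (m%:R * eps / (4 * D))))%:E)%E &
    forall w, E w -> [/\ forall j, `|(Z j w).2| <= M,
      forall i, m%:R * (risk (F i) / 2 - eps) <= \sum_j loss (F i) (Z j w) &
      \sum_j loss g (Z j w) <= m%:R * (3 / 2 * risk g + eps)]].
Proof.
move=> bF Fb bg gb D0 bD.
have [B0 [mB0 PB0 B0P]] := labels_bounded.
set p := expR _.
have devF i := lower_deviation eps (bF i) (Fb i) D0 bD.
have [mg Pg] := upper_deviation eps bg gb D0 bD.
have [mU PU] := probability_bigU_le (p := p) (index_enum I) (fun i => (devF i).1) (fun i => (devF i).2).
set U := \big[_/_]_(i <- _) _ in mU PU.
set G := [set w | _] in mg Pg.
have mGU : measurable (G `|` U) by exact: measurableU.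
have mBad : measurable (B0 `|` (G `|` U)) by exact: measurableU.
exists (~` (B0 `|` (G `|` U))); split.
- exact: measurableC.
- rewrite probability_setC// EFinB leeB//.
  have PB0' : (P B0 <= 0)%E by rewrite PB0.
  apply: le_trans (measureU2 P mB0 mGU) _.
  apply: le_trans (leeD PB0' (measureU2 P mg mU)) _; rewrite add0e.
  rewrite -nat1r mulrDl mul1r EFinD leeD//.
  by rewrite cardE enumT; move: PU.
- move=> w; rewrite /= => nw; split.
  + by apply: B0P => h; apply: nw; left.
  + move=> i; rewrite leNgt; apply/negP => lt; apply: nw; right; right.
    rewrite /U (bigD1_seq i) ?mem_index_enum ?index_enum_uniq//=; left.
    exact: ltW.
  + rewrite leNgt; apply/negP => lt; apply: nw; right; left; exact: ltW.
Qed.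

End Sampling.

(** Rounds down to a multiple of [h]; the index [v k] stands for the integer [v k - L] between [-L]
    and [L], whence [2L + 1] values. *)
Lemma grid_rounding (R : realType) n (h : R) (L : nat) (a : 'I_n -> R) : 0 < h ->
  (forall k, `|a k| <= h * L%:R) ->
  exists v : {ffun 'I_n -> 'I_(L.*2.+1)}, forall k, `|a k - h * ((v k)%:R - L%:R)| <= h.
Proof.
move=> h0 aL; pose y k := a k / h + L%:R.
have y0 k : 0 <= y k.
  rewrite /y -lerBlDr sub0r lerNl -mulNr ler_pdivrMr// mulrC.
  by have := aL k; rewrite ler_norml => /andP[]; rewrite lerNl.
have yL k : y k <= (L.*2)%:R.
  rewrite /y -addnn natrD lerD2r ler_pdivrMr// mulrC.
  exact: le_trans (ler_norm _) (aL k).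
have tr k : (Num.truncn (y k) < L.*2.+1)%N.
  by rewrite ltnS -(ler_nat R); apply: le_trans (yL k); case/andP: (truncn_itv (y0 k)).
exists [ffun k => Ordinal (tr k)] => k; rewrite ffunE /=.
have -> : a k - h * ((Num.truncn (y k))%:R - L%:R) = h * (y k - (Num.truncn (y k))%:R).
  by rewrite /y; field; rewrite gt_eqF.
rewrite normrM (gtr0_norm h0) -[leRHS]mulr1 ler_pM2l//.
have /andP[h1 h2] := truncn_itv (y0 k).
by rewrite ger0_norm ?subr_ge0// lerBlDl natr1 ltW.
Qed.

(** * Oracle inequality *)

Section Minimizer.
Context {R : realType} {dX : measure_display} {X : measurableType dX}.
Variable K : X -> X -> R.
Variables (m : nat) (x : 'I_m -> X) (y : 'I_m -> R) (lambda : R) (c : 'I_m -> R).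
Hypotheses (m0 : (0 < m)%N) (lambda0 : 0 < lambda).
Hypothesis cmin : is_l1_minimizer K x y lambda c.

(** Comparison with the zero vector, whose objective is at most [M^2]. *)
Lemma minimizer_norm M : 0 <= M -> (forall j, `|y j| <= M) ->
  \sum_j `|c j| <= M ^+ 2 / lambda.
Proof.
move=> M0 yM; rewrite ler_pdivlMr// mulrC.
have mr : 0 < m%:R :> R by rewrite ltr0n.
apply: le_trans (_ : _ <= l1_objective K x y lambda c) _.
  by rewrite /l1_objective lerDr mulr_ge0 ?invr_ge0 ?ler0n// sumr_ge0// => j _; exact: sqr_ge0.
apply: le_trans (cmin (fun=> 0)) _.
rewrite /l1_objective [X in lambda * X]big1 ?mulr0 ?addr0; last by move=> k _; rewrite normr0.
rewrite mulrC ler_pdivrMr// mulr_natr -[m in leRHS]card_ord -sumr_const.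
apply: ler_sum => j _; rewrite big1 ?sub0r ?sqrrN; last by move=> k _; rewrite mulr0.
by rewrite -real_normK ?num_real// lerXn2r ?nnegrE.
Qed.

(** Minimality compares only coefficients on the sample; [representer] brings [cg] there with the
    same values at the [x j] and no larger norm. *)
Lemma minimizer_le (pdK : pd_kernel K) (l1K : l1_cond K) N (t : 'I_N -> X) (cg : 'I_N -> R) :
  injective x ->
  \sum_j (kernel_fun K x c (x j) - y j) ^+ 2 <=
    \sum_j (kernel_fun K t cg (x j) - y j) ^+ 2
      + m%:R * (lambda * (\sum_i `|cg i| - \sum_j `|c j|)).
Proof.
move=> ix; have [c' c'E c'g] := representer pdK l1K t cg ix.
have mr : 0 < m%:R :> R by rewrite ltr0n.
have := cmin c'; rewrite /l1_objective -/(kernel_fun K x c _) => h.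
have {}h : m%:R^-1 * \sum_j (kernel_fun K x c (x j) - y j) ^+ 2 + lambda * \sum_j `|c j| <=
    m%:R^-1 * \sum_j (kernel_fun K t cg (x j) - y j) ^+ 2 + lambda * \sum_i `|cg i|.
  apply: le_trans h _; apply: lerD; last by rewrite ler_wpM2l// ltW.
  rewrite ler_wpM2l ?invr_ge0 ?ler0n// le_eqVlt; apply/orP; left; apply/eqP.
  by apply: eq_bigr => j _; rewrite -c'E.
rewrite -(ler_pM2l (_ : 0 < m%:R^-1)) ?invr_gt0// mulrDr mulKf ?gt_eqF//.
by rewrite mulrBr addrA lerBrDr.
Qed.

End Minimizer.

(** [f] is the minimizer, [F] its rounding to a step function, [g] the comparison function; [E]
    marks risks and [S] empirical sums. The lower deviation leaves half of the risk on the left,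
    which absorbs the quarter coming from [gap]; multiplying the rest by 4 gives 10, 8 and 6. *)
Lemma risk_arith (R : realFieldType) (mR Ef EF Eg SF Sf Sg gap eps T Q : R) : 0 < mR ->
  mR * (EF / 2 - eps) <= SF -> Sg <= mR * (3 / 2 * Eg + eps) -> Sf <= Sg + mR * gap ->
  SF <= Sf + mR * T -> Ef <= EF + T -> gap <= Q + 4^-1 * Ef -> Eg <= Q ->
  Ef <= 10 * Q + 8 * eps + 6 * T.
Proof.
move=> m0 h1 h2 h3 h4 h5 h6 h7.
have : mR * (EF / 2 - eps) <= mR * (3 / 2 * Eg + eps + gap + T) by rewrite !mulrDr in h2 *; lra.
rewrite ler_pM2l//; lra.
Qed.

Section Oracle.
Context {R : realType} {dX : measure_display} {X : measurableType dX}.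
Variables (d : X -> X -> R) (rho : probability (X * R)%type R) (K : X -> X -> R).
Variables (eta Ceta alpha Calpha kappa M : R) (frho : X -> R).
Hypotheses (md : is_metric d) (bX : borel_for d) (cov : covering_cond d eta Ceta).
Hypotheses (alpha0 : 0 < alpha) (Calpha0 : 0 < Calpha).
Hypotheses (pdK : pd_kernel K) (l1K : l1_cond K) (holK : holder_cond d K alpha Calpha).
Hypotheses (kappa0 : 0 < kappa) (Kk : forall x t, `|K x t| <= kappa).
Hypotheses (M0 : 0 < M) (yM : {ae rho, forall z : X * R, `|z.2| <= M}).
Hypothesis reg : is_regression rho frho.

Let f0 := trunc_reg M frho.
Let risk := excess_risk rho M frho.
Let loss := excess_loss M frho.
Let bf0 : bmeas f0. Proof. exact: (bmeas_trunc_reg M0 reg). Qed.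
Let hkf N (t : 'I_N -> X) c : hol d alpha (kernel_fun K t c).
Proof. exact: (hol_kernel_fun Calpha0 holK). Qed.
Let bh f : hol d alpha f -> bmeas f. Proof. exact: (hol_bmeas md bX cov alpha0). Qed.

(** For [s > 2] the surplus [l^(s-2)] is moved into the coefficients, where a power of [kappa]
    bounds it; smoothness beyond the saturation of the filter is given away. *)
Lemma approximation_of_range s : 0 < s -> in_range_LKs rho K s frho ->
  exists2 C, 0 < C & forall k Rz, 0 < k <= 1 -> 0 <= Rz ->
  exists N (t : 'I_N -> X) (cg : 'I_N -> R),
    risk (kernel_fun K t cg) <= C * (k `^ Num.min s 2) ^+ 2 /\
    forall N' (x : 'I_N' -> X) (c : 'I_N' -> R), \sum_i `|c i| <= Rz ->
      k * k `^ Num.min s 2 * (\sum_i `|cg i| - \sum_i `|c i|) <=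
        C * (k `^ Num.min s 2) ^+ 2 + 4^-1 * risk (kernel_fun K x c).
Proof.
move=> s0 inr.
have [A spec] := spectral_data md bX cov alpha0 Calpha0 pdK holK s0 inr reg.1 bf0
   (regression_bounded M0 yM reg) Kk.
pose A' := Num.max 1 ((kappa `^ (s - Num.min s 2)) ^+ 2 * A).
apply: (span_approximation (eta := eta) (Ceta := Ceta) (A := A')
   md bX cov alpha0 Calpha0 pdK l1K holK Kk _ _ bf0).
- by rewrite lt_min s0 ltr0n ge_min lexx orbT.
- by rewrite /A' le_max lexx.
move=> e e0; have [n [psi [l [a [hp lk ep op [aA fe]]]]]] := spec e e0.
exists n, psi, l, (fun i => l i `^ (s - Num.min s 2) * a i); split => //.
have sm : 0 <= s - Num.min s 2 by rewrite subr_ge0 ge_min lexx.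
split.
  apply: le_trans (_ : (kappa `^ (s - Num.min s 2)) ^+ 2 * A <= _); last by rewrite le_max lexx orbT.
  apply: le_trans (ler_wpM2l (sqr_ge0 _) aA); rewrite mulr_sumr; apply: ler_sum => i _.
  rewrite exprMn ler_wpM2r ?sqr_ge0// lerXn2r ?nnegrE ?powR_ge0//.
  by have /andP[l0 l1] := lk i; apply: ler_powRl => //; exact: ltW.
apply: le_trans fe; rewrite le_eqVlt; apply/orP; left; apply/eqP.
apply: eq_Rintegral => z _; congr ((_ - _) ^+ 2); apply: eq_bigr => i _; rewrite mulrA -powRD ?subrKC//.
by have /andP[l0 _] := lk i; rewrite gt_eqF ?implybT.
Qed.

(** Divided by [lambda], a sup bound for every function in play: [kappa * M^2] for the minimizer, 1
    more for its rounding, and the last term for the comparison function. *)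
Definition sup_radius C := kappa * M ^+ 2 + 1 + kappa * (C + M ^+ 2 / 4).

(** [nu] is the accuracy of the rounding relative to [1 / lambda]. The minimizer has a Hoelder
    constant of order [1 / lambda], so cells of radius [nu^(1/alpha)] and values on a grid of step
    [nu / lambda] reach it within order [nu / lambda]. The Lipschitz constant of the loss is again
    of order [1 / lambda], whence [nu / lambda^2]. *)
Lemma oracle_inequality s C lambda k nu m :
  (0 < m)%N -> 0 < C -> 0 < lambda -> lambda <= 1 -> 0 < k <= 1 -> 0 < nu <= 1 -> 0 < s ->
  k * k `^ s = lambda ->
  (forall k Rz, 0 < k <= 1 -> 0 <= Rz ->
  exists N (t : 'I_N -> X) (cg : 'I_N -> R),
    risk (kernel_fun K t cg) <= C * (k `^ s) ^+ 2 /\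
    forall N' (x : 'I_N' -> X) (c : 'I_N' -> R), \sum_i `|c i| <= Rz ->
      k * k `^ s * (\sum_i `|cg i| - \sum_i `|c i|) <=
        C * (k `^ s) ^+ 2 + 4^-1 * risk (kernel_fun K x c)) ->
  let L := (Num.truncn (kappa * M ^+ 2 / nu)).+1 in
  let D := ((sup_radius C + 3 * M) / lambda) ^+ 2 in
  exists2 n : nat, n%:R <= Ceta * (nu `^ alpha^-1) `^ (- eta) &
  forall eps (dO : measure_display) (O : measurableType dO) (P : probability O R)
    (Z : 'I_m -> O -> (X * R)%type), iid_sample P rho Z ->
  exists E : set O, [/\ measurable E,
    (P E >= (1 - (((L.*2.+1) ^ n).+1)%:R * expR (- (m%:R * eps / (4 * D))))%:E)%E &
    forall w, E w -> injective (fun j => (Z j w).1) -> forall c : 'I_m -> R,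
      is_l1_minimizer K (fun j => (Z j w).1) (fun j => (Z j w).2) lambda c ->
      risk (kernel_fun K (fun j => (Z j w).1) c) <=
        10 * (C * (k `^ s) ^+ 2) + 8 * eps +
        12 * (M ^+ 2 * Calpha + 1) * (sup_radius C + M) * (nu / lambda ^+ 2)].
Proof.
move=> m0 C0 l0 l1 k01 /andP[nu0 nu1] s0 kl approx L D.
have Rz0 : 0 <= M ^+ 2 / lambda by rewrite divr_ge0 ?sqr_ge0// ltW.
have [N [t [cg [Eg gapg]]]] := approx k _ k01 Rz0; rewrite kl in gapg.
have q1 : k `^ s <= 1.
  have /andP[k0 k1] := k01.
  by have := ler_powRl (ltW s0) (ltW k0) k1; rewrite powR1.
have q21 : (k `^ s) ^+ 2 <= 1 by rewrite expr_le1// powR_ge0.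
(* The gap inequality for the empty expansion bounds the norm of [cg], since the zero function has
   risk at most [M^2]. *)
have cgB : \sum_i `|cg i| <= (C + M ^+ 2 / 4) / lambda.
  rewrite ler_pdivlMr// mulrC.
  have z0 : 'I_0 -> X by case.
  have := gapg 0%N z0 (fun=> 0); rewrite !big_ord0 subr0 => /(_ Rz0) h.
  apply: le_trans h _; apply: lerD.
    by rewrite -[leRHS]mulr1 ler_wpM2l// ltW.
  rewrite mulrC ler_wpM2r ?invr_ge0 ?ler0n// /risk /excess_risk -[leRHS](Ex_cst rho).
  apply: Ex_le; [|exact: bmeas_cst|].
    by apply: bmeasX; apply: bmeasB; apply: bmeas_fst => //; apply: bh.
  move=> z; rewrite /kernel_fun big_ord0 sub0r sqrrN -real_normK ?num_real//.
  by rewrite lerXn2r ?nnegrE ?(ltW M0)//; exact: trunc_reg_bound.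
set b := sup_radius C / lambda.
have li : 1 <= lambda^-1 by rewrite invf_ge1.
have r1 : 0 <= C + M ^+ 2 / 4 by rewrite addr_ge0 ?divr_ge0 ?sqr_ge0// ltW.
have kM : 0 <= kappa * M ^+ 2 by rewrite mulr_ge0 ?sqr_ge0// ltW.
pose h := nu / lambda; have h0 : 0 < h by rewrite divr_gt0.
have hL : kappa * M ^+ 2 / lambda <= h * L%:R <= b.
  have y0 : 0 <= kappa * M ^+ 2 / nu by rewrite divr_ge0// ltW.
  have /andP[t1 t2] := truncn_itv y0.
  have -> : kappa * M ^+ 2 / lambda = h * (kappa * M ^+ 2 / nu).
    by rewrite /h; field; rewrite ?gt_eqF.
  rewrite ler_pM2l//; apply/andP; split; first exact: ltW.
  rewrite /b /h /L -natr1 mulrAC ler_pM2r ?invr_gt0// mulrDr mulr1.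
  apply: (@le_trans _ _ (kappa * M ^+ 2 + 1)); last by rewrite /sup_radius lerDl mulr_ge0// ltW.
  by apply: lerD => //; rewrite mulrC -ler_pdivlMr.
have /andP[hL1 hL2] := hL.
have gB x : `|kernel_fun K t cg x| <= b.
  apply: le_trans (kernel_fun_bound _ _ _ Kk) _.
  apply: (@le_trans _ _ (kappa * ((C + M ^+ 2 / 4) / lambda))).
    by rewrite ler_wpM2l// ltW.
  by rewrite mulrA ler_pM2r ?invr_gt0// /sup_radius lerDr addr_ge0.
have r0 : 0 < nu `^ alpha^-1 by exact: powR_gt0.
have r1' : nu `^ alpha^-1 <= 1.
  by have := ler_powRl (_ : 0 <= alpha^-1) (ltW nu0) nu1; rewrite powR1 invr_ge0; apply; exact: ltW.
have [n [tn [idx [nC _ midx tx]]]] := net_partition bX cov r0 r1'.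
exists n => // eps dO O P Z iid.
pose F (v : {ffun 'I_n -> 'I_(L.*2.+1)}) x := h * ((v (idx x))%:R - L%:R).
have bF v : bmeas (F v).
  exact: (bmeas_step midx (fun k => h * ((v k)%:R - L%:R))).
have Fb v x : `|F v x| <= b.
  apply: le_trans hL2; rewrite normrM (gtr0_norm h0) ler_pM2l// ler_norml.
  have u : (v (idx x))%:R <= L%:R + L%:R :> R by rewrite -natrD addnn ler_nat -ltnS ltn_ord.
  by apply/andP; split; [rewrite lerBrDl subrr ler0n|rewrite lerBlDr].
have D0 : 0 < D.
  rewrite exprn_gt0// divr_gt0// /sup_radius.
  by have := mulr_ge0 (ltW kappa0) r1; move: M0 kM; lra.
have bD : (b + 3 * M) ^+ 2 <= D.
  have b0 : 0 <= b by exact: le_trans (gB point).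
  rewrite /D (mulrDl (sup_radius C)) lerXn2r ?nnegrE//.
  - by rewrite addr_ge0// mulr_ge0// ltW.
  - by rewrite addr_ge0// divr_ge0 ?(ltW l0)// mulr_ge0// ltW.
  - by rewrite lerD2l ler_peMr// mulr_ge0// ltW.
have bg : bmeas (kernel_fun K t cg) by exact: bh.
have [E [mE PE EP]] := sampling_event M0 yM reg iid eps bF Fb bg gB D0 bD.
exists E; split => //.
  by move: PE; rewrite card_ffun !card_ord.
move=> w Ew ix c cmin; have [yw Fw gw] := EP w Ew.
set x := fun j => (Z j w).1 in ix cmin *; set f := kernel_fun K x c.
have cR : \sum_j `|c j| <= M ^+ 2 / lambda.
  exact: (minimizer_norm m0 l0 cmin (ltW M0)).
have fB y : `|f y| <= kappa * M ^+ 2 / lambda.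
  apply: le_trans (kernel_fun_bound _ _ _ Kk) _.
  by rewrite -mulrA ler_wpM2l// ltW.
(* [v] depends on the sample through [c], but [F v] belongs to the finite family fixed before the
   sample was drawn. *)
have [v vE] := @grid_rounding _ _ _ _ (fun k => f (tn k)) h0 (fun k => le_trans (fB (tn k)) hL1).
have fF y : `|f y - F v y| <= (M ^+ 2 * Calpha + 1) * h.
  apply: le_trans (ler_distD (f (tn (idx y))) _ _) _.
  rewrite mulrDl mul1r; apply: lerD; last exact: vE.
  have fL y1 y2 : `|f y1 - f y2| <= M ^+ 2 / lambda * Calpha * d y1 y2 `^ alpha.
    apply: le_trans (kernel_fun_holder holK _ _ _ _) _.
    by rewrite !ler_wpM2r ?powR_ge0// ltW.
  have L0 : 0 <= M ^+ 2 / lambda * Calpha by rewrite mulr_ge0// ltW.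
  have := hol_close md alpha0 L0 fL r0 (tx y); rewrite powR_root ?(ltW nu0)// distrC.
  by rewrite /h; congr (_ <= _); ring.
have fb y : `|f y| <= b by exact: le_trans (fB y) (le_trans hL1 hL2).
pose T := (M ^+ 2 * Calpha + 1) * h * (2 * (b + M)).
have lossT z : `|loss f z - loss (F v) z| <= T.
  exact: excess_loss_lipschitz fb (Fb v) fF.
have bf : bmeas f by exact: (bh (hkf _ _)).
have T1 : \sum_j loss (F v) (Z j w) <= \sum_j loss f (Z j w) + m%:R * T.
  rewrite mulr_natl -[m in T *+ m]card_ord -sumr_const -big_split/=.
  apply: ler_sum => j _; rewrite -lerBlDl; apply: le_trans (lossT (Z j w)).
  by rewrite distrC ler_norm.
have T2 : risk f <= risk (F v) + T.
  rewrite -lerBlDl /risk -(Ex_excess_loss M0 yM reg bf) -(Ex_excess_loss M0 yM reg (bF v)).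
  have bl1 := bmeas_excess_loss M0 reg bf; have bl2 := bmeas_excess_loss M0 reg (bF v).
  rewrite -ExB//; apply: le_trans (ler_norm _) _.
  by apply: Ex_norm_le; first exact: bmeasB.
have mr : 0 < m%:R :> R by rewrite ltr0n.
have tl j : trunc_label M (Z j w) = (Z j w).2 by rewrite /trunc_label clamp_id.
have min' : \sum_j loss f (Z j w) <= \sum_j loss (kernel_fun K t cg) (Z j w) +
    m%:R * (lambda * (\sum_i `|cg i| - \sum_j `|c j|)).
  rewrite /loss /excess_loss !sumrB addrAC lerD2r.
  have := minimizer_le m0 l0 cmin pdK l1K t cg ix.
  by under [X in _ -> X <= _]eq_bigr do rewrite tl; under [X in _ -> _ <= X + _]eq_bigr do rewrite tl.
have := risk_arith mr (Fw v) gw min' T1 T2 (gapg _ x c cR) Eg.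
move=> h1; apply: le_trans h1 _; rewrite lerD2l.
have A0 : 0 <= M ^+ 2 * Calpha + 1 by rewrite addr_ge0// mulr_ge0 ?sqr_ge0// ltW.
have -> : 12 * (M ^+ 2 * Calpha + 1) * (sup_radius C + M) * (nu / lambda ^+ 2) =
   6 * ((M ^+ 2 * Calpha + 1) * h * (2 * ((sup_radius C + M) / lambda))).
  by rewrite /h; field; rewrite gt_eqF.
have bM : b + M <= (sup_radius C + M) / lambda.
  by rewrite (mulrDl (sup_radius C)) lerD2l ler_peMr// ltW.
have n2 : (0 : R) <= 2 by exact: ler0n.
have n6 : (0 : R) <= 6 by exact: ler0n.
exact: (ler_wpM2l n6 (ler_wpM2l (mulr_ge0 A0 (ltW h0)) (ler_wpM2l n2 bM))).
Qed.

End Oracle.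

(** * Rates *)

Section Rates.
Context {R : realType}.

Lemma ln4_ge1 : 1 <= ln (4 : R).
Proof.
have h : expR (2^-1) <= 2 :> R by have := @expR_le_quadratic R 2^-1 (lexx _); lra.
have h4 : expR (2^-1 + 2^-1) <= 4 :> R.
  by have := ler_pM (expR_ge0 _) (expR_ge0 _) h h; rewrite expRD; lra.
have e1 : (1 : R) = 2^-1 + 2^-1 by lra.
by rewrite -[leLHS](@expRK R) ler_ln ?posrE ?expR_gt0// [X in expR X]e1.
Qed.

(** The deviation is chosen to make the exponential [delta / (2N)]; [N + 1 <= 2N] covers the extra
    event of the comparison function. *)
Lemma confidence_level (mR D delta : R) (N : nat) : (0 < N)%N -> 0 < mR -> 0 < D -> 0 < delta ->
  (N.+1)%:R * expR (- (mR * (4 * D / mR * ln (2 * N%:R / delta)) / (4 * D))) <= delta.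
Proof.
move=> N0 m0 D0 de0; have NR : 1 <= N%:R :> R by rewrite ler1n.
have N0' : 0 < N%:R :> R by rewrite ltr0n.
have -> : mR * (4 * D / mR * ln (2 * N%:R / delta)) / (4 * D) = ln (2 * N%:R / delta).
  by field; rewrite !gt_eqF.
rewrite expRN lnK ?posrE ?divr_gt0 ?mulr_gt0// invf_div mulrA ler_pdivrMr ?mulr_gt0//.
by rewrite mulrC ler_pM2l// -natr1; lra.
Qed.

(** For the last bound, [(2 + 2m) / delta] is twice [(1 + m) / delta], which is itself at least 2;
    it links the logarithms of the two regimes of [s]. *)
Lemma log_cardinality (mR delta : R) : 1 <= mR -> 0 < delta -> delta < 1 ->
  [/\ 1 <= ln ((2 + 2 * mR) / delta), ln (2 / delta) <= ln ((2 + 2 * mR) / delta),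
    ln mR <= ln ((2 + 2 * mR) / delta) &
    ln ((2 + 2 * mR) / delta) <= 2 * ln ((1 + mR) / delta)].
Proof.
move=> m1 de0 de1; have m0 : 0 < mR by lra.
have p2 : 0 < 2 + 2 * mR by lra.
have p0 : 0 < (2 + 2 * mR) / delta by rewrite divr_gt0.
have le0 : 2 + 2 * mR <= (2 + 2 * mR) / delta by rewrite ler_pdivlMr//; nra.
split.
- apply: le_trans ln4_ge1 _; rewrite ler_ln ?posrE//; lra.
- rewrite ler_ln ?posrE ?divr_gt0// ler_pM2r ?invr_gt0//; lra.
- rewrite ler_ln ?posrE//; lra.
- have a0 : 0 < (1 + mR) / delta by rewrite divr_gt0//; lra.
  have -> : (2 + 2 * mR) / delta = 2 * ((1 + mR) / delta) by rewrite mulrA; congr (_ / _); ring.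
  rewrite lnM ?posrE// [leRHS]mulr_natl mulr2n lerD2r ler_ln ?posrE//.
  by rewrite ler_pdivlMr//; nra.
Qed.

(** As [1 / nu <= mR], there are at most [(2y + 3) mR] grid values, so one cell costs a logarithm of
    order [Lam]. *)
Lemma log_grid (y nu mR G Lam : R) : 0 <= y -> 0 < nu -> mR^-1 <= nu -> 1 <= mR ->
  G = ln (2 * y + 3) -> 1 <= Lam -> ln mR <= Lam ->
  0 <= ln ((Num.truncn (y / nu)).+1.*2.+1%:R : R) <= (G + 1) * Lam.
Proof.
move=> y0 nu0 mnu m1 GE L1 mL; have m0 : 0 < mR by lra.
set L := (Num.truncn (y / nu)).+1.
have yn : 0 <= y / nu by rewrite divr_ge0// ltW.
have /andP[t1 _] := truncn_itv yn.
apply/andP; split; first by rewrite ln_ge0// ler1n.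
have G0 : 0 <= G by rewrite GE ln_ge0//; lra.
have ynm : y / nu <= y * mR.
  by rewrite ler_wpM2l// -[leRHS]invrK lef_pV2 ?posrE ?invr_gt0.
have le : (L.*2.+1)%:R <= (2 * y + 3) * mR.
  rewrite -natr1 -addnn natrD /L -natr1.
  have -> : (2 * y + 3) * mR = 2 * (y * mR) + 3 * mR by ring.
  lra.
have p0 : 0 < 2 * y + 3 by lra.
apply: (@le_trans _ _ (ln ((2 * y + 3) * mR))).
  by rewrite ler_ln ?posrE ?mulr_gt0 ?ltr0n.
rewrite lnM ?posrE// -GE mulrDl mul1r lerD// -[leLHS]mulr1 ler_wpM2l//.
Qed.

(** With at most [Ce mR nu] cells, division by [mR] leaves [nu]: the union bound costs, up to [Lam],
    the same order [nu / l^2] as the rounding. *)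
Lemma deviation_size (D0 l mR nu Ce G Lam n lL l2 : R) : 0 <= D0 -> 0 < l -> 0 < mR ->
  0 <= nu -> 0 <= n -> n <= Ce * (mR * nu) -> mR^-1 <= nu -> 0 <= lL <= (G + 1) * Lam ->
  l2 <= Lam -> 0 <= Lam ->
  4 * (D0 / l ^+ 2) / mR * (l2 + n * lL) <= 4 * D0 * (1 + Ce * (G + 1)) * (nu / l ^+ 2) * Lam.
Proof.
move=> D00 l0 m0 nu0 n0 nC mnu /andP[lL0 lLG] l2L Lam0.
have h1 : n * lL <= Ce * (mR * nu) * ((G + 1) * Lam) by apply: ler_pM.
have h2 : (l2 + n * lL) / mR <= nu * Lam + Ce * nu * ((G + 1) * Lam).
  rewrite mulrDl; apply: lerD.
    by rewrite mulrC; apply: le_trans (ler_wpM2l _ l2L) (ler_wpM2r Lam0 mnu); rewrite invr_ge0 ltW.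
  rewrite ler_pdivrMr//; apply: le_trans h1 _.
  by rewrite le_eqVlt; apply/orP; left; apply/eqP; ring.
have d0 : 0 <= 4 * (D0 / l ^+ 2) by rewrite mulr_ge0// divr_ge0// sqr_ge0.
rewrite -mulrA [mR^-1 * _]mulrC; apply: le_trans (ler_wpM2l d0 h2) _.
by rewrite le_eqVlt; apply/orP; left; apply/eqP; ring.
Qed.

Lemma powR_le_exponent (mR a b : R) : 1 <= mR -> b <= a -> mR `^ (- a) <= mR `^ (- b).
Proof. by move=> m1 ab; apply: ler_powR => //; rewrite lerN2. Qed.

Lemma rate_exponent_small (s th : R) : 0 < s ->
  (2^-1 * th * ((1 + s) / (1 + 2 * s))) * (1 + s)^-1 * s * 2 = s / (1 + 2 * s) * th.
Proof. by move=> s0; field; apply/andP; split; apply: lt0r_neq0; lra. Qed.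

(** Equality holds at [s = 1], and for [sg = 2] the right side decreases to [th / 3] as [s] grows:
    saturation 2 of the filter is just enough. *)
Lemma rate_exponent_large (s sg th : R) : 0 < th -> 1 <= s -> sg = Num.min s 2 ->
  3^-1 * th <= (2^-1 * th * ((1 + s) / (1 + 2 * s))) * (1 + sg)^-1 * sg * 2.
Proof.
move=> th0 s1 sgE; have sg1 : 1 <= sg by rewrite sgE le_min s1 ler1n.
have p1 : 0 < 1 + 2 * s by lra.
have p2 : 0 < 1 + sg by lra.
have -> : (2^-1 * th * ((1 + s) / (1 + 2 * s))) * (1 + sg)^-1 * sg * 2 =
  th * ((1 + s) * sg / ((1 + 2 * s) * (1 + sg))) by field; rewrite !gt_eqF.
rewrite mulrC ler_pM2l// ler_pdivlMr ?mulr_gt0// mulrC ler_pdivrMr//.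
by rewrite sgE; case: (leP s 2) => s2; nra.
Qed.

(** The exponent of the bias in [rate_exponent_small] again: the prescribed [lambda] balances bias
    and sampling error when [s < 1]. *)
Lemma residual_exponent (s th : R) : 0 < s ->
  th - 2 * (2^-1 * th * ((1 + s) / (1 + 2 * s))) = s / (1 + 2 * s) * th.
Proof. by move=> s0; field; apply: lt0r_neq0; lra. Qed.

Lemma residual_exponent_large (s th : R) : 0 < th -> 1 <= s ->
  3^-1 * th <= s / (1 + 2 * s) * th.
Proof.
move=> th0 s1; have p : 0 < 1 + 2 * s by lra.
by rewrite ler_pM2r// ler_pdivlMr// mulrC ler_pdivrMr//; lra.
Qed.

Lemma total_bound (C c8 C2 q2 eps nul rate Lam risk : R) : 0 < C -> 0 <= c8 -> 0 <= C2 ->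
  risk <= 10 * (C * q2) + 8 * eps + C2 * nul -> eps <= c8 * nul * Lam -> 0 <= nul ->
  q2 <= rate -> nul <= rate -> 1 <= Lam ->
  risk <= (10 * C + 8 * c8 + C2) * rate * Lam.
Proof.
move=> C0 c80 C20 hr he nul0 hq hn L1; apply: le_trans hr _.
have rate0 : 0 <= rate by exact: le_trans hn.
have rL : rate <= rate * Lam by rewrite ler_peMr.
have -> : (10 * C + 8 * c8 + C2) * rate * Lam = 10 * (C * (rate * Lam)) +
    8 * (c8 * (rate * Lam)) + C2 * (rate * Lam) by ring.
apply: lerD; first apply: lerD.
- by rewrite ler_wpM2l// ler_wpM2l ?(ltW C0)//; exact: le_trans rL.
- rewrite ler_wpM2l//; apply: le_trans he _; rewrite -mulrA ler_wpM2l//.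
  by rewrite ler_wpM2r//; exact: le_trans L1.
- by rewrite ler_wpM2l//; exact: le_trans rL.
Qed.

End Rates.

Theorem theorem3p5 (R : realType) (dX : measure_display) (X : measurableType dX)
  (d : X -> X -> R) (rho : probability (X * R)%type R) (K : X -> X -> R)
  (eta Ceta alpha Calpha s : R) (frho : X -> R) :
  is_metric d -> d_compact d -> borel_for d ->
  (exists M : R, 0 < M /\ {ae rho, forall z : X * R, `|z.2| <= M}) ->
  0 < eta -> 0 < Ceta -> covering_cond d eta Ceta ->
  pd_kernel K -> universal_kernel d K ->
  l1_cond K ->
  0 < alpha -> 0 < Calpha -> holder_cond d K alpha Calpha ->
  is_regression rho frho ->
  0 < s -> in_range_LKs rho K s frho ->
  exists C : R, 0 < C /\
  forall (m : nat) (delta : R), (0 < m)%N -> 0 < delta < 1 ->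
  let lambda := m%:R `^ (- (2^-1 * (1 + eta / alpha)^-1 * ((1 + s) / (1 + 2 * s)))) in
  let bound :=
    if s < 1 then
      C * m%:R `^ (- (s / (1 + 2 * s) * (1 + eta / alpha)^-1))
        * ln ((2 + 2 * m%:R) / delta)
    else
      C * m%:R `^ (- (3 * (1 + eta / alpha))^-1) * ln ((1 + m%:R) / delta) in
  forall (dO : measure_display) (O : measurableType dO) (P : probability O R)
    (Z : 'I_m -> O -> (X * R)%type),
  iid_sample P rho Z ->
  exists E : set O, [/\ measurable E, (P E >= (1 - delta)%:E)%E &
    forall w, E w ->
      injective (fun j => (Z j w).1) ->
      forall c : 'I_m -> R,
        is_l1_minimizer K (fun j => (Z j w).1) (fun j => (Z j w).2) lambda c ->
        (lsq_error rho (kernel_fun K (fun j => (Z j w).1) c)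
          - lsq_error rho frho <= bound%:E)%E].
Proof.
move=> md _ bX [M [M0 yM]] eta0 Ceta0 cov pdK _ l1K alpha0 Calpha0 holK reg s0 inr.
have [kappa kappa0 Kk] := kernel_bounded md bX cov alpha0 Calpha0 pdK holK.
have [C C0 approx] := approximation_of_range md bX cov alpha0 Calpha0 pdK l1K holK Kk M0 yM reg s0 inr.
set sg := Num.min s 2 in approx.
have sg0 : 0 < sg by rewrite lt_min s0 ltr0n.
set T := 1 + eta / alpha; set th := T^-1.
have T1 : 1 < T by rewrite ltrDl divr_gt0.
have T0 : 0 < T by exact: lt_trans T1.
have th0 : 0 < th by rewrite invr_gt0.
have th1 : th <= 1 by rewrite invf_le1// ltW.
pose D0 := (sup_radius kappa M C + 3 * M) ^+ 2.
pose y := kappa * M ^+ 2.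
have y0 : 0 <= y by rewrite mulr_ge0 ?sqr_ge0// ltW.
pose G := ln (2 * y + 3).
have G0 : 0 <= G by rewrite ln_ge0//; lra.
have rad0 : 0 < sup_radius kappa M C.
  rewrite /sup_radius -/y.
  have : 0 <= kappa * (C + M ^+ 2 / 4) by rewrite mulr_ge0 ?(ltW kappa0)// addr_ge0 ?(ltW C0)// divr_ge0 ?sqr_ge0.
  lra.
pose c8 := 4 * D0 * (1 + Ceta * (G + 1)).
pose C2 := 12 * (M ^+ 2 * Calpha + 1) * (sup_radius kappa M C + M).
have D00 : 0 <= D0 by exact: sqr_ge0.
have CG : 0 <= 1 + Ceta * (G + 1) by rewrite addr_ge0// mulr_ge0 ?addr_ge0// ltW.
have MC : 0 <= M ^+ 2 * Calpha + 1 by rewrite addr_ge0// mulr_ge0 ?sqr_ge0// ltW.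
have c80 : 0 <= c8 by apply: mulr_ge0 => //; exact: mulr_ge0.
have C20 : 0 <= C2.
  by apply: mulr_ge0; [exact: mulr_ge0|rewrite addr_ge0// ltW].
pose W := 10 * C + 8 * c8 + C2.
have W0 : 0 < W by rewrite /W; lra.
(* The factor 2 pays for replacing one logarithm by the other when [s >= 1]. *)
exists (2 * W); split; first by rewrite mulr_gt0.
move=> m delta m0 /andP[de0 de1] lambda bound dO O P Z iid.
pose u := 2^-1 * th * ((1 + s) / (1 + 2 * s)).
have lE : lambda = m%:R `^ (- u) by [].
have u0 : 0 < u.
  by apply: mulr_gt0; [rewrite mulr_gt0 ?invr_gt0|rewrite divr_gt0// addr_gt0// mulr_gt0].
have m1 : 1 <= m%:R :> R by rewrite ler1n.
have mR0 : 0 < m%:R :> R by rewrite ltr0n.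
have mn : m%:R != 0 :> R by rewrite gt_eqF.
have l0 : 0 < lambda by exact: powR_gt0.
have l1 : lambda <= 1.
  by rewrite lE -[leRHS](powRr0 m%:R); apply: ler_powR => //; rewrite oppr_le0 ltW.
have sg1 : 0 < 1 + sg by rewrite addr_gt0.
pose k := lambda `^ (1 + sg)^-1.
have k0 : 0 < k by exact: powR_gt0.
have k1 : k <= 1.
  have h : 0 <= (1 + sg)^-1 by rewrite invr_ge0 ltW.
  by have := ler_powRl h (ltW l0) l1; rewrite powR1.
have kl : k * k `^ sg = lambda.
  rewrite -[X in X * _]powRr1 ?(ltW k0)// -powRD ?(gt_eqF k0) ?implybT//.
  by rewrite powR_root// ltW.
(* Chosen to solve [nu^(-eta/alpha) = m nu]: a net of radius [nu^(1/alpha)] then has at most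
   [Ceta * m * nu] cells. *)
pose nu : R := m%:R `^ (- th).
have nu0 : 0 < nu by exact: powR_gt0.
have nu1 : nu <= 1.
  by rewrite -[leRHS](powRr0 m%:R); apply: ler_powR => //; rewrite oppr_le0 ltW.
have k01 : 0 < k <= 1 by rewrite k0.
have nu01 : 0 < nu <= 1 by rewrite nu0.
have [n nC orac] := oracle_inequality md bX cov alpha0 Calpha0 pdK l1K holK kappa0 Kk M0 yM reg
  m0 C0 l0 l1 k01 nu01 sg0 kl approx.
set L := (Num.truncn (y / nu)).+1 in orac.
rewrite expr_div_n -/D0 in orac.
have D1 : 0 < D0 / lambda ^+ 2.
  by rewrite divr_gt0 ?exprn_gt0// addr_gt0// mulr_gt0.
pose N := (L.*2.+1 ^ n)%N.
have N0 : (0 < N)%N by rewrite expn_gt0.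
pose eps := 4 * (D0 / lambda ^+ 2) / m%:R * ln (2 * N%:R / delta).
have [E [mE PE EP]] := orac eps dO O P Z iid.
exists E; split => //.
  apply: le_trans PE; rewrite lee_fin lerB//.
  exact: confidence_level.
move=> w Ew ix c cmin.
have rb := EP w Ew ix c cmin.
have bf : bmeas (kernel_fun K (fun j => (Z j w).1) c).
  by apply: (hol_bmeas md bX cov alpha0); exact: (hol_kernel_fun Calpha0 holK).
rewrite (lsq_error_excess M0 yM reg bf) lee_fin.
have [L1 L2 L3 L4] := log_cardinality m1 de0 de1.
set Lam := ln ((2 + 2 * m%:R) / delta) in L1 L2 L3 L4.
have mnu : m%:R^-1 <= nu.
  by rewrite -powR_inv1 ?(ltW mR0)//; apply: powR_le_exponent.
have lL : 0 <= ln (L.*2.+1%:R : R) <= (G + 1) * Lam by exact: (log_grid y0 nu0 mnu m1).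
have nC' : n%:R <= Ceta * (m%:R * nu).
  suff <- : (nu `^ alpha^-1) `^ (- eta) = m%:R * nu by [].
  have -> : m%:R * nu = m%:R `^ (1 - th).
    by rewrite powRD ?mn ?implybT// powRr1 ?(ltW mR0).
  rewrite /nu -!powRrM; congr (_ `^ _).
  by rewrite /th /T; field; rewrite !gt_eqF// addr_gt0.
have epsE : eps = 4 * (D0 / lambda ^+ 2) / m%:R * (ln (2 / delta) + n%:R * ln (L.*2.+1%:R : R)).
  rewrite /eps; congr (_ * _).
  rewrite mulrAC lnM ?posrE ?divr_gt0 ?ltr0n//; congr (_ + _).
  by rewrite /N natrX lnXn ?ltr0n// mulr_natl.
have epsB : eps <= c8 * (nu / lambda ^+ 2) * Lam.
  rewrite epsE; apply: deviation_size => //.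
  - exact: ltW.
  - exact: le_trans L1.
have nul0 : 0 <= nu / lambda ^+ 2 by rewrite divr_ge0 ?sqr_ge0 ?(ltW nu0).
have q2E : (k `^ sg) ^+ 2 = m%:R `^ (- (u * (1 + sg)^-1 * sg * 2)).
  rewrite -powR_mulrn ?powR_ge0// /k lE -!powRrM; congr (_ `^ _); ring.
have nulE : nu / lambda ^+ 2 = m%:R `^ (- (th - 2 * u)).
  rewrite -powR_mulrn ?(ltW l0)// lE -powRrM -powRN -powRD ?mn ?implybT//.
  by congr (_ `^ _); ring.
have main rate : (k `^ sg) ^+ 2 <= rate -> nu / lambda ^+ 2 <= rate ->
    excess_risk rho M frho (kernel_fun K (fun j => (Z j w).1) c) <= W * rate * Lam.
  by move=> h1 h2; apply: (total_bound C0 c80 C20 rb epsB nul0 h1 h2 L1).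
rewrite /bound; case: ltP => s1.
  have sgs : sg = s by apply: min_l; exact: (ltW (lt_trans s1 (ltr1n R 2))).
  apply: le_trans (main (m%:R `^ (- (s / (1 + 2 * s) * th))) _ _) _.
  - by rewrite q2E sgs rate_exponent_small.
  - by rewrite nulE residual_exponent.
  rewrite ler_wpM2r//; first exact: le_trans L1.
  by rewrite ler_wpM2r ?powR_ge0// ler_peMl ?(ltW W0)// ler1n.
have -> : (3 * T)^-1 = 3^-1 * th by rewrite invfM.
apply: le_trans (main (m%:R `^ (- (3^-1 * th))) _ _) _.
- by rewrite q2E; apply: powR_le_exponent => //; exact: rate_exponent_large.
- rewrite nulE; apply: powR_le_exponent => //; rewrite residual_exponent//.
  exact: residual_exponent_large.
rewrite [2 * W]mulrC -!mulrA ler_pM2l//.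
by rewrite mulrCA ler_wpM2l ?powR_ge0.
Qed.
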